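(* Let $d\ge1$, $n\ge2$. Let $X_1,\dots,X_n$ be independent random vectors in $\mathbb{R}^d$ with $X_i\sim f_{G_i}$ for probability measures $G_1,\dots,G_n$ on $\mathbb{R}^d$, and let $\bar G_n:=(G_1+\dots+G_n)/n$. Let $\hat f_n$ be an NPMLE based on $X_1,\dots,X_n$. Below $C_d$ denotes a positive constant depending on $d$ alone. 1. Suppose that $\bar G_n$ is supported on a compact subset $S$ of $\mathbb{R}^d$. Then $$\mathbb{E}\,\mathfrak{H}^2(\hat f_n,f_{\bar G_n})\le C_d\frac{\mathrm{Vol}(S^1)}{n}(\log n)^{d+1}.$$ 2. Suppose there exist a compact subset $S\subseteq\mathbb{R}^d$ and real numbers $0<\alpha\le2$ and $K\ge1$ such that $\mu_p(\mathfrak{d}_S,\bar G_n)\le Kp^{1/\alpha}$ for all $p\ge1$. Then $$\mathbb{E}\,\mathfrak{H}^2(\hat f_n,f_{\bar G_n})\le C_d\frac{\mathrm{Vol}(S^1)(Ke^{1/\alpha})^d}{n}\left(\sqrt{\log n}\right)^{(2d/\alpha)+d+2}.$$ 3. Suppose there exist a compact set $S\subseteq\mathbb{R}^d$ and real numbers $\mu>0$ and $p>0$ such that $\mu_p(\mathfrak{d}_S,\bar G_n)\le\mu$. Then there exists a positive constant $C_{d,\mu,p}$ (depending only on $d,\mu$ and $p$) such that $$\mathbb{E}\,\mathfrak{H}^2(\hat f_n,f_{\bar G_n})\le C_{d,\mu,p}\left(\frac{\mathrm{Vol}(S^1)}{n}\right)^{\frac{p}{p+d}}\left(\sqrt{\log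 n}\right)^{\frac{2d+2p+dp}{p+d}}.$$
   Context: $\|\cdot\|$ is the Euclidean norm and $\phi_d(z):=(2\pi)^{-d/2}\exp(-\|z\|^2/2)$. For a probability measure $G$ on $\mathbb{R}^d$, $f_G(x):=\int\phi_d(x-\theta)\,dG(\theta)$, and $\mathcal{M}$ is the class of all densities $f_G$ as $G$ ranges over all probability measures on $\mathbb{R}^d$. An NPMLE based on $X_1,\dots,X_n$ is any maximizer $\hat f_n\in\arg\max_{f\in\mathcal{M}}\frac1n\sum_{i=1}^n\log f(X_i)$ (maximizers exist but need not be unique; the result is for any of them). $\mathfrak{H}^2(f,g):=\int(\sqrt{f(x)}-\sqrt{g(x)})^2dx$ is the squared Hellinger distance. For non-empty $S\subseteq\mathbb{R}^d$: $\mathfrak{d}_S(x):=\inf_{u\in S}\|x-u\|$, $S^1:=\{x:\mathfrak{d}_S(x)\le1\}$, and $\mu_p(\mathfrak{d}_S,G):=\left(\int\mathfrak{d}_S(\theta)^p\,dG(\theta)\right)^{1/p}$ for $p>0$. $\mathrm{Vol}$ is Lebesgue measure. *)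

(* Defs.v *)
From HB Require Import structures.
From mathcomp Require Import all_boot all_order all_algebra.
From mathcomp Require Import all_classical all_reals all_analysis.

Set Implicit Arguments.
Unset Strict Implicit.
Unset Printing Implicit Defensive.

Import Order.TTheory GRing.Theory Num.Theory.
Import numFieldNormedType.Exports.

Local Open Scope classical_set_scope.
Local Open Scope ring_scope.

Definition rV_display : Type -> nat -> measure_display.
Proof. exact (fun _ _ => default_measure_display). Qed.

(* The sigma-algebra of R^d is generated by the coordinate maps, as the library
   does for d.-tuple R; it contains the open sets ([open_measurable_rV] below),
   hence it is the Borel sigma-algebra. *)
Section measurable_rV.
Context {R : realType} (d : nat).

Definition rV_coord (i : 'I_d) (x : 'rV[R]_d) : measurableTypeR R := x ord0 i.

Let rV_set0 : g_sigma_preimage rV_coord set0.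
Proof. exact: sigma_algebra0. Qed.

Let rV_setC A : g_sigma_preimage rV_coord A -> g_sigma_preimage rV_coord (~` A).
Proof. exact: sigma_algebraC. Qed.

Let rV_bigcup (F : (set 'rV[R]_d)^nat) :
  (forall i, g_sigma_preimage rV_coord (F i)) ->
  g_sigma_preimage rV_coord (\bigcup_i (F i)).
Proof. exact: sigma_algebra_bigcup. Qed.

HB.instance Definition _ := @isMeasurable.Build (rV_display R d) 'rV[R]_d
  (g_sigma_preimage rV_coord) rV_set0 rV_setC rV_bigcup.

End measurable_rV.

Section measurable_rV_theory.
Context {R : realType}.

Lemma measurable_rV_coord d (i : 'I_d) :
  measurable_fun [set: 'rV[R]_d] (rV_coord i).
Proof.
move=> _ Y mY; rewrite setTI; apply: sub_sigma_algebra => /=.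
rewrite -bigcup_seq/=; exists i => /=; first by rewrite mem_index_enum.
by exists Y => //; rewrite setTI.
Qed.

Lemma measurable_fun_rV d dT (T : measurableType dT) (f : T -> 'rV[R]_d) :
  (forall i, measurable_fun setT (rV_coord i \o f)) -> measurable_fun setT f.
Proof.
move=> mf.
suff sub : g_sigma_preimage (@rV_coord R d) `<=`
    [set B | measurable (f @^-1` B)].
  by move=> _ B mB; rewrite setTI; exact: sub.
apply: smallest_sub.
  split=> /=.
  - by rewrite preimage_set0.
  - by move=> B mB; rewrite setTD preimage_setC; exact: measurableC.
  - by move=> F mF; rewrite preimage_bigcup; exact: bigcupT_measurable.
rewrite -bigcup_seq/=; apply: bigcup_sub => i _ B [Y mY <-] /=.
by rewrite setTI -comp_preimage -[X in measurable X]setTI; exact: mf.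
Qed.

Lemma open_measurable_rV d (U : set 'rV[R]_d) : open U -> measurable U.
Proof.
move=> oU.
pose box (k : {ffun 'I_d -> rat} * rat) : set 'rV[R]_d :=
  [set y | forall i, `|y ord0 i - ratr (k.1 i)| < ratr k.2].
pose B k := if `[< box k `<=` U >] then box k else set0.
have mbox k : measurable (box k).
  have -> : box k =
      \bigcap_(i in setT) (rV_coord i @^-1` ball (ratr (k.1 i) : R) (ratr k.2)).
    apply/seteqP; split=> [y ky i _|y ky i].
      by rewrite /= /ball/= distrC; exact: ky.
    by have := ky i I; rewrite /= /ball/= distrC.
  apply: fin_bigcap_measurable => // i _.
  rewrite -[X in measurable X]setTI; apply: measurable_rV_coord => //.
  exact: (measurable_realfun.open_measurable (ball_open _ _)).
have -> : U = \bigcup_k B k.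
  apply/seteqP; split=> [x Ux|x [k _]]; last first.
    by rewrite /B; case: ifPn => // /asboolP; exact.
  have /nbhs_ballP[e /= e0 xeU] : nbhs x U by exact: open_nbhs_nbhs.
  have [r] := rat_in_itvoo (divr_gt0 e0 (@ltr0n R 2)).
  rewrite in_itv/= => /andP[r0 re].
  have qP i : exists q : rat, `|x ord0 i - ratr q| < ratr r.
    have [|q] := @rat_in_itvoo R (x ord0 i - ratr r) (x ord0 i + ratr r).
      by rewrite ltrD2l gt0_cp.
    by rewrite in_itv/= => /andP[? ?]; exists q; rewrite ltr_distlC; apply/andP.
  pose q := [ffun i => xget 0 [set q : rat | `|x ord0 i - ratr q| < ratr r]].
  have xq i : `|x ord0 i - ratr (q i)| < ratr r.
    by rewrite ffunE; case: xgetP => [? _ //|/(_ _)]; have [p ?] := qP i; move=> /(_ p).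
  exists (q, r) => //; rewrite /B ifT//; apply/asboolP => y yq; apply: xeU.
  split=> // i j; rewrite (ord1 i) /ball/=.
  rewrite (splitr e) (le_lt_trans (ler_distD (ratr (q j)) _ _))// ltrD//.
    exact: lt_trans (xq j) re.
  by rewrite distrC; exact: lt_trans (yq j) re.
apply: countable_bigcupT_measurable => [|k]; first exact: countableP.
by rewrite /B; case: ifPn.
Qed.

End measurable_rV_theory.

Section lebesgue_rV.
Context {R : realType}.

Section step.
Variables (d : nat) (m : {sigma_finite_measure set 'rV[R]_d -> \bar R}).

Definition rV_cons (p : measurableTypeR R * 'rV[R]_d) : 'rV[R]_d.+1 :=
  row_mx (p.1)%:M p.2.

Definition rV_uncons (x : 'rV[R]_d.+1) : measurableTypeR R * 'rV[R]_d :=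
  (x ord0 ord0, @rsubmx _ 1 1 d x).

Lemma measurable_rV_cons : measurable_fun setT rV_cons.
Proof.
apply: measurable_fun_rV => i; case: (unliftP ord0 i) => [j|] ->.
  have -> : rV_coord (lift ord0 j) \o rV_cons = rV_coord j \o snd.
    apply/funext => -[x y]/=; rewrite /rV_coord /rV_cons/=.
    have -> : lift ord0 j = rshift 1 j by apply/val_inj.
    exact: row_mxEr.
  exact: measurableT_comp (measurable_rV_coord _) measurable_snd.
have -> : rV_coord ord0 \o rV_cons = fst.
  apply/funext => -[x y]/=; rewrite /rV_coord /rV_cons/=.
  have -> : ord0 = lshift d (ord0 : 'I_1) by apply/val_inj.
  by rewrite (@row_mxEl _ 1 1 d) mxE mulr1n.
exact: measurable_fst.
Qed.

Lemma measurable_rV_uncons : measurable_fun setT rV_uncons.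
Proof.
apply/measurable_fun_pairP; split; first exact: measurable_rV_coord.
apply: measurable_fun_rV => i.
have -> : rV_coord i \o (snd \o rV_uncons) = rV_coord (rshift 1 i).
  by apply/funext => x; rewrite /rV_coord /= mxE.
exact: measurable_rV_coord.
Qed.

Lemma rV_consK : cancel rV_cons rV_uncons.
Proof.
move=> [x y]; rewrite /rV_cons /rV_uncons row_mxKr/=; congr pair.
have -> : ord0 = lshift d (ord0 : 'I_1) by apply/val_inj.
by rewrite (@row_mxEl _ 1 1 d) mxE mulr1n.
Qed.

Definition lebesgue_rV_step : set 'rV[R]_d.+1 -> \bar R :=
  pushforward (lebesgue_measure \x m)%E rV_cons.

Let lebesgue_rV_step_measure : {measure set 'rV[R]_d.+1 -> \bar R} :=
  measure_function_pushforward__canonical__measure_function_Measure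
    (lebesgue_measure \x m)%E measurable_rV_cons.

HB.instance Definition _ := isMeasure.Build _ _ _ lebesgue_rV_step
  (measure0 lebesgue_rV_step_measure) (@measure_ge0 _ _ _ lebesgue_rV_step_measure)
  (@measure_semi_sigma_additive _ _ _ lebesgue_rV_step_measure).

Let lebesgue_rV_step_sigma_finite : sigma_finite setT lebesgue_rV_step.
Proof.
have [[F FT Foo]] := lebesgue_integral_fubini.measure_function_Measure_isSigmaFinite__to__measure_function_isSigmaFinite
  lebesgue_measure m.
exists (fun n => rV_uncons @^-1` F n).
  by rewrite -preimage_bigcup -FT preimage_setT.
move=> n; have [mF ?] := Foo n; split.
  by rewrite -[X in measurable X]setTI; exact: measurable_rV_uncons.
by rewrite /lebesgue_rV_step /pushforward -comp_preimage (_ : _ \o _ = id)//;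
  apply/funext/rV_consK.
Qed.

HB.instance Definition _ := Measure_isSigmaFinite.Build _ _ _
  lebesgue_rV_step lebesgue_rV_step_sigma_finite.

End step.

Fixpoint lebesgue_rV (d : nat) : {sigma_finite_measure set 'rV[R]_d -> \bar R} :=
  match d with
  | 0 => [the sigma_finite_measure _ _ of dirac (0 : 'rV[R]_0)]
  | d'.+1 => [the sigma_finite_measure _ _ of lebesgue_rV_step (lebesgue_rV d')]
  end.

End lebesgue_rV.

Section lebesgue_rV_theory.
Context {R : realType}.

Lemma lebesgue_rV_box d (A : 'I_d -> set (measurableTypeR R)) :
  (forall i, measurable (A i)) ->
  lebesgue_rV d [set x | forall i, A i (x ord0 i)] =
  (\prod_(i < d) lebesgue_measure (A i))%E.
Proof.
elim: d A => [|d IHd] A mA.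
  rewrite big_ord0 /= diracE mem_set//=; by case.
rewrite big_ord_recl -IHd//= /lebesgue_rV_step /pushforward.
rewrite -product_measure1E//; last first.
  rewrite [X in measurable X](_ : _ = \bigcap_(i in setT)
      (rV_coord i @^-1` A (lift ord0 i))); last first.
    by apply/seteqP; split=> y yA i; [move=> _; exact: yA|exact: yA i I].
  apply: fin_bigcap_measurable => // i _.
  by rewrite -[X in measurable X]setTI; exact: measurable_rV_coord.
congr (_ _); apply/seteqP.
have E0 x (y : 'rV[R]_d) : rV_cons (x, y) ord0 ord0 = x.
  rewrite /rV_cons/=; have -> : ord0 = lshift d (ord0 : 'I_1) by apply/val_inj.
  by rewrite (@row_mxEl _ 1 1 d) mxE mulr1n.
have ES x (y : 'rV[R]_d) i : rV_cons (x, y) ord0 (lift ord0 i) = y ord0 i.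
  rewrite /rV_cons/=; have -> : lift ord0 i = rshift 1 i by apply/val_inj.
  exact: row_mxEr.
split=> [[x y] /= xyA|[x y] /= [xA yA] i].
  by split=> [|i]; [rewrite -(E0 x y)|rewrite -(ES x y)]; exact: xyA.
by case: (unliftP ord0 i) => [j|] ->; [rewrite ES; exact: yA|rewrite E0].
Qed.

End lebesgue_rV_theory.

Section average_measure.
Local Open Scope ereal_scope.
Context {dT} {T : measurableType dT} {R : realType} (n : nat).
Variable G : 'I_n -> probability T R.

Definition average_measure (A : set T) : \bar R :=
  (n%:R^-1)%:E * \sum_(i < n) G i A.

Let Gnat (k : nat) : {measure set T -> \bar R} :=
  if insub k is Some i then G i else mzero.

Let invn_ge0 : (0 <= n%:R^-1 :> R)%R.
Proof. by rewrite invr_ge0. Qed.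

Let average_measureE : average_measure = mscale (NngNum invn_ge0) (msum Gnat n).
Proof.
apply/funext => A; rewrite /average_measure /mscale/= /msum; congr *%E.
by apply: eq_bigr => i _; rewrite /Gnat valK.
Qed.

Let average_measure0 : average_measure set0 = 0.
Proof. by rewrite average_measureE measure0. Qed.

Let average_measure_ge0 A : 0 <= average_measure A.
Proof. by rewrite average_measureE measure_ge0. Qed.

Let average_measure_sigma_additive : semi_sigma_additive average_measure.
Proof. by rewrite average_measureE; exact: measure_semi_sigma_additive. Qed.

HB.instance Definition _ := isMeasure.Build _ _ _ average_measure
  average_measure0 average_measure_ge0 average_measure_sigma_additive.

End average_measure.

Section independence.
Context {dO dT} {Omega : measurableType dO} {T : measurableType dT}.
Context {R : realType} {P : probability Omega R}.

Definition mutually_independent n (X : 'I_n -> {RV P >-> T}) : Prop :=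
  forall (J : {set 'I_n}) (A : 'I_n -> set T), (forall i, measurable (A i)) ->
  P (\bigcap_(i in [set` J]) (X i @^-1` A i)) =
  (\prod_(i in J) P (X i @^-1` A i))%E.

End independence.

Section gaussian_mixture.
Context {R : realType} {d : nat}.
Implicit Types (x z u : 'rV[R]_d) (f g : 'rV[R]_d -> R) (S : set 'rV[R]_d).
Implicit Types G : {measure set 'rV[R]_d -> \bar R}.

(* The library's norm on row vectors is the sup norm. *)
Definition l2norm x : R := Num.sqrt (\sum_(i < d) x ord0 i ^+ 2).

Definition gaussian_density z : R :=
  (2 * pi) `^ (- (d%:R / 2)) * expR (- (l2norm z ^+ 2 / 2)).

Definition mixture_density G x : R := \int[G]_theta gaussian_density (x - theta).

Definition mixture_class : set ('rV[R]_d -> R) :=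
  [set mixture_density G | G in [set: probability 'rV[R]_d R]].

Definition avg_log_likelihood n (X : 'I_n -> 'rV[R]_d) f : R :=
  n%:R^-1 * \sum_(i < n) ln (f (X i)).

Definition is_NPMLE n (X : 'I_n -> 'rV[R]_d) f : Prop :=
  mixture_class f /\
  forall g, mixture_class g -> avg_log_likelihood X g <= avg_log_likelihood X f.

Definition hellinger2 f g : R :=
  \int[lebesgue_rV d]_x (Num.sqrt (f x) - Num.sqrt (g x)) ^+ 2.

Definition dist_to S x : R := inf [set l2norm (x - u) | u in S].

Definition enlargement S : set 'rV[R]_d := [set x | dist_to S x <= 1].

(* Extended-real valued, so that a finite upper bound on it asserts that the
   p-th moment exists. *)
Definition dist_moment (p : R) S G : \bar R :=
  ((\int[G]_theta (dist_to S theta `^ p)%:E) `^ p^-1)%E.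

Definition has_density dO (Omega : measurableType dO) (P : probability Omega R)
    (X : {RV P >-> 'rV[R]_d}) f : Prop :=
  forall A, measurable A ->
  distribution P X A = (\int[lebesgue_rV d]_(x in A) (f x)%:E)%E.

End gaussian_mixture.

(* Main.v *)
Require Import Defs.
From HB Require Import structures.
From mathcomp Require Import all_boot all_order all_algebra.
From mathcomp Require Import all_classical all_reals all_analysis.
From mathcomp Require Import simple_functions measurable_fun_approximation measurable_realfun.
From mathcomp Require Import ring lra zify.

(** The Hellinger risk of a maximum likelihood estimator is governed by the cost of
describing the class of candidates by finitely many brackets. Suppose that every
mixture f is bounded, on a set D, by g_j + h_j for some j in a finite set J, where
g_j is a density almost as far from f0 = f_Gbar as f is and the envelope h_j has
integral at most tau^2. Put Y_j = prod_i sqrt ((g_j + h_j)(X_i) / f0(X_i)). By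
independence E Y_j is a product of integrals against the n different densities of
the X_i, and ln b <= b - 1 turns this product into exp (n (tau - H^2(g_j, f0) / 2)),
in which only the average f0 of these densities appears. Since the likelihood of the NPMLE is at least that
of f0, Y_j is bounded below for the index j of the NPMLE, except for the factors
with X_i outside D. Comparing with the average over J of the normalized Y_j gives
npmle_risk_le:
   E H^2 <= e + 2 tau + (2 / n) (ln |J| + 1) + int_(D^c) ln (1 / h0) f0,
with h0 a common positive lower bound of the envelopes.

The brackets come from mixture_net. Space is cut into small cells. For theta in a
cell the kernel exp (-|x - theta|^2 / 2) is, up to a geometrically small error, a
sum of products of a function of x and a function of theta, so that the contribution
of the cell to f_G depends only on finitely many moments of G on the cell, and
rounding these moments leaves finitely many classes. Cells not close to D matter
only if their mass is at least 1 / m, which at most m of them have.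

The set D is the union of the cubes of half-side M about a maximal packing s_1, ...,
s_m of S, where m is at most a multiple of the volume of S^1 (packing). With cells
of side comparable to r = min (M, sqrt (ln n)), ln |J| is at most of the order of
m M^d (ln n)^(d / 2 + 1) (discretization_parameters). The floor h0 is a mixture of
Cauchy densities: outside D the logarithm of 1 / h0 grows only logarithmically, and
the last integral is bounded by a Gaussian tail and a moment of the distance d_S
(tail_le). Altogether, for v = Vol(S^1), L = sqrt (ln n), all M >= 8 and all p > 0,
risk_le_volume gives
   E H^2 <= C ((v / n) M^d L^(d+2) + L^(d+2) e^(-M^2 / 32))
            + C (L^2 + 1 / p) (3 / M)^p int d_S^p dGbar.

The three bounds are choices of M and p: M = 16 L when d_S vanishes almost surely;
p = ln n and M = 8 e K (ln n)^(1 / alpha) under growing moments; and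
M = (v L^d / n)^(-1 / (p + d)), which makes the first and the third terms equal up
to constants, when a single moment is bounded. Outside the range where these choices
make sense the bounds follow from H^2 <= 2. *)

Set Implicit Arguments.
Unset Strict Implicit.
Unset Printing Implicit Defensive.

Import Order.TTheory GRing.Theory Num.Theory.
Import numFieldNormedType.Exports HBNNSimple.

Local Open Scope classical_set_scope.
Local Open Scope ring_scope.

(** * Integrals against laws and densities, expectations of products *)

Section weighted.
Local Open Scope ereal_scope.
Context d d' (T : measurableType d) (T' : measurableType d') (R : realType).
Variables (nu : {measure set T -> \bar R}) (mu : {measure set T' -> \bar R}).
Variables (V : T -> R) (k : T -> T').
Hypothesis V0 : forall x, (0 <= V x)%R.
Hypothesis mV : measurable_fun [set: T] V.
Hypothesis mk : measurable_fun [set: T] k.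
Hypothesis VE : forall A, measurable A ->
  \int[nu]_x ((V x)%:E * (\1_A (k x))%:E) = mu A.

Let weighted_nnsfun (h : {nnsfun T' >-> R}) :
  \int[nu]_x ((V x)%:E * (h (k x))%:E) = \int[mu]_y (h y)%:E.
Proof.
under [RHS]eq_integral do rewrite fimfunE -fsumEFin//.
under eq_integral.
  move=> x _; rewrite fimfunE -fsumEFin// ge0_mule_fsumr; last first.
    by move=> r; rewrite EFinM nnfun_muleindic_ge0.
  over.
have mkA r : measurable_fun [set: T]
    ((fun x => r%:E * (\1_(h @^-1` [set r]) (k x))%:E) : T -> \bar R).
  apply: emeasurable_funM => //; apply/measurable_EFinP.
  exact: (measurableT_comp (g := k) (measurable_indic _)).
rewrite !ge0_integral_fsum//; first last.
- by move=> r x _; rewrite mule_ge0 ?lee_fin ?V0//; have := nnfun_muleindic_ge0 h r (k x).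
- move=> r; apply: emeasurable_funM; first exact/measurable_EFinP.
  exact: mkA.
- by move=> r y _; rewrite EFinM nnfun_muleindic_ge0.
- by move=> r; exact/measurable_EFinP/measurableT_comp.
apply: eq_fsbigr => r; rewrite inE => -[y _ hyr].
have r0 : (0 <= r)%R by rewrite -hyr.
under eq_integral do rewrite EFinM muleCA.
rewrite ge0_integralZl//; last 2 first.
- apply: emeasurable_funM; apply/measurable_EFinP => //.
  exact: (measurableT_comp (g := k) (measurable_indic _)).
- by move=> x _; rewrite mule_ge0 ?lee_fin.
rewrite VE; last exact: measurable_sfunP.
by rewrite integralZl_indic_nnsfun// integral_indic// setIT.
Qed.

(** It suffices to compare both sides on indicators. The weight V is a density in the
passage from the law of a variable to its density, and the product of the other
factors in the use of independence. *)
Lemma ge0_integral_weighted (u : T' -> \bar R) :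
  measurable_fun [set: T'] u -> (forall y, 0 <= u y) ->
  \int[nu]_x ((V x)%:E * u (k x)) = \int[mu]_y u y.
Proof.
move=> mu_ u0.
pose f n := EFin \o nnsfun_approx measurableT mu_ n.
have fu y : (fun n => f n y) @ \oo --> u y.
  by apply: (@cvg_nnsfun_approx _ _ _ _ measurableT _ mu_).
have nd y n m : (n <= m)%N -> f n y <= f m y.
  by move=> nm; rewrite lee_fin; exact/lefP/nd_nnsfun_approx.
have f0 n y : 0 <= f n y by rewrite lee_fin.
have mf n : measurable_fun [set: T'] (f n) by exact/measurable_EFinP.
transitivity (limn (fun n => \int[nu]_x ((V x)%:E * f n (k x)))).
  rewrite -monotone_convergence//.
  - apply: eq_integral => x _; apply/esym/cvg_lim => //.
    exact: cvgeZl.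
  - move=> n; apply: emeasurable_funM; first exact/measurable_EFinP.
    exact: measurableT_comp.
  - by move=> n x _; rewrite mule_ge0 ?lee_fin.
  - by move=> x _ n m nm; apply: lee_wpmul2l; [rewrite lee_fin|exact: nd].
transitivity (limn (fun n => \int[mu]_y f n y)).
  by congr (limn _); apply/funext => n; rewrite weighted_nnsfun.
rewrite -monotone_convergence//.
- by apply: eq_integral => y _; exact/cvg_lim.
- by move=> y _ n m; exact: nd.
Qed.
End weighted.

Lemma integral_indic_preimage {dO dT} {Omega : measurableType dO}
    {T : measurableType dT} {R : realType} (P : {measure set Omega -> \bar R})
    (X : Omega -> T) A : measurable_fun [set: Omega] X -> measurable A ->
  (\int[P]_w (\1_A (X w))%:E = P (X @^-1` A))%E.
Proof.
move=> mX mA; rewrite -[in RHS](setIT (X @^-1` A)) -integral_indic//.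
by rewrite -[X in measurable X]setTI; exact: mX.
Qed.

(** The factors are upgraded one at a time from indicators to nonnegative functions,
the remaining factors serving as the weight of ge0_integral_weighted. *)
Lemma ge0_expectation_prod {dO dT} {Omega : measurableType dO}
    {T : measurableType dT} {R : realType} (P : probability Omega R) n
    (X : 'I_n -> {RV P >-> T}) (u : 'I_n -> T -> R) :
  mutually_independent X ->
  (forall i, measurable_fun [set: T] (u i)) -> (forall i y, 0 <= u i y) ->
  (forall i, \int[P]_w (u i (X i w))%:E < +oo)%E ->
  (\int[P]_w (\prod_(i < n) u i (X i w))%:E =
   \prod_(i < n) \int[P]_w (u i (X i w))%:E)%E.
Proof.
move=> indX mu u0 uoo.
have mX i : measurable_fun [set: Omega] (X i) by [].
pose v k (A : 'I_n -> set T) (i : 'I_n) : T -> R := if (i < k)%N then u i else \1_(A i).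
have v0 k A i y : 0 <= v k A i y by rewrite /v; case: ifP.
have mv k A i : (forall i, measurable (A i)) -> measurable_fun [set: T] (v k A i).
  by move=> mA; rewrite /v; case: ifP.
have voo k A i : (forall i, measurable (A i)) -> (\int[P]_w (v k A i (X i w))%:E < +oo)%E.
  move=> mA; rewrite /v; case: ifP => // _.
  rewrite integral_indic_preimage// (le_lt_trans (probability_le1 _ _)) ?ltry//.
  by rewrite -[X in measurable X]setTI; exact: mX.
suff H : forall k (A : 'I_n -> set T), (forall i, measurable (A i)) ->
   (\int[P]_w (\prod_(i < n) v k A i (X i w))%:E =
    \prod_(i < n) \int[P]_w (v k A i (X i w))%:E)%E.
  have := H n (fun=> setT) (fun=> measurableT).
  have vE i : v n (fun=> setT) i = u i by rewrite /v ltn_ord.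
  under eq_integral do under eq_bigr do rewrite vE.
  by under [in X in _ = X -> _]eq_bigr do rewrite vE.
elim=> [|k IH] A mA.
  have := indX [set: 'I_n]%SET A mA.
  rewrite (eq_bigl xpredT); last by move=> i; rewrite inE.
  have mXA i : measurable (X i @^-1` A i).
    by rewrite -[X in measurable X]setTI; exact: mX.
  have vE i : (\int[P]_w (v 0 A i (X i w))%:E = P (X i @^-1` A i))%E.
    exact: integral_indic_preimage.
  under [in X in _ -> _ = X]eq_bigr do rewrite vE.
  move=> <-; rewrite -[in RHS](setIT (\bigcap_(i in _) _)) -integral_indic//; last first.
    by apply: fin_bigcap_measurable => //; exact: finite_finset.
  apply: eq_integral => w _; congr EFin; rewrite indicE.
  have [wA|/negP wA] := boolP (_ \in _).
    rewrite big1// => i _; rewrite /v/= indicE mem_set//.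
    by move/set_mem: wA => /(_ i); apply; rewrite /= inE.
  have [i wi] : exists i, ~ A i (X i w).
    apply: contrapT => /forallNP h; apply: wA; apply/mem_set => i _ /=.
    by apply: contrapT; exact: h.
  by rewrite (bigD1 i)//= /v/= indicE memNset// mul0r.
have [kn|nk] := ltnP k n; last first.
  have vE B i : v k.+1 B i = v k B i.
    by rewrite /v !(leq_trans (ltn_ord i))// leqW.
  under eq_integral do under eq_bigr do rewrite vE.
  by under [RHS]eq_bigr do rewrite vE; rewrite IH.
pose i0 := Ordinal kn.
have vE B i : i != i0 -> v k.+1 A i = v k (fun j => if j == i0 then B else A j) i.
  move=> ii0; rewrite /v (negbTE ii0) ltnS leq_eqVlt.
  by case: eqP => //= ik; move: ii0; rewrite -val_eqE/= ik eqxx.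
have vE0 : v k.+1 A i0 = u i0 by rewrite /v/= ltnSn.
have vE1 B : v k (fun j => if j == i0 then B else A j) i0 = \1_B.
  by rewrite /v/= ltnn eqxx.
pose V w := \prod_(i < n | i != i0) v k.+1 A i (X i w).
pose c := (\prod_(i < n | i != i0) \int[P]_w (v k.+1 A i (X i w))%:E)%E.
have c0 : (0 <= c)%E.
  by apply: prode_ge0 => i _; apply: integral_ge0 => w _; rewrite lee_fin.
have cfin : c \is a fin_num.
  apply: prode_fin_num => i _; rewrite ge0_fin_numE; first exact: voo.
  by apply: integral_ge0 => w _; rewrite lee_fin.
have fc0 : 0 <= fine c by exact: fine_ge0.
transitivity (\int[P]_w ((V w)%:E * (u i0 (X i0 w))%:E))%E.
  by apply: eq_integral => w _; rewrite (bigD1 i0)//= vE0 mulrC.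
rewrite (@ge0_integral_weighted _ _ _ _ _ _
  (mscale (NngNum fc0) (distribution P (X i0))) _ _ _ _ _ _ (EFin \o u i0)) //=.
- rewrite ge0_integral_mscale//=; last by move=> y _; rewrite lee_fin.
    rewrite (bigD1 i0)//= vE0 muleC fineK//; congr (_ * _)%E.
    by rewrite ge0_integral_distribution//; [exact/measurable_EFinP|move=> y; rewrite lee_fin].
  exact/measurable_EFinP.
- by move=> w; apply: prodr_ge0.
- rewrite /V; under [X in measurable_fun _ X]eq_fun do rewrite -big_filter.
  by apply: measurable_prod => i _; apply: measurableT_comp => //; exact: mv.
- move=> B mB.
  have := IH (fun j => if j == i0 then B else A j).
  rewrite (bigD1 i0)//= vE1.
  rewrite (eq_bigr (fun i => \int[P]_w (v k.+1 A i (X i w))%:E)%E); last first.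
    by move=> i ii0; rewrite -vE.
  rewrite -/c.
  have -> : (\int[P]_w (\1_B (X i0 w))%:E = distribution P (X i0) B)%E.
    exact: integral_indic_preimage.
  rewrite /mscale/= fineK// muleC => <-.
    apply: eq_integral => w _; rewrite (bigD1 i0)//= vE1 mulrC EFinM.
    by congr (_%:E * _)%E; apply: eq_bigr => i ii0; rewrite -vE.
  by move=> i; case: eqP.
- exact/measurable_EFinP.
- by move=> y; rewrite lee_fin.
Qed.

(** * Product integrals over row vectors *)

Section product_integrals.
Context {R : realType}.
Local Notation mu := (@lebesgue_measure R).

Lemma rV_cons0 d (x : R) (y : 'rV[R]_d) : rV_cons (x, y) ord0 ord0 = x.
Proof.
rewrite /rV_cons/=; have -> : ord0 = lshift d (ord0 : 'I_1) by apply/val_inj.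
by rewrite (@row_mxEl _ 1 1 d) mxE mulr1n.
Qed.

Lemma rV_consS d (x : R) (y : 'rV[R]_d) i : rV_cons (x, y) ord0 (lift ord0 i) = y ord0 i.
Proof.
rewrite /rV_cons/=; have -> : lift ord0 i = rshift 1 i by apply/val_inj.
exact: row_mxEr.
Qed.

Lemma ge0_integral_lebesgue_rVS d (f : 'rV[R]_d.+1 -> \bar R) :
  measurable_fun [set: 'rV[R]_d.+1] f -> (forall x, 0 <= f x)%E ->
  (\int[lebesgue_rV d.+1]_x f x = \int[mu]_x \int[lebesgue_rV d]_y f (rV_cons (x, y)))%E.
Proof.
move=> mf f0.
transitivity (\int[pushforward (mu \x lebesgue_rV d)%E (@rV_cons R d)]_x f x)%E.
  by apply: eq_measure_integral; first exact: measurable_rV_cons.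
rewrite ge0_integral_pushforward//; last exact: measurable_rV_cons.
rewrite preimage_setT (@fubini_tonelli1 _ _ _ _ _ mu (lebesgue_rV d))//; last first.
  by move=> x; exact: f0.
by apply: measurableT_comp => //; exact: measurable_rV_cons.
Qed.

Lemma measurable_rV_prod d (u : 'I_d -> R -> R) :
  (forall i, measurable_fun [set: R] (u i)) ->
  measurable_fun [set: 'rV[R]_d] (fun x => \prod_(i < d) u i (x ord0 i)).
Proof.
move=> mu_; apply: measurable_prod => i _.
exact: (measurableT_comp (f := u i) (mu_ i) (measurable_rV_coord i)).
Qed.

Lemma ge0_integral_rV_prod d (u : 'I_d -> R -> R) :
  (forall i, measurable_fun [set: R] (u i)) -> (forall i t, 0 <= u i t) ->
  (\int[lebesgue_rV d]_x (\prod_(i < d) u i (x ord0 i))%:E =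
   \prod_(i < d) \int[mu]_t (u i t)%:E)%E.
Proof.
elim: d u => [|d IH] u mu_ u0.
  under eq_integral do rewrite big_ord0.
  by rewrite integral_cst//= diracT mule1 big_ord0.
rewrite ge0_integral_lebesgue_rVS; last 2 first.
- by apply/measurable_EFinP; exact: measurable_rV_prod.
- by move=> x; rewrite lee_fin prodr_ge0.
under eq_integral => x _.
  under eq_integral => y _.
    rewrite big_ord_recl rV_cons0.
    under eq_bigr do rewrite rV_consS.
    rewrite EFinM.
    over.
  rewrite ge0_integralZl//; last 3 first.
  - apply/measurable_EFinP.
    by apply: (measurable_rV_prod (u := fun i => u (lift ord0 i))) => i; exact: mu_.
  - by move=> y _; rewrite lee_fin prodr_ge0.
  - by rewrite lee_fin.
  rewrite (IH (fun i => u (lift ord0 i)))//.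
  over.
rewrite ge0_integralZr//.
- by rewrite big_ord_recl.
- by apply/measurable_EFinP; exact: mu_.
- by move=> x _; rewrite lee_fin.
- by apply: prode_ge0 => i _; apply: integral_ge0 => t _; rewrite lee_fin.
Qed.

Lemma integral_gauss_scaled (c s : R) : 0 < s ->
  (\int[mu]_t (expR (- (t - c) ^+ 2 / (s ^+ 2 *+ 2)))%:E =
   (Num.sqrt (s ^+ 2 * pi *+ 2))%:E)%E.
Proof.
move=> s0; have sn0 : s != 0 by rewrite gt_eqF.
have := integral_normal_pdf c s.
rewrite normal_pdfE//; under eq_integral do rewrite EFinM.
have mn := @measurable_normal_fun R c s.
rewrite ge0_integralZl//; last 3 first.
- exact/measurable_EFinP.
- by move=> x _; rewrite lee_fin expR_ge0.
- by rewrite lee_fin normal_peak_ge0.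
have p0 : normal_peak s != 0 by rewrite gt_eqF// normal_peak_gt0.
move=> h; rewrite -[LHS]mul1e.
have -> : (1%E = (normal_peak s)^-1%:E * (normal_peak s)%:E)%E.
  by rewrite -EFinM mulVf.
by rewrite -muleA h mule1 /normal_peak invrK.
Qed.

Lemma integral_cauchy (c : R) :
  (\int[mu]_t ((pi * (1 + (t - c) ^+ 2))^-1)%:E = 1)%E.
Proof.
have cc : continuous (fun t : R => (pi * oneDsqr t)^-1).
  move=> t; apply: cvgV; first by rewrite mulf_neq0 ?gt_eqF ?pi_gt0 ?oneDsqr_gt0.
  by apply: cvgMr; exact: continuous_oneDsqr.
have c0 (t : R) : 0 <= (pi * oneDsqr t)^-1.
  by rewrite invr_ge0 mulr_ge0 ?pi_ge0// ltW ?oneDsqr_gt0.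
transitivity (\int[mu]_t ((pi * oneDsqr t)^-1)%:E)%E.
  have F'E : (fun t : R => t - c)^`()%classic = cst 1.
    apply/funext => t; rewrite derive1E deriveB// derive_id derive_cst subr0//.
  rewrite [RHS](@increasing_ge0_integration_by_substitutionT _ (fun t => t - c))//.
  - by apply: eq_integral => t _; rewrite F'E /= fctE/= mulr1.
  - by move=> x y; rewrite ltrD2r.
  - by rewrite F'E => t; exact: cvg_cst.
  - by rewrite F'E; exact: is_cvg_cst.
  - by rewrite F'E; exact: is_cvg_cst.
  - exact: cvg_addrr_Ny.
  - exact: cvg_addrr.
rewrite ge0_symfun_integralT//; last first.
  by move=> t /=; rewrite /oneDsqr sqrrN.
rewrite (_ : [set x : R | 0 <= x] = `[0, +oo[%classic); last first.
  by apply/seteqP; split => x/=; rewrite in_itv/= andbT.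
under eq_integral do rewrite invfM EFinM.
rewrite ge0_integralZl//.
- rewrite integral0y_oneDsqr -!EFinM; congr EFin.
  have p0 : pi != 0 :> R by rewrite gt_eqF ?pi_gt0.
  by rewrite mulKf// mulfV.
- apply/measurable_EFinP; apply: measurable_funTS; apply: continuous_measurable_fun.
  exact: continuous_oneDsqrV.
- by rewrite lee_fin invr_ge0 pi_ge0.
Qed.

End product_integrals.

(** * Gaussian densities and their mixtures *)

Section densities.
Context {R : realType} {d : nat}.
Local Notation E := 'rV[R]_d.
Local Notation mu := (@lebesgue_measure R).
Implicit Types (G : probability E R) (x z theta : E).

Lemma sqr_l2norm z : l2norm z ^+ 2 = \sum_(i < d) z ord0 i ^+ 2.
Proof. by rewrite sqr_sqrtr// sumr_ge0// => i _; rewrite sqr_ge0. Qed.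

Lemma l2norm_ge0 z : 0 <= l2norm z. Proof. exact: sqrtr_ge0. Qed.

Lemma normr_coord_le_l2norm z i : `|z ord0 i| <= l2norm z.
Proof.
rewrite -(@ler_pXn2r _ 2)// ?nnegrE ?l2norm_ge0// sqr_l2norm real_normK ?num_real//.
by rewrite (bigD1 i)//= lerDl sumr_ge0// => j _; rewrite sqr_ge0.
Qed.

Lemma normal_pdf1E (c t : R) :
  normal_pdf c 1 t = (Num.sqrt (2 * pi))^-1 * expR (- ((t - c) ^+ 2 / 2)).
Proof.
rewrite normal_pdfE ?oner_neq0// /normal_peak /normal_fun expr1n mul1r mulNr.
by rewrite -[pi *+ 2]mulr_natl.
Qed.

Lemma gaussian_densityE x theta : gaussian_density (x - theta) =
  \prod_(i < d) normal_pdf (theta ord0 i) 1 (x ord0 i).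
Proof.
rewrite /gaussian_density sqr_l2norm.
under [RHS]eq_bigr do rewrite normal_pdf1E.
rewrite big_split/= prodr_const card_ord; congr (_ * _).
  have p0 : 0 <= 2 * pi :> R by rewrite mulr_ge0// pi_ge0.
  rewrite -powR12_sqrt// -powRN -powR_mulrn ?powR_ge0// -powRrM.
  by congr (_ `^ _); rewrite mulNr mulrC.
rewrite -expR_sum; congr expR; rewrite sumrN -mulr_suml; congr (- (_ / _)).
by apply: eq_bigr => i _; rewrite !mxE.
Qed.

Lemma gaussian_density_gt0 z : 0 < gaussian_density z.
Proof.
by apply: mulr_gt0; rewrite ?expR_gt0// powR_gt0// mulr_gt0// pi_gt0.
Qed.

Lemma gaussian_density_le_expR z :
  gaussian_density z <= expR (- (l2norm z ^+ 2 / 2)).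
Proof.
rewrite ler_piMl ?expR_ge0// powRN invf_le1; last first.
  by rewrite powR_gt0// mulr_gt0// pi_gt0.
rewrite -[leLHS](powRr0 (2 * pi)) ler_powR//.
by have := @pi_ge2 R; lra.
Qed.

Lemma gaussian_density_le1 z : gaussian_density z <= 1.
Proof.
apply: le_trans (gaussian_density_le_expR z) _.
by rewrite -expR0 ler_expR oppr_le0 divr_ge0// exprn_ge0// l2norm_ge0.
Qed.

Lemma measurable_rV_sub : measurable_fun [set: E * E] (fun p : E * E => p.1 - p.2).
Proof.
apply: measurable_fun_rV => i.
rewrite (_ : _ \o _ = fun p : E * E => rV_coord i p.1 - rV_coord i p.2); last first.
  by apply/funext => p /=; rewrite /rV_coord !mxE.
by apply: measurable_funB; [apply: measurableT_comp measurable_fst|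
  apply: measurableT_comp measurable_snd]; exact: measurable_rV_coord.
Qed.

Lemma measurable_l2norm : measurable_fun [set: E] (@l2norm R d).
Proof.
apply: (@measurableT_comp _ _ _ _ _ _ (@Num.sqrt R)).
  by apply: continuous_measurable_fun; exact: sqrt_continuous.
apply: measurable_sum => i; apply: measurable_funX; exact: measurable_rV_coord.
Qed.

Lemma measurable_gaussian_density : measurable_fun [set: E] (@gaussian_density R d).
Proof.
apply: measurable_funM => //; apply: measurableT_comp => //.
apply: measurableT_comp => //; apply: measurable_funM => //.
by apply: measurable_funX; exact: measurable_l2norm.
Qed.

Lemma measurable_gaussian_sub :
  measurable_fun [set: E * E] (fun p : E * E => gaussian_density (p.1 - p.2)).
Proof.
exact: (measurableT_comp measurable_gaussian_density measurable_rV_sub).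
Qed.

Lemma integral_gaussian_density theta :
  (\int[lebesgue_rV d]_x (gaussian_density (x - theta))%:E = 1)%E.
Proof.
under eq_integral do rewrite gaussian_densityE.
rewrite (ge0_integral_rV_prod (u := fun i => normal_pdf (theta ord0 i) 1)).
- by rewrite big1// => i _; exact: integral_normal_pdf.
- by move=> i; exact: measurable_normal_pdf.
- by move=> i t; exact: normal_pdf_ge0.
Qed.

Let measurable_gaussian_subl x :
  measurable_fun [set: E] (fun theta => gaussian_density (x - theta)).
Proof.
exact: (measurableT_comp measurable_gaussian_sub (measurable_pair1 x)).
Qed.

Lemma mixture_densityE G x :
  ((mixture_density G x)%:E = \int[G]_theta (gaussian_density (x - theta))%:E)%E.
Proof.
rewrite fineK// ge0_fin_numE; last first.
  by apply: integral_ge0 => t _; rewrite lee_fin ltW// gaussian_density_gt0.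
rewrite (@le_lt_trans _ _ (\int[G]_theta cst 1 theta)%E)//.
  apply: ge0_le_integral => //.
  - by move=> t _; rewrite lee_fin ltW// gaussian_density_gt0.
  - by apply/measurable_EFinP; exact: measurable_gaussian_subl.
  - by move=> t _; rewrite lee_fin gaussian_density_le1.
by rewrite integral_cst// mul1e [X in (X < _)%E]probability_setT ltry.
Qed.

Lemma mixture_density_ge0 G x : 0 <= mixture_density G x.
Proof. by apply: Rintegral_ge0 => t _; rewrite ltW// gaussian_density_gt0. Qed.

Lemma mixture_density_le1 G x : mixture_density G x <= 1.
Proof.
rewrite -lee_fin mixture_densityE (@le_trans _ _ (\int[G]_theta cst 1 theta)%E)//.
  apply: ge0_le_integral => //.
  - by move=> t _; rewrite lee_fin ltW// gaussian_density_gt0.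
  - by apply/measurable_EFinP; exact: measurable_gaussian_subl.
  - by move=> t _; rewrite lee_fin gaussian_density_le1.
by rewrite integral_cst// mul1e [X in (X <= _)%E]probability_setT.
Qed.

Lemma mixture_density_gt0 G x : 0 < mixture_density G x.
Proof.
rewrite lt_neqAle mixture_density_ge0 andbT eq_sym; apply/eqP => h.
have : (\int[G]_theta `|(gaussian_density (x - theta))%:E| = 0)%E.
  under eq_integral do rewrite gee0_abs ?lee_fin ?ltW ?gaussian_density_gt0//.
  by rewrite -mixture_densityE h.
move/ae_eq_integral_abs => -[//||N [mN GN0 sub]].
  by apply/measurable_EFinP; exact: measurable_gaussian_subl.
have NT : N = [set: E].
  apply/seteqP; split => // t _; apply: sub => /= /(_ I) /eqP.
  by rewrite eqe gt_eqF ?gaussian_density_gt0.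
have /eqP := @probability_setT _ _ _ G.
by rewrite -NT GN0 eqe eq_sym oner_eq0.
Qed.

Lemma measurable_mixture_density G : measurable_fun [set: E] (mixture_density G).
Proof.
apply/measurable_EFinP.
rewrite (_ : _ \o _ = fubini_F G (fun p : E * E => (gaussian_density (p.1 - p.2))%:E)).
  apply: measurable_fun_fubini_tonelli_F.
  - by apply/measurable_EFinP; exact: measurable_gaussian_sub.
  - by move=> p; rewrite lee_fin ltW// gaussian_density_gt0.
by apply/funext => x /=; rewrite mixture_densityE.
Qed.

(** By Tonelli's theorem the component theta can be drawn first. *)
Lemma ge0_integral_mixture G (F : E -> \bar R) :
  measurable_fun [set: E] F -> (forall x, 0 <= F x)%E ->
  (\int[lebesgue_rV d]_x (F x * (mixture_density G x)%:E) =
   \int[G]_theta \int[lebesgue_rV d]_x (F x * (gaussian_density (x - theta))%:E))%E.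
Proof.
move=> mF F0.
have g0 z : (0 <= (gaussian_density z)%:E)%E by rewrite lee_fin ltW// gaussian_density_gt0.
under eq_integral => x _.
  rewrite mixture_densityE -ge0_integralZl//; last first.
    by apply/measurable_EFinP; exact: measurable_gaussian_subl.
  over.
rewrite (fubini_tonelli (fun p : E * E => F p.1 * (gaussian_density (p.1 - p.2))%:E)%E)//.
- apply: emeasurable_funM; first by apply: measurableT_comp.
  by apply/measurable_EFinP; exact: measurable_gaussian_sub.
- by move=> p; rewrite mule_ge0.
Qed.

Lemma integral_mixture_density G :
  (\int[lebesgue_rV d]_x (mixture_density G x)%:E = 1)%E.
Proof.
under eq_integral do rewrite -[(mixture_density _ _)%:E]mul1e.
rewrite (ge0_integral_mixture _ (F := cst 1%E))//.
under eq_integral do under eq_integral do rewrite mul1e.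
under eq_integral do rewrite integral_gaussian_density.
by rewrite integral_cst// mul1e [LHS]probability_setT.
Qed.

Lemma integral_average_measure n (G : 'I_n -> probability E R) (f : E -> \bar R) :
  measurable_fun [set: E] f -> (forall x, 0 <= f x)%E ->
  (\int[average_measure G]_x f x = (n%:R^-1)%:E * \sum_(i < n) \int[G i]_x f x)%E.
Proof.
move=> mf f0.
pose Gnat (k : nat) : {measure set E -> \bar R} :=
  if insub k is Some i then G i else mzero.
have n0 : 0 <= n%:R^-1 :> R by rewrite invr_ge0.
transitivity (\int[mscale (NngNum n0) (msum Gnat n)]_x f x)%E.
  apply: eq_measure_integral => A mA _.
  rewrite /average_measure /mscale/= /msum; congr *%E.
  by apply: eq_bigr => i _; rewrite /Gnat valK.
rewrite ge0_integral_mscale// ge0_integral_measure_sum//=; congr *%E.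
by apply: eq_bigr => i _; rewrite /Gnat valK.
Qed.

Lemma average_measure_probability n (G : 'I_n -> probability E R) : (0 < n)%N ->
  exists Gp : probability E R, forall A, Gp A = average_measure G A.
Proof.
move=> n0.
have aT : average_measure G [set: E] = 1%E.
  rewrite /average_measure; under eq_bigr do rewrite probability_setT.
  rewrite sumEFin -EFinM sumr_const card_ord mulVf// pnatr_eq0 -lt0n//.
pose m := [the {measure set E -> \bar R} of average_measure G].
have mT : m [set: E] = 1%E := aT.
exists (mnormalize m (G (Ordinal n0))) => A.
transitivity (m A) => //.
change ((if (m [set: _] == 0) || (m [set: _] == +oo) 
  then [eta G (Ordinal n0)]
  else fun U : set _ => m U * ((fine (m [set: _]))^-1)%:E) A = m A)%E.
rewrite mT onee_eq0 orFb; have -> : (1%E == +oo :> \bar R)%E = false by [].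
cbv beta iota; have -> : fine (1 : \bar R)%E = 1 by [].
rewrite invr1 mule1.
by [].
Qed.

Lemma mixture_density_average n (G : 'I_n -> probability E R) x :
  mixture_density (average_measure G) x =
  n%:R^-1 * \sum_(i < n) mixture_density (G i) x.
Proof.
rewrite {1}/mixture_density /Rintegral integral_average_measure.
- under eq_bigr do rewrite -mixture_densityE.
  by rewrite sumEFin.
- by apply/measurable_EFinP; exact: measurable_gaussian_subl.
- by move=> t; rewrite lee_fin ltW// gaussian_density_gt0.
Qed.

Lemma eq_mixture_density (G1 G2 : {measure set E -> \bar R}) :
  (forall A, G1 A = G2 A) -> mixture_density G1 = mixture_density G2.
Proof.
move=> G12; apply/funext => x; congr fine.
by apply: eq_measure_integral => A mA _; exact: G12.
Qed.

(** The expectation of a square root of a likelihood ratio is an affinity, which is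
how the Hellinger distance enters the risk bound. *)
Lemma affinityE (f g : E -> R) :
  measurable_fun [set: E] f -> measurable_fun [set: E] g ->
  (forall x, 0 <= f x) -> (forall x, 0 <= g x) ->
  (\int[lebesgue_rV d]_x (f x)%:E = 1)%E -> (\int[lebesgue_rV d]_x (g x)%:E = 1)%E ->
  (\int[lebesgue_rV d]_x (Num.sqrt (f x * g x))%:E = (1 - hellinger2 f g / 2)%:E)%E.
Proof.
move=> mf mg f0 g0 If Ig.
have ms : measurable_fun [set: R] (@Num.sqrt R).
  by apply: continuous_measurable_fun; exact: sqrt_continuous.
have mfg : measurable_fun [set: E] (fun x => Num.sqrt (f x * g x)).
  by apply: (measurableT_comp ms); exact: measurable_funM.
have mh : measurable_fun [set: E] (fun x => (Num.sqrt (f x) - Num.sqrt (g x)) ^+ 2).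
  by apply: measurable_funX; apply: measurable_funB; exact: measurableT_comp.
set a := (\int[_]_x (Num.sqrt (f x * g x))%:E)%E.
have a0 : (0 <= a)%E by apply: integral_ge0 => x _; rewrite lee_fin sqrtr_ge0.
pose h := (\int[lebesgue_rV d]_x ((Num.sqrt (f x) - Num.sqrt (g x)) ^+ 2)%:E)%E.
have h0 : (0 <= h)%E by apply: integral_ge0 => x _; rewrite lee_fin sqr_ge0.
have ha : (h + (2:R)%:E * a = (2:R)%:E)%E.
  rewrite /h /a -ge0_integralZl//; last 1 first.
  - exact/measurable_EFinP.
  rewrite -ge0_integralD//; try (by apply/measurable_EFinP);
    try (by apply: emeasurable_funM => //; exact/measurable_EFinP);
    try (by move=> x _; rewrite lee_fin sqr_ge0);
    try (by move=> x _; rewrite -EFinM lee_fin mulr_ge0// sqrtr_ge0).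
  transitivity (\int[lebesgue_rV d]_x ((f x)%:E + (g x)%:E))%E.
    apply: eq_integral => x _; rewrite -EFinM -!EFinD; congr EFin.
    rewrite sqrtrM// sqrrB !sqr_sqrtr// -[_ * _ *+ 2]mulr_natl; lra.
  rewrite ge0_integralD//; try (by apply/measurable_EFinP);
    try (by move=> x _; rewrite lee_fin).
  by rewrite If Ig -EFinD.
have -> : hellinger2 f g = fine h by [].
move: ha h0 a0; case: (h) => [r| |]//; case: (a) => [s| |]//=.
- rewrite -EFinM -EFinD => -[rs] _ _; congr EFin; lra.
- by rewrite gt0_muley.
- by rewrite gt0_muley.
Qed.

Lemma hellinger2_ge0 (f g : E -> R) : 0 <= hellinger2 f g.
Proof. by apply: Rintegral_ge0 => x _; rewrite sqr_ge0. Qed.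

Lemma hellinger2_le2 (f g : E -> R) :
  measurable_fun [set: E] f -> measurable_fun [set: E] g ->
  (forall x, 0 <= f x) -> (forall x, 0 <= g x) ->
  (\int[lebesgue_rV d]_x (f x)%:E = 1)%E -> (\int[lebesgue_rV d]_x (g x)%:E = 1)%E ->
  hellinger2 f g <= 2.
Proof.
move=> mf mg f0 g0 If Ig; have h := affinityE mf mg f0 g0 If Ig.
have : (0 <= (1 - hellinger2 f g / 2)%:E)%E.
  by rewrite -h; apply: integral_ge0 => x _; rewrite lee_fin sqrtr_ge0.
rewrite lee_fin; lra.
Qed.

End densities.

(** * The risk of the NPMLE under finitely many brackets *)

Section real_lemmas.
Context {R : realType}.
Implicit Types x y : R.

Lemma ln_le_sub1 x : 0 < x -> ln x <= x - 1.
Proof.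
by move=> x0; rewrite lerBrDl -[leRHS](lnK x0) expR_ge1Dx.
Qed.

Lemma sqrtrD_le x y : 0 <= x -> 0 <= y ->
  Num.sqrt (x + y) <= Num.sqrt x + Num.sqrt y.
Proof.
move=> x0 y0; rewrite -(@ler_pXn2r _ 2)// ?nnegrE ?addr_ge0 ?sqrtr_ge0//.
rewrite sqrrD !sqr_sqrtr// ?addr_ge0// addrAC lerDl mulrn_wge0//.
Qed.

Lemma ln_prod (I : Type) (s : seq I) (F : I -> R) :
  (forall i, 0 < F i) -> ln (\prod_(i <- s) F i) = \sum_(i <- s) ln (F i).
Proof.
move=> F0; elim: s => [|i s IH]; first by rewrite !big_nil ln1.
by rewrite !big_cons lnM ?posrE ?prodr_gt0// IH.
Qed.

Lemma sqrtrM_le_mean (t x y : R) : 0 < t -> 0 <= x -> 0 <= y ->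
  Num.sqrt (x * y) <= (2 * t)^-1 * x + t / 2 * y.
Proof.
move=> t0 x0 y0; set a := (2 * t)^-1 * x; set b := t / 2 * y.
have a0 : 0 <= a by rewrite mulr_ge0// invr_ge0 mulr_ge0// ltW.
have b0 : 0 <= b by rewrite mulr_ge0// divr_ge0// ltW.
rewrite -[leRHS]ger0_norm ?addr_ge0// -sqrtr_sqr ler_wsqrtr//.
have -> : x * y = 4 * (a * b) by rewrite /a /b; field; rewrite gt_eqF.
by have := sqr_ge0 (a - b); rewrite !expr2; nra.
Qed.

Lemma measurable_fun_inv_gt0 {d} {T : measurableType d} (f : T -> R) :
  measurable_fun [set: T] f -> (forall x : T, 0 < f x) ->
  measurable_fun [set: T] (fun x : T => (f x)^-1).
Proof.
move=> mf f0; under eq_fun do rewrite -powR_inv1 ?ltW//.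
exact: (measurableT_comp (measurable_powR _) mf).
Qed.

End real_lemmas.

(** The integral of a nonnegative function is monotone with no measurability
assumption: it is a supremum over the simple functions below it. The loss of the
NPMLE need not be a measurable function of the sample. *)
Lemma ge0_le_integral_sub {d} {T : measurableType d} {R : realType}
    (mu : {measure set T -> \bar R}) (f g : T -> \bar R) :
  (forall x, 0 <= f x)%E -> (forall x, f x <= g x)%E ->
  (\int[mu]_x f x <= \int[mu]_x g x)%E.
Proof.
move=> f0 fg; have g0 x : (0 <= g x)%E by exact: le_trans (fg x).
rewrite !ge0_integralTE//; apply: le_ereal_sup => _ [h hf <-].
by exists h => // x; exact: le_trans (fg x).
Qed.

Section npmle_risk.
Context {R : realType} {d n : nat}.
Local Notation E := 'rV[R]_d.
Local Notation lam := (lebesgue_rV d).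
Context {dO} {Omega : measurableType dO} (P : probability Omega R).
Variables (G : 'I_n -> probability E R) (X : 'I_n -> {RV P >-> E}).
Hypothesis n0 : (0 < n)%N.
Hypothesis indX : mutually_independent X.
Hypothesis densX : forall i, has_density (X i) (mixture_density (G i)).
Local Notation f0 := (mixture_density (average_measure G)).

Lemma expectation_density i (u : E -> R) :
  measurable_fun [set: E] u -> (forall x, 0 <= u x) ->
  (\int[P]_w (u (X i w))%:E = \int[lam]_x ((u x)%:E * (mixture_density (G i) x)%:E))%E.
Proof.
move=> mu u0.
rewrite -(@ge0_integral_distribution _ _ _ _ _ _ (X i) (EFin \o u))//;
  try (by apply/measurable_EFinP); try (by move=> x; rewrite lee_fin).
under [RHS]eq_integral do rewrite muleC.
apply/esym/(@ge0_integral_weighted _ _ E E R lam (distribution P (X i))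
  (mixture_density (G i)) id _ _ _ _ (EFin \o u)) => //.
- by move=> x; exact: mixture_density_ge0.
- exact: measurable_mixture_density.
- move=> A mA; apply: etrans (esym (densX i mA)); rewrite [in RHS]integral_mkcond.
  apply: eq_integral => x _; rewrite patchE indicE; case: ifPn => xA.
    by rewrite mule1.
  by rewrite mule0.
- exact/measurable_EFinP.
Qed.

Lemma sum_integral_mixture (u : E -> R) :
  measurable_fun [set: E] u -> (forall x, 0 <= u x) ->
  (\sum_(i < n) \int[lam]_x ((u x)%:E * (mixture_density (G i) x)%:E) =
   n%:R%:E * \int[lam]_x ((u x)%:E * (f0 x)%:E))%E.
Proof.
move=> mu u0.
have mf i : measurable_fun [set: E]
    (fun x => (u x)%:E * (mixture_density (G i) x)%:E)%E.
  by apply: emeasurable_funM; apply/measurable_EFinP => //;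
    exact: measurable_mixture_density.
have pos i x : (0 <= (u x)%:E * (mixture_density (G i) x)%:E)%E.
  by rewrite -EFinM lee_fin mulr_ge0// mixture_density_ge0.
have [Gp GpE] := average_measure_probability G n0.
rewrite -(eq_mixture_density GpE) -ge0_integral_sum// -ge0_integralZl//;
  try (by apply: emeasurable_funM; apply/measurable_EFinP => //;
    exact: measurable_mixture_density);
  try (by move=> x _; rewrite -EFinM lee_fin mulr_ge0// mixture_density_ge0).
rewrite (eq_mixture_density GpE).
apply: eq_integral => x _; rewrite mixture_density_average -!EFinM.
rewrite sumEFin; congr EFin; rewrite -mulr_sumr.
by rewrite [in RHS]mulrCA mulVKf// pnatr_eq0 -lt0n.
Qed.

Variables (fhat : Omega -> E -> R).
Hypothesis npmle : forall w, is_NPMLE (fun i => X i w) (fhat w).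
Variables (J : finType) (g h : J -> E -> R) (h0 : E -> R) (D : set E) (tau e : R).
Hypothesis tau0 : 0 < tau.
Hypothesis e0 : 0 <= e.
Hypothesis mD : measurable D.
Hypothesis mg : forall j, measurable_fun [set: E] (g j).
Hypothesis g0 : forall j x, 0 <= g j x.
Hypothesis Ig : forall j, (\int[lam]_x (g j x)%:E = 1)%E.
Hypothesis mh : forall j, measurable_fun [set: E] (h j).
Hypothesis Ih : forall j, (\int[lam]_x (h j x)%:E <= (tau ^+ 2)%:E)%E.
Hypothesis mh0 : measurable_fun [set: E] h0.
Hypothesis h0_gt0 : forall x, 0 < h0 x.
Hypothesis h0_le1 : forall x, h0 x <= 1.
Hypothesis h0h : forall j x, h0 x <= h j x.
Hypothesis cover : forall f, @mixture_class R d f ->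
  exists j, (forall x, D x -> f x <= g j x + h j x) /\
            hellinger2 f f0 <= hellinger2 (g j) f0 + e.

(** A union bound over the brackets in the form of an average: the square
roots of the likelihood ratios, normalized to have expectation at most 1, have an
average W over J with the same property. *)
Theorem npmle_risk_le :
  ('E_P[fun w => hellinger2 (fhat w) f0] <=
   (e + 2 * tau + 2 / n%:R * (ln #|J|%:R + 1))%:E +
   \int[lam]_x ((\1_(~` D) x * ln (h0 x)^-1)%:E * (f0 x)%:E))%E.
Proof.
have [Gp GpE] := average_measure_probability G n0.
have f0E : f0 = mixture_density Gp by rewrite (eq_mixture_density GpE).
have f0_gt0 x : 0 < f0 x by rewrite f0E mixture_density_gt0.
have mf0 : measurable_fun [set: E] f0.
  by rewrite f0E; exact: measurable_mixture_density.
have If0 : (\int[lam]_x (f0 x)%:E = 1)%E by rewrite f0E integral_mixture_density.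
have msqrt : measurable_fun [set: R] (@Num.sqrt R).
  by apply: continuous_measurable_fun; exact: sqrt_continuous.
have hgt0 j x : 0 < h j x by exact: lt_le_trans (h0h j x).
have ghgt0 j x : 0 < g j x + h j x by rewrite ltr_wpDl.
pose q j x := (g j x + h j x) / f0 x.
have q0 j x : 0 < q j x by rewrite divr_gt0.
have mq j : measurable_fun [set: E] (q j).
  apply: measurable_funM; first exact: measurable_funD.
  exact: measurable_fun_inv_gt0.
pose u j x := Num.sqrt (q j x).
have u0 j x : 0 < u j x by rewrite sqrtr_gt0.
have mu j : measurable_fun [set: E] (u j) by exact: measurableT_comp.
pose b j := (\int[lam]_x ((u j x)%:E * (f0 x)%:E))%E.
(* The affinity increases by at most the integral of sqrt (h f0), and
   sqrt (h f0) <= h / (2 tau) + (tau / 2) f0. *)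
have ble j : (b j <= (1 - hellinger2 (g j) f0 / 2 + tau)%:E)%E.
  have mgf : measurable_fun [set: E] (fun x => (Num.sqrt (g j x * f0 x))%:E).
    by apply/measurable_EFinP; apply: measurableT_comp => //; exact: measurable_funM.
  have mhf : measurable_fun [set: E] (fun x => ((2 * tau)^-1 * h j x + tau / 2 * f0 x)%:E).
    by apply/measurable_EFinP; apply: measurable_funD; apply: measurable_funM.
  have hf0 x : 0 <= (2 * tau)^-1 * h j x + tau / 2 * f0 x.
    by rewrite addr_ge0 ?mulr_ge0 ?invr_ge0 ?divr_ge0 ?mulr_ge0// ltW.
  apply: (@le_trans _ _ (\int[lam]_x ((Num.sqrt (g j x * f0 x))%:E +
      ((2 * tau)^-1 * h j x + tau / 2 * f0 x)%:E))%E).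
    apply: ge0_le_integral_sub => x.
      by rewrite -EFinM lee_fin mulr_ge0// ltW.
    rewrite -EFinM -EFinD lee_fin.
    rewrite -[X in _ * X](@gtr0_norm _ (f0 x))// -sqrtr_sqr -sqrtrM ?(ltW (q0 _ _))//.
    rewrite expr2 mulrA divfK ?gt_eqF// mulrDl.
    apply: le_trans (sqrtrD_le _ _) _; rewrite ?mulr_ge0 ?(ltW (f0_gt0 _)) ?(ltW (hgt0 _ _))//.
    rewrite lerD2l; apply: sqrtrM_le_mean => //; exact: ltW.
  rewrite ge0_integralD//; try (by move=> x _; rewrite lee_fin ?sqrtr_ge0).
  rewrite affinityE// ?EFinD; last by move=> x; exact: ltW.
  rewrite leeD2l//.
  under eq_integral do rewrite EFinD !EFinM.
  have t1 : 0 <= (2 * tau)^-1 by rewrite invr_ge0 mulr_ge0// ltW.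
  have t2 : 0 <= tau / 2 by rewrite divr_ge0// ltW.
  rewrite ge0_integralD//; try (by move=> x _; rewrite -EFinM lee_fin mulr_ge0// ltW);
    try (by under eq_fun do rewrite -EFinM; apply/measurable_EFinP; apply: measurable_funM).
  rewrite !ge0_integralZl//; try (by apply/measurable_EFinP);
    try (by move=> x _; rewrite lee_fin ltW).
  rewrite If0 mule1; apply: (@le_trans _ _ ((2 * tau)^-1%:E * (tau ^+ 2)%:E + (tau / 2)%:E)%E).
    by rewrite leeD2r// lee_wpmul2l.
  rewrite -EFinM -EFinD lee_fin.
  by have -> : (2 * tau)^-1 * tau ^+ 2 + tau / 2 = tau by field; rewrite gt_eqF.
have b0 j : (0 <= b j)%E.
  by apply: integral_ge0 => x _; rewrite -EFinM lee_fin mulr_ge0// ltW.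
pose bi j i := (\int[lam]_x ((u j x)%:E * (mixture_density (G i) x)%:E))%E.
have bi0 j i : (0 <= bi j i)%E.
  apply: integral_ge0 => x _; rewrite -EFinM lee_fin mulr_ge0//.
    exact: ltW.
  exact: mixture_density_ge0.
have bisum j : (\sum_(i < n) bi j i = n%:R%:E * b j)%E.
  by apply: sum_integral_mixture => // x; exact: ltW.
have bfin j : b j \is a fin_num.
  by rewrite ge0_fin_numE// (le_lt_trans (ble j)) ?ltry.
have bifin j i : bi j i \is a fin_num.
  rewrite ge0_fin_numE//.
  have : (\sum_(i < n) bi j i < +oo)%E.
    by rewrite bisum -(fineK (bfin j)) -EFinM ltry.
  apply: le_lt_trans; rewrite (bigD1 i)//= leeDl//.
  by apply: sume_ge0 => k _.
pose Y j w := \prod_(i < n) u j (X i w).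
have Y0 j w : 0 < Y j w by apply: prodr_gt0.
(* b <= exp (b - 1) turns the product over i into the sum of the affinities with the
   individual densities, which is n times the one with their average. *)
have EY j : (\int[P]_w (Y j w)%:E <=
    (expR (n%:R * (tau - hellinger2 (g j) f0 / 2)))%:E)%E.
  have EX i : (\int[P]_w (u j (X i w))%:E = bi j i)%E.
    by apply: expectation_density => // x; exact: ltW.
  rewrite (ge0_expectation_prod (u := fun=> u j))//; last 2 first.
  - by move=> i x; exact: ltW.
  - by move=> i; rewrite EX -(fineK (bifin j i)) ltry.
  under eq_bigr do rewrite EX -(fineK (bifin j _)).
  rewrite prodEFin lee_fin.
  apply: (@le_trans _ _ (\prod_(i < n) expR (fine (bi j i) - 1))).
    apply: ler_prod => i _; rewrite fine_ge0//=.
    by rewrite -[leLHS](subrK 1) addrC expR_ge1Dx.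
  rewrite -expR_sum ler_expR big_split/= sumrN sumr_const card_ord.
  rewrite -mulr_natl mulr1.
  have -> : \sum_(i < n) fine (bi j i) = n%:R * fine (b j).
    apply: EFin_inj; rewrite EFinM fineK// -bisum -sumEFin.
    by apply: eq_bigr => i _; rewrite fineK.
  have : fine (b j) <= 1 - hellinger2 (g j) f0 / 2 + tau.
    by rewrite -lee_fin fineK.
  have : 0 <= n%:R :> R by [].
  nra.
pose W w := \sum_j Y j w * expR (n%:R * (hellinger2 (g j) f0 / 2 - tau)) / #|J|%:R.
pose Z w := \sum_(i < n) \1_(~` D) (X i w) * ln (h0 (X i w))^-1.
have lnh0 x : 0 <= ln (h0 x)^-1 by rewrite ln_ge0// invf_ge1.
have [j0] : exists j : J, True.
  by have [j _] := cover (ex_intro2 _ _ Gp I (erefl _)); exists j.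
move=> _; have J0 : 0 < #|J|%:R :> R by rewrite ltr0n; apply/card_gt0P; exists j0.
have lnJ : 0 <= ln #|J|%:R :> R.
  by rewrite ln_ge0// ler1n; apply/card_gt0P; exists j0.
have nR0 : 0 < n%:R :> R by rewrite ltr0n.
have pointwise w : hellinger2 (fhat w) f0 <=
    e + 2 * tau + 2 / n%:R * ln #|J|%:R + 2 / n%:R * W w + n%:R^-1 * Z w.
  have [[Gw _ fwE] /(_ f0)] := npmle w.
  have /[swap]/[apply] : mixture_class f0 by exists Gp => //; rewrite f0E.
  rewrite /avg_log_likelihood ler_pM2l ?invr_gt0// => lik.
  have fw_gt0 x : 0 < fhat w x by rewrite -fwE mixture_density_gt0.
  have fw_le1 x : fhat w x <= 1 by rewrite -fwE mixture_density_le1.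
  have [|j [fgh hj]] := @cover (fhat w); first by exists Gw.
  (* The likelihood of fhat is at least that of f0. On D it is below the bracket; off
     D it is at most 1 while the bracket is at least h0, at the price Z. *)
  have step : 0 <= ln (Y j w) * 2 + Z w.
    have -> : ln (Y j w) * 2 = \sum_(i < n) ln (q j (X i w)).
      rewrite ln_prod// mulr_suml; apply: eq_bigr => i _.
      have -> : q j (X i w) = u j (X i w) ^+ 2 by rewrite sqr_sqrtr// ltW.
      by rewrite lnXn// mulr2n; lra.
    rewrite -big_split/= -subr_ge0 in lik *; rewrite -sumrB in lik.
    apply: le_trans lik _; apply: ler_sum => i _.
    set x := X i w; rewrite /q lnM ?posrE ?invr_gt0// lnV ?posrE//.
    rewrite addrAC lerD2r indicE.
    have [xD|xD] := boolP (x \in ~` D).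
      rewrite mul1r lnV ?posrE// -subr_ge0.
      have := ln_le0 (fw_le1 x).
      have : ln (h0 x) <= ln (g j x + h j x).
        by rewrite ler_ln ?posrE// (le_trans (h0h j x))// lerDr.
      lra.
    rewrite mul0r addr0 ler_ln ?posrE// fgh//.
    by move: xD; rewrite in_setC negbK inE.
  (* ln t <= t for the j-th summand t of W. *)
  have : ln (Y j w) + n%:R * (hellinger2 (g j) f0 / 2 - tau) - ln #|J|%:R <= W w.
    rewrite -[X in _ + X - _]expRK -lnM ?posrE ?expR_gt0// -lnV ?posrE//.
    rewrite -lnM ?posrE ?invr_gt0 ?mulr_gt0 ?expR_gt0//.
    set t := Y j w * _ / _.
    have t0 : 0 < t by rewrite divr_gt0// mulr_gt0// expR_gt0.
    apply: (@le_trans _ _ t).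
      by apply: le_trans (ln_le_sub1 t0) _; rewrite lerBlDr lerDl.
    rewrite /W (bigD1 j isT) /t lerDl; apply: sumr_ge0 => k _.
    by apply: divr_ge0 => //; apply: mulr_ge0; [exact: ltW|exact: expR_ge0].
  move=> hW; apply: le_trans hj _.
  set s := hellinger2 (g j) f0 in hW *; set K := n%:R * (s / 2 - tau) in hW.
  have -> : s = 2 * tau + 2 / n%:R * K by rewrite /K; field; rewrite gt_eqF.
  have hK : K <= W w + ln #|J|%:R + Z w / 2 by lra.
  have n2 : 0 <= 2 / n%:R :> R by rewrite divr_ge0// ltW.
  have := ler_wpM2l n2 hK; set v := n%:R^-1; lra.
have mY j : measurable_fun [set: Omega] (Y j).
  by apply: measurable_prod => i _; exact: measurableT_comp.
have mW : measurable_fun [set: Omega] W.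
  apply: measurable_sum => j; apply: measurable_funM => //.
  exact: measurable_funM.
have mln1 : measurable_fun [set: E] (fun x => ln (h0 x)^-1).
  by apply: measurableT_comp => //; exact: measurable_fun_inv_gt0.
have mz : measurable_fun [set: E] (fun x => \1_(~` D) x * ln (h0 x)^-1).
  apply: measurable_funM => //; apply: measurable_indic; exact: measurableC.
have mZ : measurable_fun [set: Omega] Z.
  apply: measurable_sum => i.
  exact: (measurableT_comp (f := fun x => \1_(~` D) x * ln (h0 x)^-1)).
have z0 x : 0 <= \1_(~` D) x * ln (h0 x)^-1 by rewrite mulr_ge0.
have Z0 w : 0 <= Z w by apply: sumr_ge0.
have W0 w : 0 <= W w.
  by apply: sumr_ge0 => j _; rewrite divr_ge0 ?mulr_ge0 ?expR_ge0// ltW.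
have EW : (\int[P]_w (W w)%:E <= 1)%E.
  pose a j := expR (n%:R * (hellinger2 (g j) f0 / 2 - tau)) / #|J|%:R.
  have a0 j : 0 <= a j by rewrite divr_ge0 ?expR_ge0.
  have WE w : ((W w)%:E = \sum_j (a j)%:E * (Y j w)%:E)%E.
    under eq_bigr do rewrite -EFinM.
    rewrite sumEFin; congr EFin; apply: eq_bigr => j _.
    by rewrite /a -mulrA mulrC.
  under eq_integral do rewrite WE.
  rewrite ge0_integral_sum//;
    try (by move=> j; apply: emeasurable_funM; apply/measurable_EFinP);
    try (by move=> j w _; rewrite -EFinM lee_fin mulr_ge0// ltW).
  apply: (@le_trans _ _ (\sum_(j : J) (#|J|%:R^-1)%:E)%E); last first.
    rewrite sumEFin lee_fin sumr_const -[leLHS]mulr_natl mulfV// gt_eqF//.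
  apply: lee_sum => j _.
  rewrite ge0_integralZl//; try (by apply/measurable_EFinP);
    try (by move=> w _; rewrite lee_fin ltW); try (by rewrite lee_fin).
  apply: (@le_trans _ _ ((a j)%:E *
     (expR (n%:R * (tau - hellinger2 (g j) f0 / 2)))%:E)%E).
    by apply: lee_wpmul2l => //; rewrite lee_fin.
  rewrite -EFinM lee_fin /a mulrAC -expRD -mulrDr.
  by rewrite (_ : _ - _ + _ = 0) ?mulr0 ?expR0 ?mul1r//; lra.
have EZ : (\int[P]_w (Z w)%:E = n%:R%:E *
    \int[lam]_x ((\1_(~` D) x * ln (h0 x)^-1)%:E * (f0 x)%:E))%E.
  rewrite -sum_integral_mixture//.
  under eq_integral do rewrite -sumEFin.
  rewrite ge0_integral_sum//; last 2 first.
  - move=> i; apply/measurable_EFinP.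
    exact: (measurableT_comp (f := fun x => \1_(~` D) x * ln (h0 x)^-1)).
  - by move=> i w _; rewrite lee_fin.
  by apply: eq_bigr => i _; exact: expectation_density.
rewrite unlock.
pose c := e + 2 * tau + 2 / n%:R * ln #|J|%:R.
have c0 : 0 <= c.
  by rewrite !addr_ge0 ?mulr_ge0 ?divr_ge0// ?(ltW tau0)// ?ltW.
apply: (@le_trans _ _ (\int[P]_w (c%:E + ((2 / n%:R)%:E * (W w)%:E +
    (n%:R^-1)%:E * (Z w)%:E)))%E).
  apply: ge0_le_integral_sub => w; first by rewrite lee_fin hellinger2_ge0.
  by rewrite -!EFinM -!EFinD lee_fin addrA.
have n1 : 0 <= n%:R^-1 :> R by rewrite invr_ge0.
have n2 : 0 <= 2 / n%:R :> R by rewrite divr_ge0.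
have pW w : (0 <= (2 / n%:R)%:E * (W w)%:E)%E by rewrite -EFinM lee_fin mulr_ge0.
have pZ w : (0 <= (n%:R^-1)%:E * (Z w)%:E)%E by rewrite -EFinM lee_fin mulr_ge0.
have emW : measurable_fun [set: Omega] (fun w => (2 / n%:R)%:E * (W w)%:E)%E.
  by apply: emeasurable_funM => //; exact/measurable_EFinP.
have emZ : measurable_fun [set: Omega] (fun w => (n%:R^-1)%:E * (Z w)%:E)%E.
  by apply: emeasurable_funM => //; exact/measurable_EFinP.
rewrite ge0_integralD//; try (by move=> w _; rewrite adde_ge0);
  try (exact: emeasurable_funD); try (by move=> w _; rewrite lee_fin).
rewrite integral_cst// [X in (c%:E * X)%E]probability_setT mule1.
rewrite ge0_integralD// !ge0_integralZl//;
  try (by apply/measurable_EFinP); try (by move=> w _; rewrite lee_fin).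
rewrite EZ muleA -EFinM mulVf ?gt_eqF// mul1e addeA leeD2r//.
have -> : e + 2 * tau + 2 / n%:R * (ln #|J|%:R + 1) = c + 2 / n%:R.
  by rewrite /c mulrDr mulr1 addrA.
rewrite [X in (_ <= X)%E]EFinD; apply: leeD2l.
by rewrite -[leRHS]mule1 lee_wpmul2l.
Qed.

End npmle_risk.

(** * Separable expansion of the Gaussian kernel *)

Section gaussian_kernel_expansion.
Context {R : realType}.
Implicit Types (x y s t a : R) (b k : nat).

Lemma sum_exp_coeff_le x k : 0 <= x -> \sum_(b < k) x ^+ b / b`!%:R <= expR x.
Proof.
move=> x0; rewrite -(big_mkord xpredT (fun b => x ^+ b / b`!%:R)).
apply: (@nondecreasing_cvgn_le R (series (exp_coeff x))); last exact: is_cvg_series_exp_coeff.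
apply: nondecreasing_series => n _ _; exact: exp_coeff_ge0.
Qed.

Lemma exprn_fact_le_expR x b : 0 <= x -> x ^+ b / b`!%:R <= expR x.
Proof.
move=> x0; apply: le_trans (sum_exp_coeff_le b.+1 x0).
rewrite big_ord_recr/= lerDr sumr_ge0// => i _.
by rewrite divr_ge0// exprn_ge0.
Qed.

(** The terms with b >= k are compared with those of the series of exp (4 |x|). *)
Lemma exp_tail_le x k :
  `|expR x - \sum_(b < k) x ^+ b / b`!%:R| <= 4 ^- k * expR (4 * `|x|).
Proof.
have key N : (k <= N)%N -> `|series (exp_coeff x) N - series (exp_coeff x) k| <=
    4 ^- k * expR (4 * `|x|).
  move=> kN; rewrite /series /= (big_cat_nat (n := k))//= addrAC subrr add0r.
  apply: le_trans (ler_norm_sum _ _ _) _.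
  apply: (@le_trans _ _ (\sum_(k <= b < N) 4 ^- k * ((4 * `|x|) ^+ b / b`!%:R))).
    apply: ler_sum_nat => b /andP[kb _].
    rewrite /exp_coeff/= normrM normrX normfV (@ger0_norm _ b`!%:R)// exprMn.
    rewrite [leRHS]mulrA ler_pM2r ?invr_gt0 ?ltr0n ?fact_gt0//.
    rewrite mulrA ler_peMl ?exprn_ge0//.
    by rewrite mulrC ler_pdivlMr ?exprn_gt0// mul1r ler_eXn2l// ltr1n.
  rewrite -mulr_sumr ler_wpM2l ?invr_ge0 ?exprn_ge0//.
  apply: le_trans (sum_exp_coeff_le N _); last by rewrite mulr_ge0.
  rewrite -(big_mkord xpredT (fun b => (4 * `|x|) ^+ b / b`!%:R)).
  rewrite [leRHS](big_cat_nat (n := k))//= lerDr sumr_ge0//.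
have cv : `|series (exp_coeff x) N - series (exp_coeff x) k| @[N --> \oo] -->
    `|expR x - series (exp_coeff x) k|.
  apply: cvg_norm; apply: cvgB; last exact: cvg_cst.
  exact: is_cvg_series_exp_coeff.
rewrite -(big_mkord xpredT (fun b => x ^+ b / b`!%:R)).
rewrite -[X in `|_ - X|]/(series (exp_coeff x) k) -(cvg_lim _ cv)//.
apply: limr_le; first exact: cvgP cv.
near=> N; apply: key; near: N; exact: nbhs_infty_ge.
Unshelve. all: by end_near. Qed.

(** Splitting the factor 1 / b! of the exponential series evenly between the two
variables gives exp (-(s - t)^2 / 2) = sum_b gcoef b s * gcoef b t with coefficient
functions bounded by 1. *)
Definition gcoef b t : R := expR (- t ^+ 2 / 2) * t ^+ b / Num.sqrt b`!%:R.

Lemma gcoefM b s t : gcoef b s * gcoef b t =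
  expR (- s ^+ 2 / 2 - t ^+ 2 / 2) * ((s * t) ^+ b / b`!%:R).
Proof.
have f0 : 0 <= b`!%:R :> R by [].
rewrite -[b`!%:R in RHS](sqr_sqrtr f0) expRD exprMn -[- (t ^+ 2 / 2)]mulNr /gcoef.
have : Num.sqrt b`!%:R != 0 :> R by rewrite gt_eqF// sqrtr_gt0 ltr0n fact_gt0.
by move=> h; field.
Qed.

Lemma sqr_gcoef_le b s : gcoef b s ^+ 2 <= 2 ^+ b * expR (- s ^+ 2 / 2).
Proof.
rewrite (expr2 (gcoef b s)) gcoefM -(expr2 s).
have -> : s ^+ 2 ^+ b / b`!%:R = 2 ^+ b * ((s ^+ 2 / 2) ^+ b / b`!%:R).
  by rewrite [in RHS]expr_div_n [RHS]mulrA [2 ^+ b * _]mulrC divfK// expf_eq0 pnatr_eq0 andbF.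
rewrite mulrCA ler_pM2l ?exprn_gt0//.
rewrite expRD -[leRHS]mulr1 -mulrA ler_wpM2l ?expR_ge0//.
rewrite expRN mulrC ler_pdivrMr ?expR_gt0// mul1r.
by apply: exprn_fact_le_expR; rewrite divr_ge0// sqr_ge0.
Qed.

Lemma gcoef_le1 b t : `|gcoef b t| <= 1.
Proof.
rewrite -(@ler_pXn2r _ 2)// ?nnegrE// expr1n real_normK ?num_real//.
rewrite (expr2 (gcoef b t)) gcoefM -(expr2 t).
have -> : - t ^+ 2 / 2 - t ^+ 2 / 2 = - t ^+ 2 by lra.
rewrite expRN mulrC ler_pdivrMr ?expR_gt0// mul1r.
by apply: exprn_fact_le_expR; rewrite sqr_ge0.
Qed.

Lemma gcoef_le b s : `|gcoef b s| <= 2 ^+ b * expR (- s ^+ 2 / 4).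
Proof.
rewrite -(@ler_pXn2r _ 2)// ?nnegrE ?mulr_ge0 ?expR_ge0 ?exprn_ge0//.
rewrite real_normK ?num_real// (le_trans (sqr_gcoef_le b s))//.
rewrite exprMn -expRM_natl; apply: ler_pM; rewrite ?expR_ge0 ?exprn_ge0//.
  by rewrite ler_eXnr// exprn_ege1// ler1n.
by rewrite ler_expR; lra.
Qed.

(** For |t| <= a this dominates both the kernel at (s, t) and its partial sums, while
keeping Gaussian decay in s. *)
Let env a s : R := expR (16 * a ^+ 2 - s ^+ 2 / 4).

Let mul_le_env a s t : `|t| <= a ->
  expR (- s ^+ 2 / 2 - t ^+ 2 / 2) * expR (4 * `|s * t|) <= env a s.
Proof.
move=> ta; rewrite -expRD ler_expR normrM.
have : t ^+ 2 <= a ^+ 2 by rewrite -real_normK ?num_real// ler_pXn2r// nnegrE (le_trans _ ta).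
have := sqr_ge0 (`|s| / 2 - 4 * `|t|); rewrite sqrrB exprMn real_normK ?num_real//.
rewrite [(_ * `|t|) ^+ 2]exprMn real_normK ?num_real// exprVn.
have := sqr_ge0 t; nra.
Qed.

Lemma gauss_le_env a s t : `|t| <= a -> expR (- (s - t) ^+ 2 / 2) <= env a s.
Proof.
move=> ta; apply: le_trans (mul_le_env s ta); rewrite -expRD ler_expR.
have : s * t <= `|s * t| by exact: ler_norm.
have : 0 <= `|s * t| by []. rewrite sqrrB; lra.
Qed.

Lemma sum_gcoef_le_env a s t k : `|t| <= a ->
  `|\sum_(b < k) gcoef b s * gcoef b t| <= env a s.
Proof.
move=> ta; apply: le_trans (mul_le_env s ta).
under eq_bigr do rewrite gcoefM.
rewrite -mulr_sumr normrM ger0_norm ?expR_ge0// ler_wpM2l ?expR_ge0//.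
apply: (@le_trans _ _ (expR `|s * t|)); last by rewrite ler_expR ler_peMl// ler1n.
apply: le_trans (sum_exp_coeff_le k (normr_ge0 _)).
apply: le_trans (ler_norm_sum _ _ _) _; apply: ler_sum => b _.
by rewrite normrM normrX normfV (@ger0_norm _ b`!%:R).
Qed.

Lemma gauss_expansion_le a s t k : `|t| <= a ->
  `|expR (- (s - t) ^+ 2 / 2) - \sum_(b < k) gcoef b s * gcoef b t| <=
  4 ^- k * env a s.
Proof.
move=> ta; under eq_bigr do rewrite gcoefM.
have -> : expR (- (s - t) ^+ 2 / 2) =
    expR (- s ^+ 2 / 2 - t ^+ 2 / 2) * expR (s * t).
  by rewrite -expRD; congr expR; rewrite sqrrB; lra.
rewrite -mulr_sumr -mulrBr normrM ger0_norm ?expR_ge0//.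
apply: le_trans (ler_wpM2l (expR_ge0 _) (exp_tail_le _ _)) _.
by rewrite mulrCA ler_wpM2l ?mul_le_env// invr_ge0 exprn_ge0.
Qed.

Lemma prod_diff_le (I : Type) (r : seq I) (X Y B : I -> R) (eta : R) : 0 <= eta ->
  (forall i, `|X i| <= B i) -> (forall i, `|Y i| <= B i) ->
  (forall i, `|X i - Y i| <= eta * B i) ->
  `|\prod_(i <- r) X i - \prod_(i <- r) Y i| <=
  (size r)%:R * eta * \prod_(i <- r) B i.
Proof.
move=> e0 XB YB XYB; elim: r => [|i r IH].
  by rewrite !big_nil subrr normr0 !mul0r.
have B0 j : 0 <= B j by exact: le_trans (XB j).
rewrite !big_cons.
set PX := \prod_(_ <- _) X _; set PY := \prod_(_ <- _) Y _.
set PB := \prod_(_ <- _) B _.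
have PX_le : `|PX| <= PB by rewrite normr_prod; apply: ler_prod => j _; rewrite normr_ge0 XB.
have -> : X i * PX - Y i * PY = (X i - Y i) * PX + Y i * (PX - PY) by ring.
apply: le_trans (ler_normD _ _) _; rewrite !normrM.
have -> : (size (i :: r))%:R * eta * (B i * PB) =
    eta * B i * PB + B i * ((size r)%:R * eta * PB) by rewrite /= -natr1; ring.
by apply: lerD; apply: ler_pM.
Qed.

End gaussian_kernel_expansion.

(** * A finite net of mixing distributions *)

Section bounded_integrals.
Context {d} {T : measurableType d} {R : realType}.
Implicit Types (G : probability T R) (f g : T -> R).

Definition bounded_measurable f :=
  measurable_fun [set: T] f /\ exists c : R, forall t : T, `|f t| <= c.

Lemma bounded_measurable_cst (c : R) : bounded_measurable (fun=> c).
Proof. by split; [exact: measurable_cst|exists `|c|]. Qed.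

Lemma bounded_measurableD f g : bounded_measurable f -> bounded_measurable g ->
  bounded_measurable (fun t : T => f t + g t).
Proof.
move=> [mf [a fa]] [mg [b gb]]; split; first exact: measurable_funD.
by exists (a + b) => t; apply: le_trans (ler_normD _ _) _; exact: lerD.
Qed.

Lemma bounded_measurableM f g : bounded_measurable f -> bounded_measurable g ->
  bounded_measurable (fun t : T => f t * g t).
Proof.
move=> [mf [a fa]] [mg [b gb]]; split; first exact: measurable_funM.
by exists (a * b) => t; rewrite normrM ler_pM.
Qed.

Lemma bounded_measurable_sum (I : Type) (r : seq I) (f : I -> T -> R) :
  (forall i, bounded_measurable (f i)) ->
  bounded_measurable (fun t : T => \sum_(i <- r) f i t).
Proof.
move=> bf; elim: r => [|i r IH].
  under eq_fun do rewrite big_nil; exact: bounded_measurable_cst.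
by under eq_fun do rewrite big_cons; exact: bounded_measurableD.
Qed.

Lemma bounded_measurable_integrable G f : bounded_measurable f ->
  G.-integrable [set: T] (EFin \o f).
Proof.
move=> [mf [c fc]]; apply/integrableP; split; first exact/measurable_EFinP.
apply: (@le_lt_trans _ _ (\int[G]_t (cst c%:E t))%E).
  apply: ge0_le_integral_sub => t; first by rewrite abse_ge0.
  by rewrite /= lee_fin.
by rewrite integral_cst// [X in (c%:E * X)%E]probability_setT mule1 ltry.
Qed.

Lemma Rintegral_bcst G (c : R) : \int[G]_t c = c.
Proof. by rewrite Rintegral_cst// [X in fine X]probability_setT mulr1. Qed.

Lemma Rintegral_bD G f g : bounded_measurable f -> bounded_measurable g ->
  \int[G]_t (f t + g t) = \int[G]_t f t + \int[G]_t g t.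
Proof. by move=> bf bg; rewrite RintegralD//; exact: bounded_measurable_integrable. Qed.

Lemma Rintegral_bZ G (c : R) f : bounded_measurable f ->
  \int[G]_t (c * f t) = c * \int[G]_t f t.
Proof. by move=> bf; rewrite RintegralZl//; exact: bounded_measurable_integrable. Qed.

Lemma Rintegral_bsum G (I : Type) (r : seq I) (f : I -> T -> R) :
  (forall i, bounded_measurable (f i)) ->
  \int[G]_t (\sum_(i <- r) f i t) = \sum_(i <- r) \int[G]_t f i t.
Proof.
move=> bf; elim: r => [|i r IH].
  by under eq_Rintegral do rewrite big_nil; rewrite Rintegral_bcst big_nil.
under eq_Rintegral do rewrite big_cons.
by rewrite Rintegral_bD ?big_cons ?IH//; exact: bounded_measurable_sum.
Qed.

Lemma le_Rintegral_b G f g : bounded_measurable f -> bounded_measurable g ->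
  (forall t, f t <= g t) -> \int[G]_t f t <= \int[G]_t g t.
Proof. by move=> bf bg fg; apply: le_Rintegral => //; exact: bounded_measurable_integrable. Qed.

Lemma norm_Rintegral_b_le G f (c : R) : bounded_measurable f ->
  (forall t, `|f t| <= c) -> `|\int[G]_t f t| <= c.
Proof.
move=> bf fc; rewrite ler_norml -{1}(Rintegral_bcst G c) -[X in _ <= _ <= X](Rintegral_bcst G c).
have bc := bounded_measurable_cst.
apply/andP; split; last first.
  by apply: le_Rintegral_b => // t; have := fc t; rewrite ler_norml => /andP[].
rewrite Rintegral_bcst -(Rintegral_bcst G (- c)).
by apply: le_Rintegral_b => // t; have := fc t; rewrite ler_norml => /andP[].
Qed.

End bounded_integrals.

Section quantization.
Context {R : realType} (delta : R).
Hypothesis delta0 : 0 < delta.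

Definition quantize_levels := (Num.truncn (2 / delta)).+1.

Definition quantize (x : R) : 'I_quantize_levels := inord (Num.truncn ((x + 1) / delta)).

Lemma quantize_close x y : `|x| <= 1 -> `|y| <= 1 -> quantize x = quantize y ->
  `|x - y| <= delta.
Proof.
have key z : `|z| <= 1 -> (quantize z)%:R * delta <= z + 1 < ((quantize z)%:R + 1) * delta.
  move=> /ler_normlP[z1 z2].
  have z0 : 0 <= (z + 1) / delta by rewrite divr_ge0 ?(ltW delta0)//; lra.
  rewrite /quantize inordK; last first.
    rewrite ltnS; apply: le_truncn; rewrite ler_pM2r ?invr_gt0//; lra.
  have /andP[h1 h2] := truncn_itv z0.
  by rewrite -ler_pdivlMr// h1 -ltr_pdivrMr//= natr1.
move=> /key/andP[x1 x2] /key/andP[y1 y2] xy; rewrite xy in x1 x2.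
rewrite ler_norml; apply/andP; split; lra.
Qed.

End quantization.

Section mixture_net.
Context {R : realType} {d : nat}.
Local Notation E := 'rV[R]_d.
Implicit Types (G : probability E R) (x theta v : E).

(** The functions of one variable in the d-dimensional expansion; integrated over a
cell around v they give the features of a mixing distribution. *)
Definition gfeat k (b : {ffun 'I_d -> 'I_k}) v : R := \prod_(i < d) gcoef (b i) (v ord0 i).

Lemma gfeat_le1 k b v : `|@gfeat k b v| <= 1.
Proof.
rewrite normr_prod; apply: prodr_ile1 => i _; rewrite normr_ge0; exact: gcoef_le1.
Qed.

Lemma expR_l2norm (v : E) (c : R) :
  expR (- (l2norm v ^+ 2 * c)) = \prod_(i < d) expR (- (v ord0 i ^+ 2 * c)).
Proof. by rewrite -expR_sum sqr_l2norm sumrN mulr_suml. Qed.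

Lemma gfeat_le k b v : `|@gfeat k b v| <= 2 ^+ (k * d) * expR (- (l2norm v ^+ 2 / 4)).
Proof.
rewrite normr_prod expR_l2norm.
have -> : 2 ^+ (k * d) = \prod_(i < d) 2 ^+ k :> R by rewrite prodr_const card_ord exprM.
rewrite -big_split/=; apply: ler_prod => i _; rewrite normr_ge0/=.
apply: le_trans (gcoef_le _ _) _.
rewrite -[in leRHS]mulNr ler_wpM2r ?expR_ge0//.
by rewrite ler_weXn2l ?ler1n// ltnW.
Qed.

Lemma gaussian_density_expansion (a : R) k x theta v :
  (forall i, `|theta ord0 i - v ord0 i| <= a) ->
  `|gaussian_density (x - theta) - (2 * pi) `^ (- (d%:R / 2)) *
     \sum_(b : {ffun 'I_d -> 'I_k}) gfeat b (x - v) * gfeat b (theta - v)| <=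
  d%:R * 4 ^- k * expR (16 * d%:R * a ^+ 2) * expR (- (l2norm (x - v) ^+ 2 / 4)).
Proof.
move=> ta.
have p0 : 0 <= (2 * pi) `^ (- (d%:R / 2)) :> R by exact: powR_ge0.
have p1 : (2 * pi) `^ (- (d%:R / 2)) <= 1 :> R.
  rewrite powRN invf_le1 ?powR_gt0 ?mulr_gt0 ?pi_gt0//.
  by rewrite -[leLHS](powRr0 (2 * pi)) ler_powR//; have := @pi_ge2 R; lra.
rewrite /gaussian_density -mulrBr normrM ger0_norm//.
apply: le_trans (ler_piMl (normr_ge0 _) p1) _.
have -> : expR (- (l2norm (x - theta) ^+ 2 / 2)) =
   \prod_(i < d) expR (- ((x - v) ord0 i - (theta - v) ord0 i) ^+ 2 / 2).
  rewrite expR_l2norm; apply: eq_bigr => i _; rewrite -mulNr !mxE.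
  by congr (expR (- _ ^+ 2 / 2)); ring.
under [X in `|_ - X|]eq_bigr do rewrite /gfeat -big_split/=.
rewrite -(bigA_distr_bigA (fun i (b : 'I_k) =>
  gcoef b ((x - v) ord0 i) * gcoef b ((theta - v) ord0 i))).
have tv i : `|(theta - v) ord0 i| <= a by rewrite !mxE.
apply: le_trans (prod_diff_le (eta := 4 ^- k)
  (B := fun i => expR (16 * a ^+ 2 - (x - v) ord0 i ^+ 2 / 4)) _ _ _ _ _) _.
- by rewrite invr_ge0 exprn_ge0.
- by move=> i; rewrite ger0_norm ?expR_ge0// gauss_le_env.
- by move=> i; exact: sum_gcoef_le_env.
- by move=> i; exact: gauss_expansion_le.
rewrite -sum1_size sum1_card card_ord.
have -> : \prod_(i < d) expR (16 * a ^+ 2 - (x - v) ord0 i ^+ 2 / 4) =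
    expR (16 * d%:R * a ^+ 2) * expR (- (l2norm (x - v) ^+ 2 / 4)).
  rewrite -expR_sum -expRD; congr expR; rewrite big_split/= sumr_const card_ord.
  by rewrite sumrN -mulr_suml -sqr_l2norm -mulr_natl; ring.
by rewrite mulrA.
Qed.

Lemma measurable_gfeat k (b : {ffun 'I_d -> 'I_k}) v :
  measurable_fun [set: E] (fun theta => gfeat b (theta - v)).
Proof.
rewrite /gfeat.
under eq_fun do under eq_bigr do rewrite !mxE.
apply: (@measurable_rV_prod R d (fun i t => gcoef (b i) (t - v ord0 i))) => i.
have mt : measurable_fun [set: R] (fun t => t - v ord0 i) by exact: measurable_funB.
apply: measurable_funM => //; apply: measurable_funM; last exact: measurable_funX.
apply: measurableT_comp => //; apply: measurable_funM => //.
by apply: measurableT_comp => //; exact: measurable_funX.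
Qed.

Lemma bounded_measurable_gaussian x :
  bounded_measurable (fun theta : E => gaussian_density (x - theta)).
Proof.
split; last by exists 1 => t; rewrite ger0_norm ?gaussian_density_le1// ltW// gaussian_density_gt0.
exact: (measurableT_comp measurable_gaussian_sub (measurable_pair1 x)).
Qed.

Lemma bounded_measurable_gfeat k (b : {ffun 'I_d -> 'I_k}) v :
  bounded_measurable (fun theta : E => gfeat b (theta - v)).
Proof.
by split; [exact: measurable_gfeat|exists 1 => t; exact: gfeat_le1].
Qed.

Lemma bounded_measurable_indic (A : set E) : measurable A ->
  bounded_measurable (\1_A : E -> R).
Proof.
move=> mA; split; first exact: measurable_indic.
by exists 1 => t; rewrite indicE; case: (_ \in _); rewrite ?normr1 ?normr0.
Qed.

Lemma Rintegral_indic_prob G (A : set E) : measurable A ->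
  \int[G]_theta \1_A theta = fine (G A).
Proof. by move=> mA; rewrite /Rintegral integral_indic// setIT. Qed.

Section cells.
Variables (C : finType) (kappa : E -> option C) (ctr : C -> E) (near : pred C).
Variables (a : R) (D : set E) (eps1 eps2 delta : R) (k m : nat).
Hypothesis mcell : forall c, measurable (kappa @^-1` [set Some c]).
Hypothesis cell_ctr : forall theta c, kappa theta = Some c ->
  forall i, `|theta ord0 i - ctr c ord0 i| <= a.
Hypothesis eps1_ge0 : 0 <= eps1.
Hypothesis eps2_ge0 : 0 <= eps2.
Hypothesis outside : forall x theta, D x -> kappa theta = None ->
  gaussian_density (x - theta) <= eps1.
Hypothesis far : forall x theta c, D x -> kappa theta = Some c -> ~~ near c ->
  gaussian_density (x - theta) <= eps2 * expR (- (l2norm (x - ctr c) ^+ 2 / 8)).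
Hypothesis delta0 : 0 < delta.
Hypothesis k0 : (0 < k)%N.
Hypothesis m0 : (0 < m)%N.

Local Notation cell c := (kappa @^-1` [set Some c]).
Local Notation gam c x := (expR (- (l2norm (x - ctr c) ^+ 2 / 8))).
Local Notation mass G c := (fine (G (cell c))).
Local Notation feature := {ffun 'I_d -> 'I_k}.

Let mom G c (b : feature) : R := \int[G]_theta (\1_(cell c) theta * gfeat b (theta - ctr c)).

Let loc G c x : R := \int[G]_theta (\1_(cell c) theta * gaussian_density (x - theta)).

Let kd : R := (2 * pi) `^ (- (d%:R / 2)).

Let kd01 : 0 <= kd <= 1.
Proof.
rewrite powR_ge0/= /kd powRN invf_le1 ?powR_gt0 ?mulr_gt0 ?pi_gt0//.
by rewrite -[leLHS](powRr0 (2 * pi)) ler_powR//; have := @pi_ge2 R; lra.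
Qed.

Let eta := d%:R * 4 ^- k * expR (16 * d%:R * a ^+ 2) : R.

Let eta0 : 0 <= eta.
Proof. by rewrite !mulr_ge0 ?expR_ge0 ?invr_ge0 ?exprn_ge0. Qed.

Let mass_ge0 G c : 0 <= mass G c. Proof. exact: fine_ge0. Qed.

Let gam4_le c x : expR (- (l2norm (x - ctr c) ^+ 2 / 4)) <= gam c x.
Proof. by rewrite ler_expR; have := sqr_ge0 (l2norm (x - ctr c)); lra. Qed.

Let bmi c f : bounded_measurable f ->
  bounded_measurable (fun theta : E => \1_(cell c) theta * f theta : R).
Proof. by move=> bf; apply: bounded_measurableM => //; exact: bounded_measurable_indic. Qed.

Let loc_expansion G c x :
  `|loc G c x - kd * \sum_(b : feature) gfeat b (x - ctr c) * mom G c b| <=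
  mass G c * (eta * gam c x).
Proof.
have bg := bounded_measurable_gaussian x.
have bf (b : feature) := bmi c (bounded_measurable_gfeat b (ctr c)).
have -> : kd * \sum_(b : feature) gfeat b (x - ctr c) * mom G c b =
   \int[G]_theta (kd * \sum_(b : feature) gfeat b (x - ctr c) *
     (\1_(cell c) theta * gfeat b (theta - ctr c))).
  rewrite Rintegral_bZ; last first.
    apply: bounded_measurable_sum => b; apply: bounded_measurableM => //.
    exact: bounded_measurable_cst.
  rewrite Rintegral_bsum; last first.
    by move=> b; apply: bounded_measurableM => //; exact: bounded_measurable_cst.
  by congr (_ * _); apply: eq_bigr => b _; rewrite Rintegral_bZ.
set S := fun theta : E => _ * \sum_(_ | _) _.
have bS : bounded_measurable S.
  apply: bounded_measurableM; first exact: bounded_measurable_cst.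
  apply: bounded_measurable_sum => b; apply: bounded_measurableM => //.
  exact: bounded_measurable_cst.
have bloc := bmi c bg.
have pt theta : `|\1_(cell c) theta * gaussian_density (x - theta) - S theta| <=
    \1_(cell c) theta * (eta * gam c x).
  have -> : S theta = \1_(cell c) theta * (kd * \sum_(b : feature)
      gfeat b (x - ctr c) * gfeat b (theta - ctr c)).
    rewrite /S mulrCA; congr (_ * _); rewrite mulr_sumr.
    by apply: eq_bigr => b _; rewrite mulrCA.
  rewrite -mulrBr indicE; have [|_] := boolP (_ \in _); last by rewrite !mul0r normr0.
  rewrite inE/= => /cell_ctr tc; rewrite !mul1r.
  apply: le_trans (gaussian_density_expansion k x tc) _.
  by rewrite ler_wpM2l.
have bI : bounded_measurable (fun theta => \1_(cell c) theta * (eta * gam c x) : R).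
  by apply: bmi; exact: bounded_measurable_cst.
have bS' := bounded_measurableM (bounded_measurable_cst (-1)) bS.
have -> : loc G c x - \int[G]_theta S theta =
   \int[G]_theta (\1_(cell c) theta * gaussian_density (x - theta) + (-1) * S theta).
  by rewrite Rintegral_bD// (Rintegral_bZ G (-1) bS) mulN1r.
have -> : mass G c * (eta * gam c x) = \int[G]_theta (\1_(cell c) theta * (eta * gam c x)).
  under eq_Rintegral do rewrite mulrC.
  by rewrite Rintegral_bZ ?Rintegral_indic_prob// 1?mulrC//; exact: bounded_measurable_indic.
have bI' := bounded_measurableM (bounded_measurable_cst (-1)) bI.
rewrite ler_norml -[X in X <= _](mulN1r) -Rintegral_bZ//.
apply/andP; split; apply: le_Rintegral_b => //; try exact: bounded_measurableD.
  by move=> t; have := pt t; rewrite ler_norml => /andP[+ _]; rewrite !mulN1r.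
by move=> t; have := pt t; rewrite ler_norml => /andP[_]; rewrite !mulN1r.
Qed.

Let mom_le1 G c b : `|mom G c b| <= 1.
Proof.
apply: norm_Rintegral_b_le; first exact/bmi/bounded_measurable_gfeat.
move=> t; rewrite normrM -[leRHS]mulr1 ler_pM//; last exact: gfeat_le1.
by rewrite indicE; case: (_ \in _); rewrite ?normr1 ?normr0.
Qed.

Let loc_ge0 G c x : 0 <= loc G c x.
Proof.
by apply: Rintegral_ge0 => t _; rewrite mulr_ge0// ltW// gaussian_density_gt0.
Qed.

Let mixture_le_loc G x : D x -> mixture_density G x <= eps1 + \sum_c loc G c x.
Proof.
move=> Dx; rewrite /loc -Rintegral_bsum; last by move=> c; exact/bmi/bounded_measurable_gaussian.
have bs : bounded_measurable (fun t : E => \sum_c \1_(cell c) t * gaussian_density (x - t) : R).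
  by apply: bounded_measurable_sum => c; exact/bmi/bounded_measurable_gaussian.
rewrite -[X in X + _](Rintegral_bcst G) -Rintegral_bD//; last exact: bounded_measurable_cst.
apply: le_Rintegral_b => //; first exact: bounded_measurable_gaussian.
  by apply: bounded_measurableD => //; exact: bounded_measurable_cst.
move=> t; case kt : (kappa t) => [c|].
  rewrite (bigD1 c)//= indicE mem_set//= mul1r addrCA lerDl addr_ge0// sumr_ge0// => i _.
  by rewrite mulr_ge0// ltW// gaussian_density_gt0.
by apply: le_trans (outside Dx kt) _; rewrite lerDl sumr_ge0// => i _;
  rewrite mulr_ge0// ltW// gaussian_density_gt0.
Qed.

Let loc_le_mixture G x : \sum_c loc G c x <= mixture_density G x.
Proof.
rewrite /loc -Rintegral_bsum; last by move=> c; exact/bmi/bounded_measurable_gaussian.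
apply: le_Rintegral_b.
- by apply: bounded_measurable_sum => c; exact/bmi/bounded_measurable_gaussian.
- exact: bounded_measurable_gaussian.
move=> t; case kt : (kappa t) => [c|].
  rewrite (bigD1 c)//= indicE mem_set//= mul1r big1 ?addr0// => i ic.
  rewrite indicE memNset ?mul0r//= kt => -[ci].
  by rewrite ci eqxx in ic.
rewrite big1 ?ltW ?gaussian_density_gt0// => i _.
by rewrite indicE memNset ?mul0r//= kt.
Qed.

Let far_le G c x : D x -> ~~ near c -> loc G c x <= mass G c * (eps2 * gam c x).
Proof.
move=> Dx nc.
have -> : mass G c * (eps2 * gam c x) = \int[G]_theta (\1_(cell c) theta * (eps2 * gam c x)).
  under eq_Rintegral do rewrite mulrC.
  by rewrite Rintegral_bZ ?Rintegral_indic_prob// 1?mulrC//; exact: bounded_measurable_indic.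
apply: le_Rintegral_b; first exact/bmi/bounded_measurable_gaussian.
  exact/bmi/bounded_measurable_cst.
move=> t; rewrite indicE; have [|_] := boolP (_ \in _); last by rewrite !mul0r.
by rewrite inE/= => kt; rewrite !mul1r far.
Qed.

Let B := expR (d%:R * a ^+ 2 / 2) : R.

Let b0 : feature := [ffun=> Ordinal k0].

(* On a cell the feature of degree zero is bounded below by 1 / B, so that it
   controls the mass. *)
Let mass_le_mom G c : mass G c <= B * mom G c b0.
Proof.
have bf := bmi c (bounded_measurable_gfeat b0 (ctr c)).
rewrite -Rintegral_indic_prob// /mom -Rintegral_bZ//.
apply: le_Rintegral_b; first exact: bounded_measurable_indic.
  by apply: bounded_measurableM => //; exact: bounded_measurable_cst.
move=> t; rewrite indicE; have [|_] := boolP (_ \in _); last by rewrite !mul0r mulr0.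
rewrite inE/= => /cell_ctr tc; rewrite mul1r.
have -> : gfeat b0 (t - ctr c) = expR (- (l2norm (t - ctr c) ^+ 2 / 2)).
  rewrite expR_l2norm; apply: eq_bigr => i _.
  by rewrite /gcoef ffunE/= fact0 sqrtr1 expr0 divr1 mulr1 mulNr.
rewrite /B -expRD -[leLHS]expR0 ler_expR -mulrBl divr_ge0// subr_ge0.
rewrite sqr_l2norm; apply: (@le_trans _ _ (\sum_(i < d) a ^+ 2)).
  apply: ler_sum => i _; have := tc i; 
  rewrite -[_ - ctr c ord0 i](_ : (t - ctr c) ord0 i = _) ?mxE//.
  move=> h; rewrite -[leLHS]real_normK ?num_real// ler_pXn2r// ?nnegrE//.
  by rewrite (le_trans _ h).
by rewrite sumr_const card_ord mulr_natl.
Qed.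

Let mom_le_mass G c : mom G c b0 <= mass G c.
Proof.
rewrite -Rintegral_indic_prob//; apply: le_Rintegral_b; first exact/bmi/bounded_measurable_gfeat.
  exact: bounded_measurable_indic.
move=> t; rewrite -[leRHS]mulr1 ler_wpM2l//.
by apply: le_trans (ler_norm _) _; exact: gfeat_le1.
Qed.

Let feature_bound := 2 ^+ (k * d) * (#|feature|)%:R : R.

(* Both contributions of the cell are expanded. The truncation error of G is
   proportional to the mass of the cell, which the degree zero feature transfers
   to G'. *)
Let active_le G G' c x :
  (forall b, `|mom G c b - mom G' c b| <= delta) ->
  loc G c x <= loc G' c x +
    ((B + 1) * (mass G' c + delta) * eta + delta * feature_bound) * gam c x.
Proof.
move=> close.
have /andP[kd0 kd1] := kd01.
have := loc_expansion G c x; rewrite ler_norml => /andP[_ e1].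
have := loc_expansion G' c x; rewrite ler_norml => /andP[e2 _].
have e3 : kd * (\sum_(b : feature) gfeat b (x - ctr c) * mom G c b) -
   kd * (\sum_(b : feature) gfeat b (x - ctr c) * mom G' c b) <=
   delta * feature_bound * gam c x.
  rewrite -mulrBr -sumrB.
  apply: (@le_trans _ _ (kd * (delta * feature_bound * gam c x))); last first.
    by rewrite ler_piMl// !mulr_ge0 ?expR_ge0 ?exprn_ge0// ltW.
  rewrite ler_wpM2l//.
  apply: (@le_trans _ _ (\sum_(b : feature) (2 ^+ (k * d) * gam c x) * delta)).
    apply: ler_sum => b _; rewrite -mulrBr.
    apply: le_trans (ler_norm _) _; rewrite normrM ler_pM//.
    apply: le_trans (gfeat_le _ _) _.
    by rewrite ler_wpM2l ?exprn_ge0.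
  by rewrite sumr_const -[leLHS]mulr_natr /feature_bound; lra.
have e4 : mass G c <= B * (mass G' c + delta).
  apply: le_trans (mass_le_mom G c) _; rewrite ler_wpM2l ?expR_ge0//.
  have := close b0; have := mom_le_mass G' c; rewrite ler_norml => h /andP[_]; lra.
have e5 := ler_wpM2r (mulr_ge0 eta0 (expR_ge0 (- (l2norm (x - ctr c) ^+ 2 / 8)))) e4.
have : 0 <= delta * (eta * gam c x) by rewrite !mulr_ge0 ?expR_ge0// ltW.
move: e1 e2 e3 e5; set u := kd * _; set v := kd * _; set g := gam c x.
move=> *; lra.
Qed.

Let lev := quantize_levels delta.

Let qfeat G c : {ffun feature -> 'I_lev} := [ffun b => quantize delta (mom G c b)].

Let active G : {set C} := [set c | near c || (m%:R^-1 <= mass G c)].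

Let K := (#|near| + m)%N.

Let card_active G : (#|active G| <= K)%N.
Proof.
have -> : active G = [set c | near c] :|: [set c | m%:R^-1 <= mass G c].
  by apply/setP => c; rewrite !inE.
apply: leq_trans (leq_card_setU _ _) _; rewrite cardsE leq_add2l.
set H := [set c | _]%SET; have mR : 0 < m%:R :> R by rewrite ltr0n.
rewrite -(ler_nat R) -[leRHS]mul1r -ler_pdivrMr// mulr_natl -sumr_const.
apply: (@le_trans _ _ (\sum_(c in H) mass G c)).
  by apply: ler_sum => c; rewrite inE.
apply: (@le_trans _ _ (\sum_c mass G c)).
  by rewrite [leRHS](bigID (mem H))/= lerDl sumr_ge0.
under eq_bigr do rewrite -Rintegral_indic_prob//.
rewrite -Rintegral_bsum; last by move=> c; exact: bounded_measurable_indic.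
rewrite -[leRHS](Rintegral_bcst G); apply: le_Rintegral_b.
- by apply: bounded_measurable_sum => c; exact: bounded_measurable_indic.
- exact: bounded_measurable_cst.
move=> t; case kt : (kappa t) => [c|].
  rewrite (bigD1 c)//= indicE mem_set//= big1 ?addr0// => i ic.
  rewrite indicE memNset//= kt => -[ci].
  by rewrite ci eqxx in ic.
by rewrite big1// => i _; rewrite indicE memNset//= kt.
Qed.

Let code G : {ffun 'I_K -> option (C * {ffun feature -> 'I_lev})} :=
  [ffun i : 'I_K => omap (fun c => (c, qfeat G c))
     (nth None [seq Some c | c <- enum (active G)] i)].

Let code_inj G G' c : code G = code G' -> c \in active G -> qfeat G c = qfeat G' c.
Proof.
move=> GG' cA; have cE : c \in enum (active G) by rewrite mem_enum.
have iK : (index c (enum (active G)) < K)%N.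
  by apply: leq_trans (card_active G); rewrite cardE index_mem.
move: GG' => /ffunP/(_ (Ordinal iK)); rewrite !ffunE/=.
rewrite (nth_map c) ?index_mem// nth_index//=.
by case: nth => [c'|]//= [<-] ->.
Qed.

(** The class of G records its active cells, which are the near ones and those of
mass at least 1 / m, together with the rounded features of each. The three parts of
the envelope are the light far cells, the truncation of the kernel expansion and
the rounding of the features. *)
Lemma mixture_net : exists (J : finType) (iota : probability E R -> J),
  #|J| = ((#|C| * quantize_levels delta ^ (k ^ d)).+1 ^ (#|near| + m))%N /\
  forall G G' x, iota G = iota G' -> D x ->
    mixture_density G x <= mixture_density G' x + eps1 +
      \sum_c (eps2 / m%:R + (B + 1) * (mass G' c + delta) * eta +
              delta * (2 ^+ (k * d) * (k ^ d)%:R)) * gam c x.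
Proof.
exists {ffun 'I_K -> option (C * {ffun feature -> 'I_lev})}, code; split.
  by rewrite card_ffun card_option card_prod !card_ffun !card_ord.
move=> G G' x GG' Dx.
have fb : feature_bound = 2 ^+ (k * d) * (k ^ d)%:R.
  by rewrite /feature_bound card_ffun !card_ord.
rewrite -fb.
apply: le_trans (mixture_le_loc G Dx) _.
rewrite -addrA addrCA lerD2l.
apply: le_trans (lerD (loc_le_mixture G' x) (lexx _)); rewrite -big_split/=.
apply: ler_sum => c _.
have g0 := expR_ge0 (- (l2norm (x - ctr c) ^+ 2 / 8)).
have d0 := ltW delta0.
have p1 : 0 <= eps2 / m%:R * gam c x by rewrite !mulr_ge0 ?invr_ge0.
have p2 : 0 <= ((B + 1) * (mass G' c + delta) * eta + delta * feature_bound) * gam c x.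
  rewrite mulr_ge0// addr_ge0// !mulr_ge0 ?addr_ge0 ?expR_ge0 ?exprn_ge0//.
rewrite -addrA mulrDl.
have [cA|cA] := boolP (c \in active G).
  have : forall b, `|mom G c b - mom G' c b| <= delta.
    move=> b; apply: (quantize_close delta0) => //.
    by have /ffunP/(_ b) := code_inj GG' cA; rewrite !ffunE.
  by move=> /(active_le x); lra.
move: cA; rewrite inE negb_or -ltNge => /andP[nc lc].
have h1 := far_le G Dx nc.
have h2 : mass G c * (eps2 * gam c x) <= eps2 / m%:R * gam c x.
  have -> : eps2 / m%:R * gam c x = m%:R^-1 * (eps2 * gam c x).
    by rewrite [RHS]mulrA [m%:R^-1 * eps2]mulrC.
  by apply: ler_wpM2r; [rewrite mulr_ge0|exact: ltW].
have := loc_ge0 G' c x; lra.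
Qed.

End cells.

End mixture_net.

(** * Distance to a set and packings *)

Section distance_and_packing.
Context {R : realType} {d : nat}.
Local Notation E := 'rV[R]_d.
Implicit Types (S : set E) (x u : E).

Lemma continuous_l2norm_sub u : continuous (fun x : E => l2norm (x - u)).
Proof.
have cs : continuous (fun x : E => \sum_(i < d) (x - u) ord0 i ^+ 2).
  apply: continuous_big => [|i _ x]; first exact: add_continuous.
  apply: (@continuous_comp _ _ _ (fun x : E => (x - u) ord0 i) (fun t : R => t ^+ 2));
    last exact: sqr_continuous.
  rewrite (_ : (fun x : E => (x - u) ord0 i) = (fun x : E => x ord0 i - u ord0 i)); last first.
    by apply/funext => y; rewrite !mxE.
  apply: (@continuousB R R^o _ (fun x : E => x ord0 i) (fun=> u ord0 i)).
    exact: coord_continuous.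
  exact: cst_continuous.
move=> x; apply: (@continuous_comp _ _ _
  (fun x : E => \sum_(i < d) (x - u) ord0 i ^+ 2) (@Num.sqrt R)).
  exact: cs.
exact: sqrt_continuous.
Qed.

Lemma dist_to_ge0 S x : 0 <= dist_to S x.
Proof.
have [S0|/set0P S0] := eqVneq S set0.
  by rewrite /dist_to S0 image_set0 inf0.
apply: lb_le_inf; first by case: S0 => u Su; exists (l2norm (x - u)), u.
by move=> _ [u _ <-]; exact: l2norm_ge0.
Qed.

Lemma dist_to_le S x u : S u -> dist_to S x <= l2norm (x - u).
Proof.
move=> Su; apply: ge_inf; last by exists u.
by exists 0 => _ [v _ <-]; exact: l2norm_ge0.
Qed.

Lemma dist_to_lt S x (t : R) : S !=set0 -> dist_to S x < t ->
  exists2 u, S u & l2norm (x - u) < t.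
Proof.
move=> [u0 Su0] xt; have h0 : 0 < t - dist_to S x by rewrite subr_gt0.
have [|_ [u Su <-]] := inf_adherent (E := [set l2norm (x - u) | u in S]) h0.
  split; first by exists (l2norm (x - u0)), u0.
  by exists 0 => _ [v _ <-]; exact: l2norm_ge0.
by rewrite -/(dist_to S x) subrKC => h; exists u.
Qed.

Lemma dist_to_in S x : S x -> dist_to S x = 0.
Proof.
move=> Sx; apply/eqP; rewrite eq_le dist_to_ge0 andbT.
apply: le_trans (dist_to_le _ Sx) _; rewrite subrr /l2norm big1 ?sqrtr0// => i _.
by rewrite mxE expr0n.
Qed.

Lemma measurable_dist_to S : S !=set0 -> measurable_fun [set: E] (dist_to S).
Proof.
move=> S0 mE; apply: (measurability _ (RGenInftyO.measurableE R)) => //.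
move=> _ [_ [t ->] <-]; rewrite setTI.
rewrite (_ : _ @^-1` _ = \bigcup_(u in S) [set x | l2norm (x - u) < t]); last first.
  apply/seteqP; split=> x /=; rewrite in_itv/=.
    by move=> /(dist_to_lt S0)[u Su xu]; exists u.
  by move=> [u Su /=]; apply: le_lt_trans; exact: dist_to_le.
apply: open_measurable_rV; apply: bigcup_open => u _.
have /continuousP/(_ _ (@open_lt R t)) := @continuous_l2norm_sub u.
exact.
Qed.

Lemma measurable_enlargement S : S !=set0 -> measurable (enlargement S).
Proof.
move=> S0; rewrite (_ : enlargement S = [set: E] `&` dist_to S @^-1` `]-oo, 1]).
  by apply: measurable_dist_to => //; exact: measurable_itv.
by rewrite setTI; apply/seteqP; split=> x /=; rewrite in_itv.
Qed.

Definition box (s : E) (c : R) : set E := [set x | forall i, `|x ord0 i - s ord0 i| <= c].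

Lemma box_itvE s c : box s c =
  [set x | forall i, (`[s ord0 i - c, s ord0 i + c]%classic : set (measurableTypeR R)) (x ord0 i)].
Proof.
apply/seteqP; split=> x h i; have := h i; rewrite /= in_itv/= ler_distl.
  by [].
by [].
Qed.

Lemma measurable_box s c : measurable (box s c).
Proof.
rewrite box_itvE [X in measurable X](_ : _ = \bigcap_(i in setT)
   (rV_coord i @^-1` `[s ord0 i - c, s ord0 i + c]%classic)); last first.
  by apply/seteqP; split=> y yA i; [move=> _; exact: yA|exact: yA i I].
apply: fin_bigcap_measurable => // i _.
rewrite -[X in measurable X]setTI; exact: measurable_rV_coord.
Qed.

Lemma lebesgue_box s c : 0 <= c -> lebesgue_rV d (box s c) = ((2 * c) ^+ d)%:E.
Proof.
move=> c0.
rewrite box_itvE (lebesgue_rV_box (A := fun i => `[s ord0 i - c, s ord0 i + c]%classic))//.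
  transitivity (\prod_(i < d) (2 * c)%:E)%E; last by rewrite prodEFin prodr_const card_ord.
  apply: eq_bigr => i _; rewrite lebesgue_measure_itv/= lte_fin.
  case: ltP => [_|h]; first by rewrite -EFinD; congr EFin; ring.
  by congr EFin; lra.
Qed.

Lemma box_sub_enlargement S s : (0 < d)%N -> S s ->
  box s (4 * d%:R)^-1 `<=` enlargement S.
Proof.
move=> d0 Ss x xs; rewrite /enlargement/=; apply: le_trans (dist_to_le _ Ss) _.
have dR : 1 <= d%:R :> R by rewrite ler1n.
rewrite -(@ler_pXn2r _ 2)// ?nnegrE ?l2norm_ge0// expr1n sqr_l2norm.
apply: (@le_trans _ _ (\sum_(i < d) (4 * d%:R)^-1 ^+ 2)).
  apply: ler_sum => i _; rewrite !mxE -[leLHS]real_normK ?num_real//.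
  by rewrite ler_pXn2r ?nnegrE ?invr_ge0 ?mulr_ge0//; exact: xs.
rewrite sumr_const card_ord -[leLHS]mulr_natl exprVn exprMn.
rewrite ler_pdivrMr ?mulr_gt0 ?exprn_gt0 ?(lt_le_trans _ dR)// mul1r !expr2; nra.
Qed.

(** The centres of a maximal packing of S by disjoint boxes of half-side 1 / (4 d),
which stay inside the enlargement: disjointness bounds their number by the volume,
maximality makes them a net. *)
Lemma packing S : (0 < d)%N -> S !=set0 -> (lebesgue_rV d (enlargement S) < +oo)%E ->
  exists m (s : 'I_m -> E), [/\ (0 < m)%N,
    ((m%:R * (2 * d%:R)^-1 ^+ d)%:E <= lebesgue_rV d (enlargement S))%E &
    forall x, exists j, forall i, `|x ord0 i - s j ord0 i| <= dist_to S x + 1].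
Proof.
move=> d0 S0 Voo.
have dR : 1 <= d%:R :> R by rewrite ler1n.
have dR0 : 0 < d%:R :> R by rewrite ltr0n.
pose c := (4 * d%:R)^-1 : R.
have c0 : 0 < c by rewrite invr_gt0 mulr_gt0.
have c2 : 2 * c = (2 * d%:R)^-1 by rewrite /c; field; rewrite gt_eqF.
(* The boxes of half-side c about points at sup distance more than 2 c are disjoint. *)
pose sep m (s : 'I_m -> E) := (forall j, S (s j)) /\
  (forall j k, j != k -> exists i, 2 * c < `|s j ord0 i - s k ord0 i|).
have vol m s : @sep m s -> ((m%:R * (2 * d%:R)^-1 ^+ d)%:E <= lebesgue_rV d (enlargement S))%E.
  move=> [sS ssep].
  have <- : lebesgue_rV d (\big[setU/set0]_(j < m) box (s j) c) =
      (m%:R * (2 * d%:R)^-1 ^+ d)%:E.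
    rewrite measure_semi_additive_ord//.
    - rewrite (eq_bigr (fun=> ((2 * d%:R)^-1 ^+ d)%:E)).
        rewrite sumEFin; congr EFin; rewrite sumr_const card_ord.
        by apply/esym; exact: mulr_natl.
      by move=> j _; apply: etrans (lebesgue_box _ (ltW c0)) _; rewrite c2.
    - by move=> j; exact: measurable_box.
    - apply/trivIsetP => j k _ _ jk; apply/seteqP; split=> // x [xj xk].
      have [i] := ssep j k jk; rewrite ltNge => /negP; apply.
      have -> : s j ord0 i - s k ord0 i = (x ord0 i - s k ord0 i) - (x ord0 i - s j ord0 i) by ring.
      apply: le_trans (ler_normB _ _) _.
      by have := xj i; have := xk i; lra.
    - by apply: bigsetU_measurable => j _; exact: measurable_box.
  apply: le_measure; rewrite ?inE.
  - by apply: bigsetU_measurable => j _; exact: measurable_box.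
  - exact: measurable_enlargement.
  - rewrite -bigcup_seq; apply: bigcup_sub => j _; exact: box_sub_enlargement.
pose P m := `[< exists s, @sep m s >].
have v0 : 0 < (2 * d%:R)^-1 ^+ d :> R by rewrite exprn_gt0// invr_gt0 mulr_gt0.
have Vfin : lebesgue_rV d (enlargement S) \is a fin_num.
  by rewrite ge0_fin_numE.
pose N := Num.truncn (fine (lebesgue_rV d (enlargement S)) / (2 * d%:R)^-1 ^+ d).
have PN m : P m -> (m <= N)%N.
  move=> /asboolP[s /vol]; rewrite -(fineK Vfin) lee_fin -ler_pdivlMr// => h.
  by rewrite /N truncn_ge_nat//; apply: le_trans h.
have P1 : P 1%N.
  apply/asboolP; case: S0 => u Su; exists (fun=> u); split=> // j k.
  by rewrite !ord1 eqxx.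
have exP : exists m, P m by exists 1%N.
case: (ex_maxnP exP PN) => m /asboolP[s [sS ssep]] mmax.
have m0 : (0 < m)%N by exact: mmax P1.
exists m, s; split=> //; first by apply: (vol m s); split.
move=> x.
have [|u Su xu] := @dist_to_lt S x (dist_to S x + 2^-1) S0; first by rewrite ltrDl.
have [j hj] : exists j, forall i, `|u ord0 i - s j ord0 i| <= 2 * c.
  (* Otherwise u could be added to the packing. *)
  apply: contrapT => /forallNP h.
  suff /mmax : P m.+1 by rewrite ltnn.
  apply/asboolP; exists (fun j => if unlift ord0 j is Some k then s k else u); split.
    by move=> j; case: unliftP => [k _|_].
  have hs j : exists i, 2 * c < `|u ord0 i - s j ord0 i|.
    have /existsNP[i /negP] := h j; rewrite -ltNge => hi.
    by exists i.
  move=> j k; case: unliftP => [j' ->|->]; case: unliftP => [k' ->|->].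
  - by rewrite (inj_eq lift_inj) => /ssep.
  - by move=> _; have [i] := hs j'; exists i; rewrite distrC.
  - by move=> _; exact: hs.
  - by rewrite eqxx.
exists j => i.
have -> : x ord0 i - s j ord0 i = (x - u) ord0 i + (u ord0 i - s j ord0 i) by rewrite !mxE; ring.
apply: le_trans (ler_normD _ _) _.
have := normr_coord_le_l2norm (x - u) i; have := hj i.
have : 2 * c <= 2^-1 by rewrite c2 lef_pV2 ?posrE ?mulr_gt0// ler_peMr.
lra.
Qed.

End distance_and_packing.

(** * The envelope and the mass far from the support *)

Section envelope_and_tail.
Context {R : realType} {d : nat}.
Local Notation E := 'rV[R]_d.
Local Notation lam := (lebesgue_rV d).
Local Notation mu := (@lebesgue_measure R).
Implicit Types (x z v theta : E).

Lemma pi_lt4 : pi < 4 :> R. Proof. by have := @pihalf_lt2 R; lra. Qed.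

Lemma pi_ge1 : 1 <= pi :> R. Proof. by have := @pi_ge2 R; lra. Qed.

Lemma measurable_gauss8 v :
  measurable_fun [set: E] (fun x => expR (- (l2norm (x - v) ^+ 2 / 8))).
Proof.
apply: measurableT_comp => //; apply: measurableT_comp => //.
apply: measurable_funM => //; apply: measurable_funX.
apply: (measurableT_comp measurable_l2norm).
exact: (measurableT_comp measurable_rV_sub (measurable_pair2 v)).
Qed.

Lemma integral_gauss8_le v :
  (\int[lam]_x (expR (- (l2norm (x - v) ^+ 2 / 8)))%:E <= (6 ^+ d)%:E)%E.
Proof.
under eq_integral do rewrite expR_l2norm.
have E1 x : \prod_(i < d) expR (- ((x - v) ord0 i ^+ 2 / 8)) =
    \prod_(i < d) expR (- (x ord0 i - v ord0 i) ^+ 2 / (2 ^+ 2 *+ 2)).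
  apply: eq_bigr => i _; congr expR; rewrite !mxE mulNr; congr (- (_ / _)).
  by rewrite -mulr_natr expr2; ring.
under eq_integral do rewrite E1.
rewrite (ge0_integral_rV_prod (u := fun i t => expR (- (t - v ord0 i) ^+ 2 / (2 ^+ 2 *+ 2))))//.
- under eq_bigr do rewrite integral_gauss_scaled//.
  rewrite prodEFin lee_fin prodr_const card_ord lerXn2r ?nnegrE//.
  rewrite -(@ler_pXn2r _ 2)// ?nnegrE// sqr_sqrtr ?mulrn_wge0 ?mulr_ge0 ?pi_ge0//.
  by rewrite -mulr_natr !expr2; have := pi_lt4; lra.
- move=> i; exact: measurable_normal_fun.
Qed.

Definition cauchy_density z : R := \prod_(i < d) (pi * (1 + z ord0 i ^+ 2))^-1.

Let cauchy1_gt0 (t : R) : 0 < pi * (1 + t ^+ 2).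
Proof. by rewrite mulr_gt0 ?pi_gt0// ltr_pwDl// sqr_ge0. Qed.

Lemma cauchy_density_gt0 z : 0 < cauchy_density z.
Proof. by apply: prodr_gt0 => i _; rewrite invr_gt0. Qed.

Lemma cauchy_density_le1 z : cauchy_density z <= 1.
Proof.
apply: prodr_ile1 => i _; rewrite invr_ge0 ltW//= invf_le1//.
by rewrite mulr_ege1 ?pi_ge1// lerDl sqr_ge0.
Qed.

Lemma cauchy_density_ge z (u : R) : 0 <= u -> (forall i, `|z ord0 i| <= u) ->
  (4 * (1 + u) ^+ 2) ^- d <= cauchy_density z.
Proof.
move=> u0 zu; rewrite -exprVn.
have -> : (4 * (1 + u) ^+ 2)^-1 ^+ d = \prod_(i < d) (4 * (1 + u) ^+ 2)^-1.
  by rewrite prodr_const card_ord.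
have p0 : 0 < 4 * (1 + u) ^+ 2 by rewrite mulr_gt0// exprn_gt0// ltr_pwDl.
apply: ler_prod => i _; rewrite invr_ge0 ltW//= lef_pV2 ?posrE//.
apply: ler_pM; rewrite ?pi_ge0 ?addr_ge0 ?sqr_ge0//; first by rewrite ltW// pi_lt4.
have : z ord0 i ^+ 2 <= u ^+ 2.
  by rewrite -[leLHS]real_normK ?num_real// ler_pXn2r// nnegrE.
by rewrite sqrrD expr1n mul1r; lra.
Qed.

Lemma measurable_cauchy_sub v : measurable_fun [set: E] (fun x => cauchy_density (x - v)).
Proof.
rewrite /cauchy_density; under eq_fun do under eq_bigr do rewrite !mxE.
apply: (@measurable_rV_prod R d (fun i t => (pi * (1 + (t - v ord0 i) ^+ 2))^-1)) => i.
apply: measurable_fun_inv_gt0 => //; apply: measurable_funM => //.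
by apply: measurable_funD => //; apply: measurable_funX; exact: measurable_funB.
Qed.

Lemma integral_cauchy_density v : (\int[lam]_x (cauchy_density (x - v))%:E = 1)%E.
Proof.
rewrite /cauchy_density; under eq_integral do under eq_bigr do rewrite !mxE.
rewrite (ge0_integral_rV_prod (u := fun i t => (pi * (1 + (t - v ord0 i) ^+ 2))^-1))//.
- by rewrite big1// => i _; exact: integral_cauchy.
- move=> i; apply: measurable_fun_inv_gt0 => //; apply: measurable_funM => //.
  by apply: measurable_funD => //; apply: measurable_funX; exact: measurable_funB.
- by move=> i t; rewrite invr_ge0 ltW.
Qed.

Section heavy_tailed_floor.
Variables (m : nat) (s : 'I_m -> E) (eps0 : R).
Hypothesis m0 : (0 < m)%N.
Hypothesis eps00 : 0 < eps0.
Hypothesis eps01 : eps0 <= 1.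

Let mR : 0 < m%:R :> R. Proof. by rewrite ltr0n. Qed.

(** Polynomial tails keep the logarithm of the inverse of the floor small far from the
net; the total mass is eps0. *)
Definition floor_density x : R :=
  eps0 / m%:R * \sum_(j < m) cauchy_density (x - s j).

Lemma floor_density_gt0 x : 0 < floor_density x.
Proof.
rewrite mulr_gt0 ?divr_gt0// (bigD1 (Ordinal m0))//= ltr_pwDl ?cauchy_density_gt0//.
by apply: sumr_ge0 => j _; rewrite ltW// cauchy_density_gt0.
Qed.

Lemma floor_density_le1 x : floor_density x <= 1.
Proof.
rewrite /floor_density -mulrA; apply: mulr_ile1 => //; first exact: ltW.
  by rewrite mulr_ge0 ?invr_ge0// sumr_ge0// => j _; rewrite ltW// cauchy_density_gt0.
rewrite ler_pdivrMl// mulr1; apply: (@le_trans _ _ (\sum_(j < m) 1)).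
  by apply: ler_sum => j _; exact: cauchy_density_le1.
by rewrite sumr_const card_ord.
Qed.

Lemma measurable_floor_density : measurable_fun [set: E] floor_density.
Proof.
apply: measurable_funM => //; apply: measurable_sum => j.
exact: measurable_cauchy_sub.
Qed.

Lemma integral_floor_density : (\int[lam]_x (floor_density x)%:E = eps0%:E)%E.
Proof.
have mc j := measurable_cauchy_sub (s j).
under eq_integral do rewrite EFinM -sumEFin.
rewrite ge0_integralZl//.
- rewrite ge0_integral_sum//; last 2 first.
    by move=> j; apply/measurable_EFinP.
    by move=> j x _; rewrite lee_fin ltW// cauchy_density_gt0.
  under eq_bigr do rewrite integral_cauchy_density.
  by rewrite sumEFin -EFinM sumr_const card_ord divfK// gt_eqF.
- by apply: emeasurable_sum => j; exact/measurable_EFinP.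
- by move=> x _; apply: sume_ge0 => j _; rewrite lee_fin ltW// cauchy_density_gt0.
- by rewrite lee_fin divr_ge0// ltW.
Qed.

Lemma ln_floor_density_le x j (u : R) : 0 <= u ->
  (forall i, `|x ord0 i - s j ord0 i| <= u) ->
  ln (floor_density x)^-1 <= ln (m%:R / eps0) + d%:R * ln 4 + 2 * d%:R * ln (1 + u).
Proof.
move=> u0 xu.
have p0 : 0 < 4 * (1 + u) ^+ 2 by rewrite mulr_gt0// exprn_gt0// ltr_pwDl.
have u1 : 0 < 1 + u by rewrite ltr_pwDl.
have e1 : ln (4 * (1 + u) ^+ 2) = ln 4 + 2 * ln (1 + u).
  by rewrite lnM ?posrE ?exprn_gt0// lnXn// mulr_natl.
have q0 : 0 < m%:R / eps0 by rewrite divr_gt0.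
have r0 : 0 < (4 * (1 + u) ^+ 2) ^+ d by rewrite exprn_gt0.
have -> : ln (m%:R / eps0) + d%:R * ln 4 + 2 * d%:R * ln (1 + u) =
    ln (m%:R / eps0 * (4 * (1 + u) ^+ 2) ^+ d).
  by rewrite [RHS]lnM ?posrE// lnXn// e1 -[_ *+ d]mulr_natl; ring.
rewrite ler_ln ?posrE ?invr_gt0 ?floor_density_gt0 ?(mulr_gt0 q0 r0)//.
rewrite -[leRHS]invrK lef_pV2 ?posrE ?floor_density_gt0 ?invr_gt0 ?(mulr_gt0 q0 r0)//.
rewrite invfM invf_div /floor_density ler_pM2l ?divr_gt0//.
apply: (@le_trans _ _ (cauchy_density (x - s j))).
  by apply: cauchy_density_ge => // i; rewrite !mxE.
rewrite (bigD1 j)//= lerDl sumr_ge0// => k _.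
by rewrite ltW// cauchy_density_gt0.
Qed.

Section tail.
Variables (S : set E) (M p : R).
Hypothesis S0 : S !=set0.
Hypothesis M8 : 8 <= M.
Hypothesis p0 : 0 < p.
Hypothesis s_net : forall x, exists j, forall i,
  `|x ord0 i - s j ord0 i| <= dist_to S x + 1.

Let D : set E := \bigcup_(j in [set: 'I_m]) box (s j) M.

Let A1 := ln (m%:R / eps0) + d%:R * ln 4.

Let A1_ge0 : 0 <= A1.
Proof.
rewrite addr_ge0 ?mulr_ge0 ?ln_ge0 ?ler1n//.
rewrite ler_pdivlMr// mul1r (le_trans eps01)// ler1n//.
Qed.

Let le_expR8 (r : R) : r <= 2 * expR (r ^+ 2 / 8).
Proof.
have := expR_ge1Dx (r ^+ 2 / 8); have := sqr_ge0 (r - 2); rewrite sqrrB; lra.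
Qed.

Let lnM_ge0 : 0 <= ln (2 * M).
Proof. by have M8' := M8; rewrite ln_ge0//; lra. Qed.

Let B1_ge0 : 0 <= A1 + 2 * d%:R * ln (2 * M) + 2 * d%:R / p.
Proof.
apply: addr_ge0; last by rewrite divr_ge0 ?mulr_ge0// ltW.
by apply: addr_ge0; [exact: A1_ge0|rewrite !mulr_ge0].
Qed.

Let B2_ge0 : 0 <= A1 + 8 * d%:R.
Proof. by apply: addr_ge0; [exact: A1_ge0|rewrite mulr_ge0]. Qed.

(* A point x at distance more than M from the net is so because theta is far from S
   or because the noise x - theta is large; the larger of the two accounts for half
   of the distance. *)
Let tail_pointwise x theta :
  \1_(~` D) x * ln (floor_density x)^-1 <=
  (A1 + 2 * d%:R * ln (2 * M) + 2 * d%:R / p) * (3 / M) `^ p * dist_to S theta `^ p +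
  (A1 + 8 * d%:R) * expR (- (M ^+ 2 / 32)) * expR (l2norm (x - theta) ^+ 2 / 4).
Proof.
have M8' := M8.
have M0 : 0 < M by lra.
have d0 : 0 <= d%:R :> R by [].
have lnM0 := lnM_ge0.
set t1 := _ * dist_to S theta `^ p.
have c0 := B1_ge0.
have t10 : 0 <= t1 by rewrite !mulr_ge0 ?powR_ge0.
set t2 := _ * expR (l2norm (x - theta) ^+ 2 / 4).
have t20 : 0 <= t2 by rewrite !mulr_ge0 ?expR_ge0.
rewrite indicE; have [|_] := boolP (_ \in _); last by rewrite mul0r addr_ge0.
rewrite inE /= mul1r => xD.
set dt := dist_to S theta; set r := l2norm (x - theta).
have dt0 : 0 <= dt by exact: dist_to_ge0.
have r0 : 0 <= r by exact: l2norm_ge0.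
have [j hj] := s_net theta.
set u := dt + 1 + r.
have xu i : `|x ord0 i - s j ord0 i| <= u.
  have -> : x ord0 i - s j ord0 i = (x - theta) ord0 i + (theta ord0 i - s j ord0 i).
    by rewrite !mxE; ring.
  apply: le_trans (ler_normD _ _) _.
  by have := normr_coord_le_l2norm (x - theta) i; have := hj i; rewrite /u -/dt -/r; lra.
have uM : M < u.
  rewrite ltNge; apply/negP => uM; apply: xD; exists j => // i.
  exact: le_trans uM.
have u0 : 0 <= u by lra.
apply: le_trans (ln_floor_density_le u0 xu) _; rewrite -/A1.
have u1 : 0 < 1 + u by lra.
have [rd|rd] := leP (dt + 1) r.
  apply: (@le_trans _ _ t2); last by rewrite lerDr.
  have h1 : ln (1 + u) <= 2 * r.
    by have := ln_le_sub1 u1; rewrite /u; lra.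
  have h2 : A1 + 2 * d%:R * ln (1 + u) <= (A1 + 8 * d%:R) * expR (r ^+ 2 / 8).
    have e1 : 1 <= expR (r ^+ 2 / 8) by rewrite -expR0 ler_expR divr_ge0// sqr_ge0.
    have := ler_wpM2l A1_ge0 e1.
    have := ler_wpM2l d0 (le_trans h1 (ler_wpM2l (ler0n R 2) (le_expR8 r))).
    lra.
  apply: le_trans h2 _; rewrite /t2 -mulrA ler_wpM2l//.
  rewrite -expRD ler_expR -/r.
  have h3 : M <= 2 * r by rewrite /u in uM; lra.
  have : M ^+ 2 <= (2 * r) ^+ 2.
    by rewrite ler_pXn2r// nnegrE ?mulr_ge0// ltW.
  by rewrite exprMn; lra.
apply: (@le_trans _ _ t1); last by rewrite lerDl.
have dt3 : 2 * (dt + 1) <= 3 * dt by rewrite /u in uM; lra.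
set y := 3 * dt / M.
have y1 : 1 < y by rewrite /y ltr_pdivlMr// mul1r; rewrite /u in uM; lra.
have y0 : 0 < y by lra.
have uy : 1 + u <= 2 * M * y.
  have -> : 2 * M * y = 6 * dt by rewrite /y; field; rewrite gt_eqF.
  by rewrite /u in uM *; lra.
have yp1 : 1 <= y `^ p by rewrite -(powRr0 y) ler_powR// ltW.
have lny : ln y <= y `^ p / p.
  rewrite ler_pdivlMr// mulrC -ln_powR.
  by apply: le_trans (ln_le_sub1 _) _; [rewrite powR_gt0|lra].
have M20 : 0 < 2 * M by rewrite mulr_gt0.
have lnu : ln (1 + u) <= ln (2 * M) + y `^ p / p.
  apply: (@le_trans _ _ (ln (2 * M * y))).
    by rewrite ler_ln ?posrE//; exact: mulr_gt0.
  by rewrite lnM ?posrE// lerD2l.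
have -> : t1 = (A1 + 2 * d%:R * ln (2 * M) + 2 * d%:R / p) * y `^ p.
  rewrite /t1 -mulrA; congr (_ * _); rewrite -powRM ?divr_ge0 ?(ltW M0)//.
  by rewrite /y mulrAC.
have q0 : 0 <= A1 + 2 * d%:R * ln (2 * M).
  by apply: addr_ge0; [exact: A1_ge0|rewrite !mulr_ge0].
have := ler_wpM2l q0 yp1.
have := ler_wpM2l (mulr_ge0 (ler0n R 2) d0) lnu.
by set Y := y `^ p; set v := p^-1; lra.
Qed.

Lemma measurable_bigcup_box : measurable D.
Proof.
by apply: fin_bigcup_measurable => // j _; exact: measurable_box.
Qed.

(** The first term is Markov's inequality for the distance to S at order p, the
logarithm ln y being absorbed by y^p / p; the second one is a Gaussian tail. *)
Lemma tail_le (G : probability E R) :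
  (\int[lam]_x ((\1_(~` D) x * ln (floor_density x)^-1)%:E * (mixture_density G x)%:E) <=
   ((A1 + 2 * d%:R * ln (2 * M) + 2 * d%:R / p) * (3 / M) `^ p)%:E *
     \int[G]_theta (dist_to S theta `^ p)%:E +
   ((A1 + 8 * d%:R) * expR (- (M ^+ 2 / 32)) * 6 ^+ d)%:E)%E.
Proof.
have M8' := M8.
have M0 : 0 < M by lra.
have d0 : 0 <= d%:R :> R by [].
have lnM0 := lnM_ge0.
have mz : measurable_fun [set: E] (fun x => \1_(~` D) x * ln (floor_density x)^-1).
  apply: measurable_funM.
    by apply: measurable_indic; apply: measurableC; exact: measurable_bigcup_box.
  apply: measurableT_comp => //; apply: measurable_fun_inv_gt0.
    exact: measurable_floor_density.
  exact: floor_density_gt0.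
have z0 x : 0 <= \1_(~` D) x * ln (floor_density x)^-1.
  by rewrite mulr_ge0// ln_ge0// invf_ge1 ?floor_density_gt0 ?floor_density_le1.
rewrite ge0_integral_mixture//; last exact/measurable_EFinP.
set c1 := _ * (3 / M) `^ p; set c2 := _ * expR (- (M ^+ 2 / 32)).
have c10 : 0 <= c1 by rewrite mulr_ge0 ?powR_ge0.
have c20 : 0 <= c2 by rewrite mulr_ge0 ?expR_ge0.
have mdp : measurable_fun [set: E] (fun theta => (dist_to S theta `^ p)%:E).
  apply/measurable_EFinP.
  exact: (measurableT_comp (measurable_powR p) (measurable_dist_to S0)).
apply: (@le_trans _ _ (\int[G]_theta (c1%:E * (dist_to S theta `^ p)%:E + (c2 * 6 ^+ d)%:E))%E).
  apply: ge0_le_integral_sub => theta.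
    by apply: integral_ge0 => x _; rewrite -EFinM lee_fin mulr_ge0// ltW// gaussian_density_gt0.
  have mg : measurable_fun [set: E] (fun x => (gaussian_density (x - theta))%:E).
    apply/measurable_EFinP.
    exact: (measurableT_comp measurable_gaussian_sub (measurable_pair2 theta)).
  have mg8 : measurable_fun [set: E] (fun x => (expR (- (l2norm (x - theta) ^+ 2 / 8)))%:E).
    by apply/measurable_EFinP; exact: measurable_gauss8.
  apply: (@le_trans _ _ (\int[lam]_x
     ((c1 * dist_to S theta `^ p)%:E * (gaussian_density (x - theta))%:E +
     c2%:E * (expR (- (l2norm (x - theta) ^+ 2 / 8)))%:E))%E).
    apply: ge0_le_integral_sub => x.
      by rewrite -EFinM lee_fin mulr_ge0// ltW// gaussian_density_gt0.
    rewrite -!EFinM -EFinD lee_fin.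
    have g0 := ltW (gaussian_density_gt0 (x - theta)).
    apply: le_trans (ler_wpM2r g0 (tail_pointwise x theta)) _.
    rewrite mulrDl -/c1 -/c2 lerD2l -[leLHS]mulrA; apply: ler_wpM2l => //.
    apply: le_trans (ler_wpM2l (expR_ge0 _) (gaussian_density_le_expR _)) _.
    by rewrite -expRD ler_expR; have := sqr_ge0 (l2norm (x - theta)); lra.
  have k1 : 0 <= c1 * dist_to S theta `^ p by rewrite mulr_ge0// powR_ge0.
  rewrite ge0_integralD//;
    try (by apply: emeasurable_funM => //);
    try (by move=> x _; rewrite -EFinM lee_fin mulr_ge0 ?expR_ge0//);
    try (by move=> x _; rewrite -EFinM lee_fin mulr_ge0// ltW// gaussian_density_gt0).
  rewrite !ge0_integralZl//;
    try (by move=> x _; rewrite lee_fin ?expR_ge0// ltW// gaussian_density_gt0);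
    try by rewrite lee_fin.
  rewrite integral_gaussian_density mule1 EFinM leeD2l// [in leRHS]EFinM.
  by rewrite lee_wpmul2l ?lee_fin// integral_gauss8_le.
have c60 : 0 <= c2 * 6 ^+ d by rewrite mulr_ge0// exprn_ge0.
rewrite ge0_integralD//; try (by apply: emeasurable_funM => //);
  try (by move=> t _; rewrite -EFinM lee_fin mulr_ge0// powR_ge0);
  try (by move=> t _; rewrite lee_fin).
rewrite ge0_integralZl//; try (by move=> t _; rewrite lee_fin powR_ge0);
  try by rewrite lee_fin.
by rewrite integral_cst// [X in (_ + _ * X)%E]probability_setT mule1.
Qed.

End tail.
End heavy_tailed_floor.
End envelope_and_tail.

(** * The risk in terms of a net of cells *)

Section integral_bounds.
Context {R : realType} {d : nat}.
Local Notation E := 'rV[R]_d.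
Local Notation lam := (lebesgue_rV d).
Implicit Types (f g : E -> R) (b c : R).

(** The envelopes are sums of many terms, and only upper bounds of their integrals
matter. *)
Definition integral_bound f b :=
  [/\ measurable_fun [set: E] f, forall x, 0 <= f x &
      (\int[lam]_x (f x)%:E <= b%:E)%E].

Lemma integral_boundD f g b c : integral_bound f b -> integral_bound g c ->
  integral_bound (fun x => f x + g x) (b + c).
Proof.
move=> [mf f0 fb] [mg g0 gc]; split.
- exact: measurable_funD.
- by move=> x; rewrite addr_ge0.
- under eq_integral do rewrite EFinD.
  rewrite ge0_integralD//; try (by apply/measurable_EFinP).
  + by rewrite EFinD leeD.
  + by move=> x _; rewrite lee_fin.
  + by move=> x _; rewrite lee_fin.
Qed.

Lemma integral_boundZ f b c : 0 <= c -> integral_bound f b ->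
  integral_bound (fun x => c * f x) (c * b).
Proof.
move=> c0 [mf f0 fb]; split.
- by apply: measurable_funM => //; exact: measurable_cst.
- by move=> x; rewrite mulr_ge0.
- under eq_integral do rewrite EFinM.
  rewrite ge0_integralZl_EFin//; try (by apply/measurable_EFinP).
  + by rewrite EFinM lee_wpmul2l.
  + by move=> x _; rewrite lee_fin.
Qed.

Lemma integral_bound_sum (I : Type) (r : seq I) (f : I -> E -> R) (b : I -> R) :
  (forall i, integral_bound (f i) (b i)) ->
  integral_bound (fun x => \sum_(i <- r) f i x) (\sum_(i <- r) b i).
Proof.
move=> fb; elim: r => [|i r IH].
  split.
  - by under eq_fun do rewrite big_nil; exact: measurable_cst.
  - by move=> x; rewrite big_nil.
  - by under eq_integral do rewrite big_nil; rewrite integral0 big_nil.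
rewrite big_cons; under eq_fun do rewrite big_cons.
exact: integral_boundD.
Qed.

End integral_bounds.

Lemma hellinger2_mixture_le2 {R : realType} {d : nat} (H H' : probability 'rV[R]_d R) :
  hellinger2 (mixture_density H) (mixture_density H') <= 2.
Proof.
by apply: hellinger2_le2 => //; try exact: measurable_mixture_density;
  try exact: mixture_density_ge0; exact: integral_mixture_density.
Qed.

Section cellwise_risk.
Context {R : realType} {d n : nat}.
Local Notation E := 'rV[R]_d.
Local Notation lam := (lebesgue_rV d).
Context {dO} {Omega : measurableType dO} (P : probability Omega R).
Variables (G : 'I_n -> probability E R) (X : 'I_n -> {RV P >-> E}).
Hypothesis n0 : (0 < n)%N.
Hypothesis indX : mutually_independent X.
Hypothesis densX : forall i, has_density (X i) (mixture_density (G i)).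
Local Notation f0 := (mixture_density (average_measure G)).
Variable fhat : Omega -> E -> R.
Hypothesis npmle : forall w, is_NPMLE (fun i => X i w) (fhat w).

(** A near maximizer of the Hellinger distance to f0 in each class lets one member
control the whole class, up to e. *)
Lemma class_representatives (J : finType) (iota : probability E R -> J) (e : R) :
  0 < e -> exists rep : J -> probability E R, forall H,
    iota (rep (iota H)) = iota H /\
    hellinger2 (mixture_density H) f0 <= hellinger2 (mixture_density (rep (iota H))) f0 + e.
Proof.
move=> e0; have [Gp GpE] := average_measure_probability G n0.
suff /choice[rep repP] : forall j : J, exists H' : probability E R, forall H,
    iota H = j -> iota H' = j /\
    hellinger2 (mixture_density H) f0 <= hellinger2 (mixture_density H') f0 + e.
  by exists rep => H; exact: repP.
move=> j; have [[H0 H0j]|noH] := pselect (exists H, iota H = j); last first.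
  by exists Gp => H Hj; exfalso; apply: noH; exists H.
pose A := [set hellinger2 (mixture_density H) f0 | H in [set H | iota H = j]].
have f0E : f0 = mixture_density Gp by rewrite (eq_mixture_density GpE).
have hA : has_sup A.
  split; first by exists (hellinger2 (mixture_density H0) f0), H0.
  exists 2; move=> _ [H _ <-]; rewrite f0E; exact: hellinger2_mixture_le2.
have [_ [H' /= H'j <-] ltH'] := sup_adherent e0 hA.
exists H' => H Hj; split=> //; rewrite -lerBlDr ltW// (le_lt_trans _ ltH')//.
by rewrite lerD2r; apply: ub_le_sup; [exact: hA.2|exists H].
Qed.

Variables (C : finType) (kappa : E -> option C) (ctr : C -> E) (near : pred C).
Variables (m : nat) (s : 'I_m -> E) (a M eps0 eps1 eps2 delta e tau : R) (k N : nat).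
Local Notation D := (\bigcup_(j in [set: 'I_m]) box (s j) M).
Local Notation B := (expR (d%:R * a ^+ 2 / 2)).
Local Notation eta := (d%:R * 4 ^- k * expR (16 * d%:R * a ^+ 2)).
Hypothesis m0 : (0 < m)%N.
Hypothesis M0 : 0 <= M.
Hypothesis eps00 : 0 < eps0.
Hypothesis eps01 : eps0 <= 1.
Hypothesis e0 : 0 < e.
Hypothesis tau0 : 0 < tau.
Hypothesis mcell : forall c, measurable (kappa @^-1` [set Some c]).
Hypothesis cell_ctr : forall theta c, kappa theta = Some c ->
  forall i, `|theta ord0 i - ctr c ord0 i| <= a.
Hypothesis eps1_ge0 : 0 <= eps1.
Hypothesis eps2_ge0 : 0 <= eps2.
Hypothesis outside : forall x theta, D x -> kappa theta = None ->
  gaussian_density (x - theta) <= eps1.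
Hypothesis far : forall x theta c, D x -> kappa theta = Some c -> ~~ near c ->
  gaussian_density (x - theta) <= eps2 * expR (- (l2norm (x - ctr c) ^+ 2 / 8)).
Hypothesis delta0 : 0 < delta.
Hypothesis k0 : (0 < k)%N.
Hypothesis N0 : (0 < N)%N.
Hypothesis tau_ge :
  eps1 * (m%:R * (2 * M) ^+ d) +
  6 ^+ d * (#|C|%:R * (eps2 / N%:R + delta * (2 ^+ (k * d) * (k ^ d)%:R)) +
            (B + 1) * (1 + #|C|%:R * delta) * eta) + eps0 <= tau ^+ 2.

Let mass_sum_le1 (H : probability E R) :
  \sum_c fine (H (kappa @^-1` [set Some c])) <= 1.
Proof.
have -> : \sum_c fine (H (kappa @^-1` [set Some c])) =
    \int[H]_theta (\sum_c \1_(kappa @^-1` [set Some c]) theta).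
  rewrite Rintegral_bsum; first by apply: eq_bigr => c _; rewrite Rintegral_indic_prob.
  by move=> c; exact: bounded_measurable_indic.
rewrite -[leRHS](Rintegral_bcst H 1); apply: le_Rintegral_b.
- by apply: bounded_measurable_sum => c; exact: bounded_measurable_indic.
- exact: bounded_measurable_cst.
move=> t; case kt : (kappa t) => [c|].
  rewrite (bigD1 c)//= big1 ?addr0.
    by rewrite indicE; case: (_ \in _).
  move=> i ic; rewrite indicE memNset//= kt => -[ci].
  by rewrite ci eqxx in ic.
by rewrite big1// => i _; rewrite indicE memNset//= kt.
Qed.

(** The brackets are given by the net: the envelope adds the floor to the errors of
mixture_net, and tau_ge says that its integral is at most tau^2. *)
Lemma cellwise_risk_le :
  ('E_P[fun w => hellinger2 (fhat w) f0] <=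
   (e + 2 * tau + 2 / n%:R * (ln
      ((#|C| * quantize_levels delta ^ (k ^ d)).+1 ^ (#|near| + N))%:R + 1))%:E +
   \int[lam]_x ((\1_(~` D) x * ln (floor_density s eps0 x)^-1)%:E * (f0 x)%:E))%E.
Proof.
have [J [iota [cJ netJ]]] := mixture_net mcell cell_ctr eps1_ge0 eps2_ge0 outside far
  delta0 k0 N0.
have [rep repP] := class_representatives iota e0.
rewrite -cJ.
pose gam c x := expR (- (l2norm (x - ctr c) ^+ 2 / 8)).
pose wt j c := eps2 / N%:R +
  (B + 1) * (fine (rep j (kappa @^-1` [set Some c])) + delta) * eta +
  delta * (2 ^+ (k * d) * (k ^ d)%:R).
have eta0 : 0 <= eta by rewrite !mulr_ge0 ?expR_ge0 ?invr_ge0 ?exprn_ge0.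
have B0 : 0 <= B + 1 by rewrite addr_ge0 ?expR_ge0.
have wt0 j c : 0 <= wt j c.
  have dd := ltW delta0; rewrite /wt !addr_ge0//.
  - by rewrite mulr_ge0 ?invr_ge0.
  - by apply: mulr_ge0 => //; apply: mulr_ge0 => //; rewrite addr_ge0// fine_ge0.
  - by rewrite !mulr_ge0 ?exprn_ge0.
pose env j x := eps1 * (\sum_(i < m) \1_(box (s i) M) x) + \sum_c wt j c * gam c x.
pose h j x := env j x + floor_density s eps0 x.
have gam_bound c : integral_bound (gam c) (6 ^+ d).
  split; [exact: measurable_gauss8|by move=> x; exact: expR_ge0|exact: integral_gauss8_le].
have box_bound i : integral_bound (\1_(box (s i) M) : E -> R) ((2 * M) ^+ d).
  split.
  - by apply: measurable_indic; exact: measurable_box.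
  - by move=> x; rewrite indicE.
  - rewrite integral_indic ?setIT//; last exact: measurable_box.
    by rewrite le_eqVlt; apply/orP; left; apply/eqP; exact: lebesgue_box.
have env_bound j : integral_bound (env j)
    (eps1 * (\sum_(i < m) (2 * M) ^+ d) + \sum_c wt j c * 6 ^+ d).
  apply: integral_boundD; first by apply: integral_boundZ => //; exact: integral_bound_sum.
  by apply: integral_bound_sum => c; exact: integral_boundZ.
have h_bound j : integral_bound (h j)
    (eps1 * (\sum_(i < m) (2 * M) ^+ d) + \sum_c wt j c * 6 ^+ d + eps0).
  apply: integral_boundD => //; split.
  - exact: measurable_floor_density.
  - by move=> x; apply: ltW; exact: floor_density_gt0.
  - by rewrite integral_floor_density.
have h_tau j : (\int[lam]_x (h j x)%:E <= (tau ^+ 2)%:E)%E.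
  have [_ _ /le_trans] := h_bound j; apply; rewrite lee_fin.
  apply: le_trans tau_ge; rewrite lerD2r sumr_const card_ord (mulr_natl (_ ^+ d) m) lerD2l.
  rewrite -mulr_suml mulrC ler_wpM2l ?exprn_ge0//.
  rewrite /wt; set u := eps2 / _; set v := delta * (_ * _).
  have -> : \sum_c (u + (B + 1) * (fine (rep j (kappa @^-1` [set Some c])) + delta) * eta + v) =
    #|C|%:R * (u + v) + (B + 1) * (\sum_c fine (rep j (kappa @^-1` [set Some c])) +
       #|C|%:R * delta) * eta.
    rewrite !big_split/= !sumr_const -mulr_suml -mulr_sumr big_split/= sumr_const.
    rewrite -(mulr_natl u) -(mulr_natl v) -(mulr_natl delta).
    by rewrite addrAC -mulrDr.
  rewrite lerD2l ler_wpM2r// ler_wpM2l// lerD2r.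
  exact: mass_sum_le1.
apply: (@npmle_risk_le _ _ _ _ _ P G X n0 indX densX fhat npmle J
  (fun j => mixture_density (rep j)) h (floor_density s eps0) D tau e) => //.
- exact: ltW.
- exact: measurable_bigcup_box.
- by move=> j; exact: measurable_mixture_density.
- by move=> j x; exact: mixture_density_ge0.
- by move=> j; exact: integral_mixture_density.
- by move=> j; have [] := h_bound j.
- exact: measurable_floor_density.
- by move=> x; exact: floor_density_gt0.
- by move=> x; exact: floor_density_le1.
- by move=> j x; rewrite lerDr; have [] := env_bound j.
- move=> _ [H _ <-]; exists (iota H); have [iH hH] := repP H; split=> // x Dx.
  apply: le_trans (netJ H (rep (iota H)) x (esym iH) Dx) _.
  rewrite -addrA lerD2l /h /env -[leLHS]addr0; apply: lerD; last first.
    by apply: ltW; exact: floor_density_gt0.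
  rewrite lerD2r; have [i _ xi] := Dx; rewrite ler_peMr//.
  rewrite (bigD1 i)//= indicE mem_set// lerDl; apply: sumr_ge0 => l _.
  by rewrite indicE.
Qed.

End cellwise_risk.

Section grid.
Context {R : realType} {d : nat}.
Local Notation E := 'rV[R]_d.
Local Notation index := {ffun 'I_d -> int}.
Implicit Types (t x : E) (z : index).
Variables (m : nat) (s : 'I_m -> E) (a : R).
Hypothesis a0 : 0 < a.

Definition grid_index (t : E) : index := [ffun i => Num.floor (t ord0 i / a)].

Definition grid_point (z : index) : E := \row_i (a * (z i)%:~R).

Lemma grid_point_close t i : `|t ord0 i - grid_point (grid_index t) ord0 i| <= a.
Proof.
rewrite mxE ffunE.
have /andP[h1 h2] := floor_itv (t ord0 i / a).
rewrite ler_norml; apply/andP; split.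
  have : a * (Num.floor (t ord0 i / a))%:~R <= t ord0 i.
    by rewrite mulrC -ler_pdivlMr.
  by move: a0; lra.
have : t ord0 i < a * (Num.floor (t ord0 i / a) + 1)%:~R.
  by rewrite mulrC -ltr_pdivrMr.
by rewrite intrD mulrDr mulr1; lra.
Qed.

Lemma measurable_grid_cell (z : index) : measurable [set t | grid_index t = z].
Proof.
rewrite (_ : [set _ | _] = \bigcap_(i in [set: 'I_d])
   (rV_coord i @^-1` (`[a * (z i)%:~R, a * (z i + 1)%:~R[%classic : set (measurableTypeR R)))).
  apply: fin_bigcap_measurable => // i _.
  by rewrite -[X in measurable X]setTI; apply: measurable_rV_coord.
apply/seteqP; split=> [t <- i _|t tz].
  rewrite /= in_itv/= ffunE.
  by have := floor_itv (t ord0 i / a); rewrite ler_pdivlMr// ltr_pdivrMr// ![a * _]mulrC.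
apply/ffunP => i; rewrite ffunE; apply: floor_def.
have := tz i I; rewrite /= in_itv/=.
by rewrite ler_pdivlMr// ltr_pdivrMr// ![a * _]mulrC.
Qed.

Local Notation label Z := ('I_m * {ffun 'I_d -> 'I_(Z.*2.+1)})%type.

(** The labels at a centre are the index vectors at sup distance at most Z from
its own. *)
Definition label_index Z (l : label Z) : index :=
  [ffun i => Num.floor (s l.1 ord0 i / a) + (l.2 i : nat)%:Z - Z%:Z].

Lemma label_exists Z t j (c : R) : (forall i, `|t ord0 i - s j ord0 i| <= c) ->
  c / a + 1 <= Z%:R -> exists l : label Z, label_index l = grid_index t.
Proof.
move=> tc cZ.
have key i : exists w : 'I_(Z.*2.+1),
    (Num.floor (s j ord0 i / a) + (w : nat)%:Z - Z%:Z = grid_index t i)%R.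
  rewrite ffunE; set x := Num.floor (s j ord0 i / a); set y := Num.floor (t ord0 i / a).
  have /andP[x1 x2] := floor_itv (s j ord0 i / a).
  have /andP[y1 y2] := floor_itv (t ord0 i / a).
  have : `|t ord0 i / a - s j ord0 i / a| <= c / a.
    by rewrite -mulrBl normrM (gtr0_norm (_ : 0 < a^-1)) ?invr_gt0// ler_wpM2r// invr_ge0 ltW.
  rewrite ler_norml => /andP[h1 h2].
  have u : y - x < Z%:Z + 1.
    move: x1 x2 y1 y2; rewrite -/x -/y !rmorphD/= => x1 x2 y1 y2.
    rewrite -(ltr_int R) !rmorphD rmorphN/=.
    by move: h1 h2 cZ; rewrite -[Z%:Z%:~R]/(Z%:R : R); lra.
  have l : x - y < Z%:Z + 1.
    move: x1 x2 y1 y2; rewrite -/x -/y !rmorphD/= => x1 x2 y1 y2.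
    rewrite -(ltr_int R) !rmorphD rmorphN/=.
    by move: h1 h2 cZ; rewrite -[Z%:Z%:~R]/(Z%:R : R); lra.
  have wlt : (absz (y - x + Z%:Z)%R < Z.*2.+1)%N by move: u l; clear; lia.
  by exists (Ordinal wlt) => /=; move: u l; clear; lia.
have /choice[w wP] := key.
by exists (j, [ffun i => w i]); apply/ffunP => i; rewrite -wP !ffunE.
Qed.

Section grid_cells.
Variables (Z0 Z1 : nat).

Definition cell_index (c : label Z0 + label Z1) : index :=
  match c with inl l => label_index l | inr l => label_index l end.

(** Near labels take precedence: a cell with a far label is out of reach of the near
ones, which gives the smallness required of far cells. *)
Definition label_of_index (z : index) : option (label Z0 + label Z1) :=
  if [pick l : label Z0 | label_index l == z] is Some l then Some (inl l)
  else omap inr [pick l : label Z1 | label_index l == z].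

Definition grid_label (t : E) := label_of_index (grid_index t).

Definition grid_near : pred (label Z0 + label Z1) :=
  fun c => if c is inl _ then true else false.

Lemma grid_label_index t c : grid_label t = Some c -> cell_index c = grid_index t.
Proof.
rewrite /grid_label /label_of_index.
case: pickP => [l /eqP <- [<-]//|_]; case: pickP => [l /eqP <- [<-]//|//].
Qed.

Lemma measurable_grid_label c : measurable (grid_label @^-1` [set Some c]).
Proof.
have [h|h] := eqVneq (label_of_index (cell_index c)) (Some c).
  rewrite (_ : _ @^-1` _ = [set t | grid_index t = cell_index c]).
    exact: measurable_grid_cell.
  apply/seteqP; split=> [t /= /grid_label_index//|t /= tc].
  by rewrite /grid_label tc.
rewrite (_ : _ @^-1` _ = set0); first exact: measurable0.
rewrite -subset0 => t /= tc; move/eqP: h; apply.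
by rewrite (grid_label_index tc).
Qed.

Lemma grid_label_close t c : grid_label t = Some c ->
  forall i, `|t ord0 i - grid_point (cell_index c) ord0 i| <= a.
Proof. by move=> /grid_label_index -> i; exact: grid_point_close. Qed.

Lemma card_grid_label :
  #|((label Z0 + label Z1)%type : finType)| = (m * Z0.*2.+1 ^ d + m * Z1.*2.+1 ^ d)%N.
Proof. by rewrite card_sum !card_prod !card_ffun !card_ord. Qed.

Lemma card_grid_near : #|grid_near| = (m * Z0.*2.+1 ^ d)%N.
Proof.
have -> : #|grid_near| = #|[seq inl l | l : label Z0] : seq (label Z0 + label Z1)|.
  apply: eq_card => -[l|l].
    by rewrite -[LHS]/true; apply/esym/mapP; exists l; rewrite ?mem_enum.
  by rewrite -[LHS]/false; apply/esym/negbTE/negP => /mapP[].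
rewrite fintype.card_image; last by move=> x y [].
by rewrite !card_prod !card_ffun !card_ord.
Qed.

Variables (M r R1 : R).
Local Notation D := (\bigcup_(j in [set: 'I_m]) box (s j) M).

Lemma l2norm_ge_escape x t j (b : R) : 0 <= b -> box (s j) M x ->
  ~ (forall i, `|t ord0 i - s j ord0 i| <= M + b) -> b ^+ 2 <= l2norm (x - t) ^+ 2.
Proof.
move=> b0 xj /existsNP[i /negP]; rewrite -ltNge => ti.
rewrite ler_pXn2r// ?nnegrE ?l2norm_ge0//.
apply: le_trans (normr_coord_le_l2norm _ i); rewrite !mxE.
have := ler_distD (x ord0 i) (t ord0 i) (s j ord0 i); rewrite (distrC (t ord0 i) (x ord0 i)).
by have := xj i; move: ti; lra.
Qed.

Lemma grid_outside x t : 0 <= R1 -> (M + R1) / a + 1 <= Z1%:R -> D x -> grid_label t = None ->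
  gaussian_density (x - t) <= expR (- (R1 ^+ 2 / 2)).
Proof.
move=> R10 hZ [j _ xj] tN; apply: le_trans (gaussian_density_le_expR _) _.
rewrite ler_expR lerN2 ler_pM2r ?invr_gt0//.
apply: (l2norm_ge_escape R10 xj) => tj.
have [l lt] := label_exists tj hZ; move: tN; rewrite /grid_label /label_of_index.
by case: pickP => // _; case: pickP => // /(_ l); rewrite lt eqxx.
Qed.

(** The sup distance from theta to the cell centre is at most a, so that
|x - c|^2 <= 2 |x - theta|^2 + 2 d a^2; half of the Gaussian exponent pays for r
and the other half for the decay in x - c. *)
Lemma grid_far x t c : 0 <= r -> (M + r) / a + 1 <= Z0%:R -> D x -> grid_label t = Some c ->
  ~~ grid_near c -> gaussian_density (x - t) <=
    expR (- (r ^+ 2 / 4) + d%:R * a ^+ 2 / 4) *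
    expR (- (l2norm (x - grid_point (cell_index c)) ^+ 2 / 8)).
Proof.
move=> r0 hZ [j _ xj] tc nc; apply: le_trans (gaussian_density_le_expR _) _.
rewrite -expRD ler_expR.
have h1 : r ^+ 2 <= l2norm (x - t) ^+ 2.
  apply: (l2norm_ge_escape r0 xj) => tj; have [l lt] := label_exists tj hZ.
  move: tc nc; rewrite /grid_label /label_of_index.
  by case: pickP => [l' _ [<-]//|/(_ l)]; rewrite lt eqxx.
have h2 : l2norm (x - grid_point (cell_index c)) ^+ 2 <=
    2 * l2norm (x - t) ^+ 2 + 2 * (d%:R * a ^+ 2).
  rewrite !sqr_l2norm !mulr_sumr.
  have -> : 2 * (d%:R * a ^+ 2) = \sum_(i < d) (2 * a ^+ 2).
    by rewrite sumr_const card_ord -(mulr_natl (2 * _)) mulrCA.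
  rewrite -big_split/=; apply: ler_sum => i _; rewrite !mxE.
  have := grid_label_close tc i; rewrite mxE.
  set u := t ord0 i; set v := a * _; set y := x ord0 i => uv.
  have : (u - v) ^+ 2 <= a ^+ 2 by rewrite -(real_normK (num_real (u - v))) ler_pXn2r// nnegrE ltW.
  have := sqr_ge0 (y - u - (u - v)); lra.
move: h1 h2; lra.
Qed.

End grid_cells.
End grid.

Section grid_risk.
Context {R : realType} {d n : nat}.
Local Notation E := 'rV[R]_d.
Local Notation lam := (lebesgue_rV d).
Context {dO} {Omega : measurableType dO} (P : probability Omega R).
Variables (G : 'I_n -> probability E R) (X : 'I_n -> {RV P >-> E}).
Hypothesis n0 : (0 < n)%N.
Hypothesis indX : mutually_independent X.
Hypothesis densX : forall i, has_density (X i) (mixture_density (G i)).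
Local Notation f0 := (mixture_density (average_measure G)).
Variable fhat : Omega -> E -> R.
Hypothesis npmle : forall w, is_NPMLE (fun i => X i w) (fhat w).
Variables (m : nat) (s : 'I_m -> E) (a M r R1 eps0 delta e tau : R) (k Z0 Z1 : nat).
Local Notation D := (\bigcup_(j in [set: 'I_m]) box (s j) M).
Local Notation B := (expR (d%:R * a ^+ 2 / 2)).
Local Notation eta := (d%:R * 4 ^- k * expR (16 * d%:R * a ^+ 2)).
Local Notation cardC := (m * Z0.*2.+1 ^ d + m * Z1.*2.+1 ^ d)%N.

Lemma grid_risk_le : (0 < m)%N -> 0 <= M -> 0 < eps0 -> eps0 <= 1 -> 0 < e -> 0 < tau ->
  0 < a -> 0 <= r -> 0 <= R1 -> 0 < delta -> (0 < k)%N ->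
  (M + r) / a + 1 <= Z0%:R -> (M + R1) / a + 1 <= Z1%:R ->
  expR (- (R1 ^+ 2 / 2)) * (m%:R * (2 * M) ^+ d) +
  6 ^+ d * (cardC%:R * (expR (- (r ^+ 2 / 4) + d%:R * a ^+ 2 / 4) / m%:R +
              delta * (2 ^+ (k * d) * (k ^ d)%:R)) +
            (B + 1) * (1 + cardC%:R * delta) * eta) + eps0 <= tau ^+ 2 ->
  ('E_P[fun w => hellinger2 (fhat w) f0] <=
   (e + 2 * tau + 2 / n%:R * (ln
      ((cardC * quantize_levels delta ^ (k ^ d)).+1 ^ (m * Z0.*2.+1 ^ d + m))%:R + 1))%:E +
   \int[lam]_x ((\1_(~` D) x * ln (floor_density s eps0 x)^-1)%:E * (f0 x)%:E))%E.
Proof.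
move=> m0 M0 eps00 eps01 e0 tau0 a0 r0 R10 delta0 k0 hZ0 hZ1.
pose C := (('I_m * {ffun 'I_d -> 'I_(Z0.*2.+1)} +
            'I_m * {ffun 'I_d -> 'I_(Z1.*2.+1)})%type : finType).
have cC : #|C| = cardC .
  exact: card_grid_label.
have cN : #|@grid_near d m Z0 Z1| = (m * Z0.*2.+1 ^ d)%N .
  exact: card_grid_near.
rewrite -cC -cN => tau_ge.
apply: (@cellwise_risk_le _ _ _ _ _ P G X n0 indX densX fhat npmle C
  (@grid_label _ _ _ s a Z0 Z1) (fun c => grid_point a (cell_index s a c))
  (@grid_near _ _ Z0 Z1) m s a M eps0 (expR (- (R1 ^+ 2 / 2)))
  (expR (- (r ^+ 2 / 4) + d%:R * a ^+ 2 / 4)) delta e tau k m) => //.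
- exact: measurable_grid_label.
- exact: grid_label_close.
- by move=> x t; exact: grid_outside.
- by move=> x t c; exact: grid_far.
Qed.

End grid_risk.

(** * Choice of the discretization parameters *)

Section elementary.
Context {R : realType}.
Implicit Types x y : R.

Lemma ln_ge_half x : 2 <= x -> 1 / 2 <= ln x.
Proof.
move=> x2; have := @ln_le_sub1 R 2^-1; rewrite lnV ?posrE ?invr_gt0// => /(_ ltac:(lra)) h.
have : ln 2 <= ln x by rewrite ler_ln ?posrE//; lra.
by move: h; lra.
Qed.

Lemma exprn_le_expR x k : 0 <= x -> x ^+ k <= k`!%:R * expR x.
Proof.
move=> x0; have := @exprn_fact_le_expR R x k x0.
by rewrite ler_pdivrMr ?ltr0n ?fact_gt0// mulrC.
Qed.

Lemma exprn_mono x k l : 1 <= x -> (k <= l)%N -> x ^+ k <= x ^+ l.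
Proof. by move=> x1 kl; rewrite ler_weXn2l. Qed.

Lemma natpow_expR (N : R) k : 0 < N -> N ^+ k = expR (k%:R * ln N).
Proof. by move=> N0; rewrite expRM_natl lnK ?posrE. Qed.

Lemma natpowV_expR (N : R) k : 0 < N -> N ^- k = expR (- (k%:R * ln N)).
Proof. by move=> N0; rewrite expRN -natpow_expR. Qed.

(** As x >= 1, x^k is at most (x^2)^k, which up to k! is a term of the exponential
series. *)
Lemma exprn_gauss_le x k : 1 <= x -> x ^+ k * expR (- (x ^+ 2 / 16)) <= 16 ^+ k * k`!%:R.
Proof.
move=> x1; rewrite -[expR _]invrK -expRN opprK -/(_ / _) ler_pdivrMr ?expR_gt0//.
have x2 : 0 <= x ^+ 2 / 16 by rewrite divr_ge0 ?sqr_ge0.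
have := exprn_le_expR k x2; rewrite expr_div_n ler_pdivrMr ?exprn_gt0// -exprM => h.
have : x ^+ k <= x ^+ (2 * k) by apply: exprn_mono => //; lia.
by move: h; rewrite mulrC mulrA => h h'; exact: le_trans h' h.
Qed.

Lemma sqrt_ln_pow_le (N : R) k : 2 <= N -> Num.sqrt (ln N) ^+ k <= 4 ^+ k * k`!%:R * N.
Proof.
move=> N2; have l2 := ln_ge_half N2; have N0 : 0 < N by lra.
set L := Num.sqrt _.
have L2 : L ^+ 2 = ln N by rewrite sqr_sqrtr//; lra.
have L1 : 1 <= 2 * L.
  by rewrite -(@ler_pXn2r _ 2)// ?nnegrE ?mulr_ge0 ?sqrtr_ge0// exprMn L2; lra.
have h1 : L ^+ k <= (2 * L) ^+ (2 * k).
  have kk : (k <= 2 * k)%N by lia.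
  apply: le_trans (exprn_mono L1 kk).
  rewrite exprMn ler_peMl ?exprn_ge0 ?sqrtr_ge0//.
  by rewrite exprn_ege1//; lra.
apply: le_trans h1 _; rewrite (exprM (2 * L) 2 k) (exprMn 2 2 L) L2 exprMn.
have -> : (2 ^+ 2 : R) = 4 by lra.
rewrite -mulrA ler_wpM2l ?exprn_ge0//.
have := @exprn_le_expR (ln N) k; rewrite lnK ?posrE//; apply; lra.
Qed.

End elementary.

Section parameter_choice.
Context {R : realType}.
Variables (d : nat) (d1 : (0 < d)%N).
Implicit Types (M r L : R).
Local Notation dR := (d%:R : R).

Let d1R : 1 <= dR. Proof. by rewrite ler1n. Qed.

Lemma odd_width_le (y : R) (Z : nat) c : 1 <= y -> Z%:R <= c * y + 2 -> 0 <= c ->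
  (Z.*2.+1 ^ d)%:R <= (2 * c + 5) ^+ d * y ^+ d.
Proof.
move=> y1 Zc c0; rewrite natrX -exprMn lerXn2r// ?nnegrE ?mulr_ge0//; try lra.
have -> : (Z.*2.+1)%:R = 2 * Z%:R + 1 :> R by rewrite -addn1 natrD -mul2n natrM.
nra.
Qed.

Lemma exists_width (y : R) : 0 <= y -> exists Z : nat, y + 1 <= Z%:R /\ Z%:R <= y + 2.
Proof.
move=> y0; have y1 : 0 <= y + 1 by lra.
exists (Num.truncn (y + 1)).+1; have := truncn_itv y1.
rewrite -addn1 natrD => /andP[h1 h2]; split; lra.
Qed.

(** The regime in which the estimate is not trivial. The parameter r is the radius
up to which the cells around the net are resolved, N the sample size and m the
number of points of the net. *)
Definition regime (N m M r L : R) :=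
  [/\ 2 <= N, 1 <= m, 8 <= M, m * M ^+ d <= N &
      L = Num.sqrt (ln N) /\ r = Num.min M (6 * L)].

Lemma regimeP N m M r L : regime N m M r L ->
  [/\ 3 <= r, r <= M, r <= 6 * L, 1 <= 2 * L & [/\ L ^+ 2 = ln N, m <= N & M ^+ d <= N]].
Proof.
move=> [N2 m1 M8 mM [LE rE]]; have l2 := ln_ge_half N2.
have L2 : L ^+ 2 = ln N by rewrite LE sqr_sqrtr//; lra.
have L1 : 1 <= 2 * L.
  by rewrite -(@ler_pXn2r _ 2)// ?nnegrE ?mulr_ge0 ?LE ?sqrtr_ge0// exprMn -LE L2; lra.
have Md : 1 <= M ^+ d by rewrite exprn_ege1//; lra.
split=> //.
- by rewrite rE le_min; apply/andP; split; lra.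
- by rewrite rE ge_min lexx.
- by rewrite rE ge_min lexx orbT.
- split=> //; nra.
Qed.

Lemma regime_pow_le : exists C, 0 < C /\ forall N m M r L, regime N m M r L ->
  [/\ L ^+ d <= C * N, 1 <= C * L ^+ d & 1 + M ^+ d + L ^+ d <= C * N].
Proof.
exists (4 ^+ d * d`!%:R + 2); have f0 : 1 <= d`!%:R :> R by rewrite ler1n fact_gt0.
have p4 : 2 ^+ d <= 4 ^+ d :> R by apply: lerXn2r; rewrite ?nnegrE ?ler_nat.
have p2 : 1 <= 2 ^+ d :> R by rewrite exprn_ege1// ler1n.
split; first by nra.
move=> N m M r L H; have [r3 rM rL L1 [L2 mN MN]] := regimeP H.
have [N2 m1 M8 mM [LE rE]] := H.
have h := sqrt_ln_pow_le d N2; rewrite -LE in h.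
have Ld : 1 <= 2 ^+ d * L ^+ d by rewrite -exprMn exprn_ege1.
have L0 : 0 <= L ^+ d by rewrite exprn_ge0//; lra.
set W := 4 ^+ d * d`!%:R in h *.
have W1 : 2 ^+ d <= W by apply: le_trans p4 _; rewrite /W ler_peMr// exprn_ge0.
have h' : 2 ^+ d * L ^+ d <= W * L ^+ d by rewrite ler_wpM2r.
have hN : N <= W * N by rewrite ler_peMl//; lra.
split; rewrite mulrDl; lra.
Qed.

Lemma regime_cells_le : exists C, 0 < C /\ forall N m M r L (m' Z0 Z1 : nat),
  regime N m M r L -> m = m'%:R ->
  Z0%:R <= 4 * dR * (M / r) + 2 -> Z1%:R <= 2 * dR * ((M + 6 * L) / r) + 2 ->
  (m' * Z0.*2.+1 ^ d + m' * Z1.*2.+1 ^ d)%:R <= C * m * (M ^+ d + L ^+ d) /\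
  (m' * Z0.*2.+1 ^ d + m')%:R <= C * m * (M / r) ^+ d.
Proof.
pose c0 : R := (2 * (4 * dR) + 5) ^+ d; pose c1 : R := (2 * (2 * dR) + 5) ^+ d.
have c00 : 1 <= c0 by rewrite exprn_ege1//; move: d1R; lra.
have c10 : 1 <= c1 by rewrite exprn_ege1//; move: d1R; lra.
have p12 : 1 <= 12 ^+ d :> R by rewrite exprn_ege1//; lra.
exists (c0 + c1 * 12 ^+ d + 1); split; first by nra.
move=> N m M r L m' Z0 Z1 H mE h0 h1; have [r3 rM rL L1 [L2 mN MN]] := regimeP H.
have [N2 m1 M8 mM [LE rE]] := H.
have r0 : 0 < r by lra.
have y0 : 1 <= M / r by rewrite ler_pdivlMr// mul1r.
have y1 : 1 <= (M + 6 * L) / r by rewrite ler_pdivlMr// mul1r; lra.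
have k0 : (Z0.*2.+1 ^ d)%:R <= c0 * (M / r) ^+ d.
  by apply: odd_width_le => //; move: d1R; lra.
have k1 : (Z1.*2.+1 ^ d)%:R <= c1 * ((M + 6 * L) / r) ^+ d.
  by apply: odd_width_le => //; move: d1R; lra.
have q0 : 1 <= (M / r) ^+ d by rewrite exprn_ege1.
have Mr : (M / r) ^+ d <= M ^+ d.
  by rewrite lerXn2r ?nnegrE//; [lra|lra|rewrite ler_pdivrMr//; nra].
have MLr : ((M + 6 * L) / r) ^+ d <= 12 ^+ d * (M ^+ d + L ^+ d).
  have : ((M + 6 * L) / r) ^+ d <= (M + 6 * L) ^+ d.
    by rewrite lerXn2r ?nnegrE//; [lra|lra|rewrite ler_pdivrMr//; nra].
  have M0 : 0 <= M ^+ d by rewrite exprn_ge0//; lra.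
  have L0 : 0 <= L ^+ d by rewrite exprn_ge0//; lra.
  move=> /le_trans; apply; have [ML|ML] := lerP (6 * L) M.
    have : (M + 6 * L) ^+ d <= 12 ^+ d * M ^+ d.
      by rewrite -exprMn lerXn2r ?nnegrE//; lra.
    by move: p12; nra.
  have : (M + 6 * L) ^+ d <= 12 ^+ d * L ^+ d.
    by rewrite -exprMn lerXn2r ?nnegrE//; lra.
  by move: p12; nra.
have M0 : 0 <= M ^+ d by rewrite exprn_ge0//; lra.
have L0 : 0 <= L ^+ d by rewrite exprn_ge0//; lra.
move: k0 k1 Mr MLr q0; clear -m1 mE M0 L0 c00 c10 p12.
set X := M ^+ d in M0 *; set Y := L ^+ d in L0 *; set P := 12 ^+ d in p12 *.
set u := (M / r) ^+ d; set v := (_ / r) ^+ d.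
rewrite !natrD !natrM -mE.
set a := (Z0.*2.+1 ^ d)%:R; set b := (Z1.*2.+1 ^ d)%:R => k0 k1 Mr MLr q0.
have h1 : a <= c0 * X by apply: le_trans k0 _; rewrite ler_wpM2l//; lra.
have h2 : b <= c1 * P * (X + Y).
  by apply: le_trans k1 _; rewrite -mulrA ler_wpM2l//; lra.
have cP : 0 <= c1 * P by rewrite mulr_ge0//; lra.
split.
  rewrite -mulrDr -[leRHS]mulrAC mulrC ler_wpM2r//; first by lra.
  rewrite !mulrDl mul1r; have : 0 <= c0 * Y by rewrite mulr_ge0//; lra.
  by move: h1 h2; rewrite !mulrDr; lra.
rewrite -[X in _ + X]mulr1 -mulrDr -[leRHS]mulrAC mulrC ler_wpM2r//; first by lra.
rewrite !mulrDl mul1r; have : 0 <= c1 * P * u by rewrite mulr_ge0//; lra.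
lra.
Qed.

(** Either r = M or e^(-3 r^2 / 16) is a large negative power of N. *)
Lemma regime_radius_gauss : exists C, 0 < C /\ forall N m M r L, regime N m M r L ->
  (1 + M ^+ d + L ^+ d) * expR (- (3 * r ^+ 2 / 16)) <=
  C * (N ^- 2 + L ^+ d * expR (- (M ^+ 2 / 8))).
Proof.
have [C1 [C10 H1]] := regime_pow_le.
pose C2 : R := 16 ^+ d * d`!%:R.
have C20 : 0 < C2 by rewrite mulr_gt0 ?exprn_gt0// ltr0n fact_gt0.
exists (C1 + C1 * C2 + 1 + C1); split.
  by have := mulr_gt0 C10 C20; lra.
move=> N m M r L H; have [r3 rM rL L1 [L2 mN MN]] := regimeP H.
have [N2 m1 M8 mM [LE rE]] := H; have [h1 h2 h3] := H1 _ _ _ _ _ H.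
have N0 : 0 < N by lra.
have L0 : 0 <= L ^+ d by rewrite exprn_ge0//; lra.
have CC : 0 < C1 * C2 by rewrite mulr_gt0.
have Ni : 0 < N ^- 2 by rewrite invr_gt0 exprn_gt0.
set g := expR (- (M ^+ 2 / 8)); have g0 : 0 < g by exact: expR_gt0.
have M0 : 0 <= M ^+ d by rewrite exprn_ge0//; lra.
have Lg : 0 <= L ^+ d * g by rewrite mulr_ge0// ltW.
have [ML|ML] := lerP M (6 * L).
  have -> : r = M by rewrite rE min_l.
  have e1 : expR (- (3 * M ^+ 2 / 16)) = expR (- (M ^+ 2 / 16)) * g.
    by rewrite -expRD; congr expR; lra.
  have M1 : 1 <= M by lra.
  have := exprn_gauss_le d M1; rewrite -/C2 e1.
  set w := expR (- (M ^+ 2 / 16)) => hw.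
  have w1 : w <= 1 by rewrite -expR0 ler_expR oppr_le0 divr_ge0// sqr_ge0.
  have w0 : 0 <= w by exact: expR_ge0.
  rewrite mulrA; apply: (@le_trans _ _ ((1 + C2 + L ^+ d) * g)).
    rewrite ler_wpM2r ?(ltW g0)// !mulrDl mul1r.
    by have := ler_wpM2l L0 w1; lra.
  have : (1 + C2) * g <= (1 + C2) * (C1 * L ^+ d) * g.
    by rewrite ler_wpM2r ?(ltW g0)// ler_peMr//; lra.
  have : 0 <= (C1 + C1 * C2 + 1 + C1) * N ^- 2 by rewrite mulr_ge0//; lra.
  have : 0 <= C1 * (L ^+ d * g) by rewrite mulr_ge0//; lra.
  move: L0 C10 C20 g0 Ni; clear; set Y := L ^+ d; set T := N ^- 2.
  by move: Y T => Y T *; nra.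
have rL' : r = 6 * L by rewrite rE min_r// ltW.
have e1 : expR (- (3 * r ^+ 2 / 16)) <= N ^- 3.
  rewrite natpowV_expR// ler_expR rL' exprMn L2; have := ln_ge_half N2; lra.
apply: (@le_trans _ _ (C1 * N * N ^- 3)).
  apply: ler_pM => //; first by rewrite !addr_ge0.
have -> : C1 * N * N ^- 3 = C1 * N ^- 2 by field; rewrite gt_eqF.
move: CC Lg C10 C20 Ni; clear; set Y := L ^+ d * g; set T := N ^- 2.
by move: Y T => Y T *; nra.
Qed.

End parameter_choice.

Section parameter_bounds.
Context {R : realType}.
Variable d : nat.
Implicit Types (M r L N m : R).
Local Notation regime := (@regime R d).

Lemma regime_cells_le_sqr C1 : 0 < C1 -> exists C, 0 < C /\ forall N m M r L (c : R),
  regime N m M r L -> c <= C1 * m * (M ^+ d + L ^+ d) -> c <= C * N ^+ 2.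
Proof.
move=> C10; have [C2 [C20 H2]] := @regime_pow_le R d.
exists (C1 * C2); split; first exact: mulr_gt0.
move=> N m M r L c H cle; have [_ _ h] := H2 _ _ _ _ _ H.
have [_ _ _ _ [_ mN _]] := regimeP H; have [N2 m1 M8 mM _] := H.
apply: le_trans cle _.
have -> : C1 * C2 * N ^+ 2 = C1 * N * (C2 * N) by ring.
apply: ler_pM => //; last lra.
- by rewrite mulr_ge0//; lra.
- rewrite addr_ge0// exprn_ge0//; first lra.
  by have [_ _ _ ? _] := regimeP H; lra.
- by rewrite ler_wpM2l// ltW.
Qed.

(** The features are rounded at precision N to the minus this power. As k is at most
216 ln N, the bound 2^(k d) on the features is at most N^(216 d) and their number
k^d at most (216 N)^d; two more powers pay for the number of cells, and the last
two are the error left. *)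
Definition resolution_exponent := (216 * d + d + 2 + 2)%N.

Lemma regime_features_le C1 : 0 < C1 -> exists C, 0 < C /\ forall N m M r L (c : R) (k : nat),
  regime N m M r L -> 0 <= c -> c <= C1 * m * (M ^+ d + L ^+ d) -> k%:R <= 6 * r ^+ 2 ->
  c * N ^- resolution_exponent <= C /\
  c * (N ^- resolution_exponent * (2 ^+ (k * d) * (k ^ d)%:R)) <= C * N ^- 2.
Proof.
move=> C10; have [C2 [C20 H2]] := regime_cells_le_sqr C10.
exists (C2 * 216 ^+ d); split; first by rewrite mulr_gt0// exprn_gt0.
move=> N m M r L c k H c0 cle kr; have {}H2 := H2 _ _ _ _ _ _ H cle.
have [r3 rM rL L1 [L2 mN MN]] := regimeP H; have [N2 m1 M8 mM [LE rE]] := H.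
have N0 : 0 < N by lra.
have p216 : 1 <= 216 ^+ d :> R by rewrite exprn_ege1//; lra.
have kL : k%:R <= 216 * ln N.
  apply: le_trans kr _; rewrite -L2; have -> : 216 * L ^+ 2 = 6 * (6 * L) ^+ 2 by ring.
  by rewrite ler_wpM2l// lerXn2r ?nnegrE//; lra.
have lnN : ln N <= N by have := ln_le_sub1 N0; lra.
have e1 : 2 ^+ (k * d) <= N ^+ (216 * d) :> R.
  rewrite (@le_trans _ _ (expR ((k * d)%:R)))//.
    rewrite -[(k * d)%:R]mulr1 expRM_natl lerXn2r ?nnegrE ?expR_ge0//.
    by have := @expR_ge1Dx R 1; lra.
  rewrite natpow_expR// ler_expR natrM [(216 * d)%:R]natrM mulrAC ler_wpM2r//.
have e2 : (k ^ d)%:R <= 216 ^+ d * N ^+ d :> R.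
  rewrite natrX -exprMn; apply: lerXn2r; rewrite ?nnegrE ?mulr_ge0 ?(ltW N0)//.
  by apply: (le_trans kL); rewrite ler_wpM2l.
have NA : N ^+ resolution_exponent = N ^+ (216 * d) * N ^+ d * N ^+ 2 * N ^+ 2.
  by rewrite -!exprD.
have P k' : 0 < N ^+ k' by exact: exprn_gt0.
split.
  rewrite ler_pdivrMr// NA.
  have : 1 <= N ^+ (216 * d) * N ^+ d * N ^+ 2.
    by rewrite -!exprD exprn_ege1//; lra.
  set u := N ^+ _ * _ * _ => u1; apply: le_trans H2 _.
  rewrite -mulrA ler_wpM2l//; first lra.
  rewrite mulrA -[leLHS]mul1r ler_wpM2r ?(ltW (P 2%N))//; nra.
have -> : C2 * 216 ^+ d * N ^- 2 =
    (C2 * N ^+ 2) * (N ^- resolution_exponent * (N ^+ (216 * d) * (216 ^+ d * N ^+ d))).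
  rewrite NA; field; rewrite !expf_neq0// gt_eqF//.
apply: ler_pM => //.
  by rewrite !mulr_ge0// ?invr_ge0 ?exprn_ge0// ltW.
rewrite ler_wpM2l//; first by rewrite invr_ge0 ltW.
by apply: ler_pM => //; rewrite exprn_ge0.
Qed.

Lemma quantize_levels_le N : 2 <= N ->
  (quantize_levels (N ^- resolution_exponent))%:R <= N ^+ (resolution_exponent + 2).
Proof.
move=> N2; have N0 : 0 < N by lra.
have A0 : 1 <= N ^+ resolution_exponent by rewrite exprn_ege1//; lra.
have h0 : 0 <= 2 / N ^- resolution_exponent by rewrite invrK mulr_ge0//; lra.
rewrite /quantize_levels -addn1 natrD; have /andP[h _] := truncn_itv h0.
move: h; rewrite invrK exprD => h.
have N4 : 4 <= N ^+ 2 by nra.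
have : N ^+ resolution_exponent * 4 <= N ^+ resolution_exponent * N ^+ 2.
  by rewrite ler_wpM2l//; lra.
lra.
Qed.

Lemma regime_classes_le C1 : 0 < C1 -> exists C, 0 < C /\
  forall N m M r L (cC cN k : nat), regime N m M r L ->
  cC%:R <= C1 * m * (M ^+ d + L ^+ d) -> cN%:R <= C1 * m * (M / r) ^+ d ->
  k%:R <= 6 * r ^+ 2 ->
  ln ((cC * quantize_levels (N ^- resolution_exponent) ^ (k ^ d)).+1 ^ cN)%:R <=
  C * (m * M ^+ d * L ^+ (d + 2)).
Proof.
move=> C10; have [C2 [C20 H2]] := regime_cells_le_sqr C10.
pose A2 : R := (resolution_exponent + 2)%:R; have A20 : 0 <= A2 by exact: ler0n.
pose C3 := 2 * C2 + 4 + 6 ^+ d * A2.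
have p6 : 1 <= 6 ^+ d :> R by rewrite exprn_ege1//; lra.
have C30 : 0 < C3 by rewrite /C3; nra.
exists (C3 * C1 * 6 ^+ d); split; first by rewrite !mulr_gt0// exprn_gt0.
move=> N m M r L cC cN k H cCle cNle kr; have {}H2 := H2 _ _ _ _ _ _ H cCle.
have [r3 rM rL L1 [L2 mN MN]] := regimeP H; have [N2 m1 M8 mM [LE rE]] := H.
have N0 : 0 < N by lra.
have l2 := ln_ge_half N2.
set Q := quantize_levels _; set q := (k ^ d)%N.
have Q1 : 1 <= Q%:R :> R by rewrite ler1n.
have Qq : 1 <= (Q ^ q)%:R :> R by rewrite natrX exprn_ege1.
have r2d : 1 <= r ^+ (2 * d) by rewrite exprn_ege1//; lra.
have qle : q%:R <= 6 ^+ d * r ^+ (2 * d).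
  have -> : 6 ^+ d * r ^+ (2 * d) = (6 * r ^+ 2) ^+ d by rewrite exprMn exprM.
  by rewrite /q natrX; apply: lerXn2r => //; rewrite nnegrE// mulr_ge0// sqr_ge0.
have lnQ : ln Q%:R <= A2 * ln N.
  have : ln Q%:R <= ln (N ^+ (resolution_exponent + 2)).
    by rewrite ler_ln ?posrE ?exprn_gt0//; exact: quantize_levels_le.
  by rewrite lnXn// mulr_natl.
have lnC : ln (1 + cC%:R) <= (2 * C2 + 4) * ln N.
  have c1 : 0 < 1 + cC%:R :> R by rewrite ltr_pwDl.
  have : ln (1 + cC%:R) <= ln ((1 + C2) * N ^+ 2).
    rewrite ler_ln ?posrE//; last by rewrite mulr_gt0 ?exprn_gt0//; lra.
    by have : 1 <= N ^+ 2 by [rewrite exprn_ege1//; lra]; lra.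
  rewrite lnM ?posrE ?exprn_gt0//; last lra.
  rewrite lnXn// -mulr_natl.
  have := @ln_le_sub1 R (1 + C2); nra.
have Qp : 0 < Q%:R :> R by lra.
have cp : 0 < 1 + cC%:R :> R by rewrite ltr_pwDl.
have Qqp : 0 < Q%:R ^+ q :> R by exact: exprn_gt0.
have lnJ : ln (cC * Q ^ q).+1%:R <= C3 * r ^+ (2 * d) * ln N.
  have : ln (cC * Q ^ q).+1%:R <= ln ((1 + cC%:R) * (Q%:R ^+ q) : R).
    rewrite ler_ln ?posrE ?ltr0n ?(mulr_gt0 cp)//.
    by rewrite -natrX -addn1 natrD natrM mulrDl mul1r addrC lerD2r.
  rewrite lnM ?posrE// lnXn//.
  move=> /le_trans; apply.
  rewrite -(mulr_natl (ln Q%:R)) /C3.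
  have lnQ0 : 0 <= ln Q%:R :> R by rewrite ln_ge0.
  have : q%:R * ln Q%:R <= 6 ^+ d * r ^+ (2 * d) * (A2 * ln N).
    by apply: ler_pM.
  have : (2 * C2 + 4) * ln N <= (2 * C2 + 4) * ln N * r ^+ (2 * d).
    by rewrite ler_peMr// mulr_ge0//; lra.
  by move: lnC; lra.
rewrite natrX lnXn ?ltr0n// -(mulr_natl (ln _)).
have lnJ0 : 0 <= ln (cC * Q ^ q).+1%:R :> R by rewrite ln_ge0// ler1n.
apply: (@le_trans _ _ (C1 * m * (M / r) ^+ d * (C3 * r ^+ (2 * d) * ln N))).
  exact: ler_pM.
have r0 : r != 0 by rewrite gt_eqF//; lra.
have -> : C1 * m * (M / r) ^+ d * (C3 * r ^+ (2 * d) * ln N) =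
   C3 * C1 * (m * M ^+ d * L ^+ 2) * r ^+ d.
  rewrite expr_div_n -L2 mul2n -addnn exprD; field; exact: expf_neq0.
have -> : C3 * C1 * 6 ^+ d * (m * M ^+ d * L ^+ (d + 2)) =
   C3 * C1 * (m * M ^+ d * L ^+ 2) * (6 * L) ^+ d.
  by rewrite exprMn exprD; ring.
rewrite ler_wpM2l//; last by rewrite lerXn2r ?nnegrE//; lra.
rewrite !mulr_ge0 ?sqr_ge0 ?exprn_ge0 ?(ltW C30) ?(ltW C10)//;
  first [exact: le_trans m1|exact: le_trans M8|rewrite LE sqrtr_ge0//|lra].
Qed.

End parameter_bounds.

Section parameters.
Context {R : realType}.
Variables (d : nat) (d1 : (0 < d)%N).
Local Notation dR := (d%:R : R).

Let d1R : 1 <= dR. Proof. by rewrite ler1n. Qed.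

Lemma expR1_le4 : expR 1 <= 4 :> R.
Proof.
have h : 1 / 2 <= expR (- (1 / 2)) :> R by have := @expR_ge1Dx R (- (1 / 2)); lra.
have -> : expR 1 = (expR (1 / 2)) ^+ 2 :> R by rewrite -expRM_natl; congr expR; lra.
have : expR (1 / 2) <= 2 :> R.
  by rewrite -[expR _]invrK -expRN -[leRHS]invrK lef_pV2 ?posrE ?expR_gt0//; lra.
have := expR_gt0 (1 / 2 : R); nra.
Qed.

(** The mass of the envelope due to the points in no cell. *)
Lemma outside_mass_le (N m M r L : R) : regime d N m M r L ->
  expR (- ((6 * L) ^+ 2 / 2)) * (m * (2 * M) ^+ d) <= 2 ^+ d * N ^- 2.
Proof.
move=> H; have [_ _ _ _ [L2 _ _]] := regimeP H; have [N2 m1 M8 mM _] := H.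
have N0 : 0 < N by apply: lt_le_trans N2.
have e1 : expR (- ((6 * L) ^+ 2 / 2)) <= N ^- 3.
  by rewrite natpowV_expR// ler_expR exprMn L2; have := ln_ge_half N2; lra.
have M0 : 0 <= M by exact: le_trans M8.
have m0 : 0 <= m by exact: le_trans m1.
apply: (@le_trans _ _ (N ^- 3 * (2 ^+ d * N))).
  apply: ler_pM => //; rewrite ?expR_ge0//.
    by rewrite mulr_ge0// exprn_ge0// mulr_ge0.
  by rewrite exprMn mulrCA ler_wpM2l// exprn_ge0.
have -> // : N ^- 3 * (2 ^+ d * N) = 2 ^+ d * N ^- 2 by field; rewrite gt_eqF.
Qed.

Lemma far_mass_le (r a : R) : dR * a ^+ 2 <= r ^+ 2 / 4 ->
  expR (- (r ^+ 2 / 4) + dR * a ^+ 2 / 4) <= expR (- (3 * r ^+ 2 / 16)).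
Proof. by rewrite ler_expR; lra. Qed.

Lemma expansion_mass_le (r a : R) (k : nat) : dR * a ^+ 2 <= r ^+ 2 / 4 -> 5 * r ^+ 2 <= k%:R ->
  (expR (dR * a ^+ 2 / 2) + 1) * (dR * 4 ^- k * expR (16 * dR * a ^+ 2)) <=
  2 * dR * expR (- (3 * r ^+ 2 / 16)).
Proof.
move=> da kr; set B := expR (dR * a ^+ 2 / 2).
have B1 : B + 1 <= 2 * B.
  have : 1 <= B by rewrite -expR0 ler_expR divr_ge0// mulr_ge0// sqr_ge0.
  by rewrite mulr2n mulrDl mul1r lerD2l.
have e4 : 4 ^- k <= expR (- (5 * r ^+ 2)).
  apply: (@le_trans _ _ (expR (- k%:R))); last by rewrite ler_expR lerN2.
  rewrite expRN lef_pV2 ?posrE ?exprn_gt0 ?expR_gt0//.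
  rewrite -[k%:R]mulr1 expRM_natl lerXn2r ?nnegrE ?expR_ge0//.
  exact: expR1_le4.
have e5 : B * (4 ^- k * expR (16 * dR * a ^+ 2)) <= expR (- (3 * r ^+ 2 / 16)).
  apply: (@le_trans _ _ (B * (expR (- (5 * r ^+ 2)) * expR (16 * dR * a ^+ 2)))).
    by rewrite ler_wpM2l ?expR_ge0// ler_wpM2r ?expR_ge0.
  by rewrite -!expRD ler_expR -mulrA; move: da; have := sqr_ge0 r; lra.
have e50 : 0 <= dR * 4 ^- k * expR (16 * dR * a ^+ 2).
  by rewrite !mulr_ge0 ?expR_ge0// invr_ge0 exprn_ge0.
apply: le_trans (ler_wpM2r e50 B1) _.
have -> : 2 * B * (dR * 4 ^- k * expR (16 * dR * a ^+ 2)) =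
   2 * dR * (B * (4 ^- k * expR (16 * dR * a ^+ 2))) by ring.
by rewrite ler_wpM2l// mulr_ge0.
Qed.

Let W : R := 2 ^+ (d + 4).

Let W1 : 1 <= W. Proof. by rewrite exprn_ege1// ler1n. Qed.

Lemma square_dominates (N L w : R) : 0 < N -> 1 <= 2 * L -> 0 <= w ->
  N ^- 2 + L ^+ d * w ^+ 2 <= W * (N^-1 + L ^+ (d + 2) * w) ^+ 2.
Proof.
move=> N0 L1 w0; have L0 : 0 <= L by lra.
have e1 : L ^+ d * w ^+ 2 <= W * (L ^+ (d + 2) * w) ^+ 2.
  rewrite (exprMn 2 _ w) (mulrA W) ler_wpM2r ?sqr_ge0// -exprM.
  have -> : ((d + 2) * 2 = d + (d + 4))%N by clear; lia.
  rewrite (exprD L d (d + 4)) mulrCA -exprMn ler_peMr ?exprn_ge0//.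
  by rewrite exprn_ege1.
have N1 : 0 < N^-1 by rewrite invr_gt0.
have e2 : N ^- 2 <= W * N^-1 ^+ 2 by rewrite exprVn ler_peMl// invr_ge0 exprn_ge0// ltW.
rewrite sqrrD; have : 0 <= W * ((N^-1 * (L ^+ (d + 2) * w)) *+ 2).
  by rewrite mulr_ge0 ?mulrn_wge0 ?mulr_ge0 ?exprn_ge0 ?(ltW N1)//; exact: le_trans W1.
by move: e1 e2; lra.
Qed.

Lemma balance_mass (c1 c2 c3 c4 K x1 x2 x3 x4 x5 S : R) : 0 <= c2 ->
  K = c1 + c2 * (c3 + c4) + 1 ->
  x1 <= c1 * S -> x2 + x3 <= c3 * S -> x4 <= c4 * S -> x5 <= S ->
  x1 + c2 * (x2 + x3 + x4) + x5 <= K * S.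
Proof.
move=> c20 -> h1 h2 h4 h5.
have : c2 * (x2 + x3 + x4) <= c2 * ((c3 + c4) * S) by rewrite ler_wpM2l//; lra.
lra.
Qed.

Lemma balance_risk (W' U V C9 C4 tau j v : R) :
  j <= 2 * C4 * U -> 2 * tau <= 2 * C9 * (W' * U + V) -> v <= W' * U ->
  0 <= 3 * W' * V -> 0 <= C4 * V -> 0 <= C9 * U -> 0 <= C9 * (W' * V) ->
  v + 2 * tau + (j + 2 * v) <= (3 * W' + 2 * C9 * (1 + W') + 2 * C4) * (U + V).
Proof. lra. Qed.

Lemma lattice_spacing (r M L : R) (a := r / (2 * dR)) : 0 < r -> r <= M -> 0 <= L ->
  [/\ 0 < a, dR * a ^+ 2 <= r ^+ 2 / 4 &
   exists Z0 Z1 : nat, [/\ (M + r) / a + 1 <= Z0%:R /\ (M + 6 * L) / a + 1 <= Z1%:R,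
     Z0%:R <= 4 * dR * (M / r) + 2 & Z1%:R <= 2 * dR * ((M + 6 * L) / r) + 2]].
Proof.
move=> r0 rM L0; have dn0 : dR != 0 by rewrite pnatr_eq0; move: d1; clear; lia.
have d0 : 0 < dR by exact: lt_le_trans d1R.
have a0 : 0 < a by rewrite divr_gt0// mulr_gt0.
have M0 : 0 <= M by exact: le_trans (ltW r0) rM.
have aV u : u / a = 2 * dR * (u / r) by rewrite /a; field; rewrite dn0 gt_eqF.
split=> //.
  have -> : dR * a ^+ 2 = r ^+ 2 / 4 / dR by rewrite /a; field; rewrite dn0.
  by rewrite ler_pdivrMr// ler_peMr ?divr_ge0 ?sqr_ge0.
have y0 : 0 <= (M + r) / a by rewrite divr_ge0 ?addr_ge0 ?(ltW r0) ?(ltW a0).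
have y1 : 0 <= (M + 6 * L) / a.
  by rewrite divr_ge0 ?(ltW a0)// addr_ge0// mulr_ge0.
have [Z0 [hZ0 hZ0']] := exists_width y0.
have [Z1 [hZ1 hZ1']] := exists_width y1.
exists Z0, Z1; split=> //; last by rewrite -aV.
apply: le_trans hZ0' _; rewrite lerD2r aV.
have -> : 4 * dR * (M / r) = 2 * dR * ((M + M) / r) by rewrite mulrDl; ring.
by rewrite ler_wpM2l ?mulr_ge0// ler_wpM2r ?invr_ge0 ?(ltW r0)// lerD2l.
Qed.

(** The choices are r = min (M, 6 L), cells of side r / (2 d), an expansion of order
k between 5 r^2 and 6 r^2, for which 4^-k beats the growth exp (16 d a^2) of the
truncation error, and cells up to distance M + 6 L from the net, beyond which the
kernel is at most N^-18. *)
Lemma discretization_parameters : exists C, 0 < C /\ forall (n m : nat) (M L : R),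
  (1 < n)%N -> (0 < m)%N -> 8 <= M -> m%:R * M ^+ d <= n%:R -> L = Num.sqrt (ln n%:R) ->
  exists (a r R1 delta tau : R) (k Z0 Z1 : nat),
  let cardC := (m * Z0.*2.+1 ^ d + m * Z1.*2.+1 ^ d)%N in
  [/\ [/\ 0 < tau, 0 < a, 0 <= r, 0 <= R1 & 0 < delta], (0 < k)%N,
      (M + r) / a + 1 <= Z0%:R /\ (M + R1) / a + 1 <= Z1%:R,
      expR (- (R1 ^+ 2 / 2)) * (m%:R * (2 * M) ^+ d) +
      6 ^+ d * (cardC%:R * (expR (- (r ^+ 2 / 4) + dR * a ^+ 2 / 4) / m%:R +
                  delta * (2 ^+ (k * d) * (k ^ d)%:R)) +
                (expR (dR * a ^+ 2 / 2) + 1) * (1 + cardC%:R * delta) *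
                (dR * 4 ^- k * expR (16 * dR * a ^+ 2))) + n%:R ^- 2 <= tau ^+ 2 &
      n%:R^-1 + 2 * tau + 2 / n%:R * (ln
        ((cardC * quantize_levels delta ^ (k ^ d)).+1 ^ (m * Z0.*2.+1 ^ d + m))%:R + 1) <=
      C * (m%:R / n%:R * M ^+ d * L ^+ (d + 2) + L ^+ (d + 2) * expR (- (M ^+ 2 / 32)))].
Proof.
have [C1 [C10 H1]] := @regime_cells_le R d d1.
have [C5 [C50 H5]] := @regime_radius_gauss R d.
have [C6 [C60 H6]] := @regime_features_le R d _ C10.
have [C4 [C40 H4]] := @regime_classes_le R d _ C10.
pose c4 : R := (1 + C6) * (2 * dR) * C5.
pose K : R := 2 ^+ d + 6 ^+ d * (C1 * C5 + C6 + c4) + 1.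
have K1 : 1 <= K.
  rewrite /K lerDr addr_ge0 ?exprn_ge0// mulr_ge0 ?exprn_ge0// /c4.
  by rewrite !addr_ge0// ?(ltW C60)// !mulr_ge0// ?addr_ge0 ?(ltW C60) ?(ltW C10) ?(ltW C50).
pose C9 : R := K * W.
have C91 : 1 <= C9 by rewrite /C9 mulr_ege1.
exists (3 * W + 2 * C9 * (1 + W) + 2 * C4); split.
  have : 0 <= 2 * C9 * (1 + W).
    apply: mulr_ge0; first by apply: mulr_ge0 => //; exact: le_trans C91.
    by apply: addr_ge0 => //; exact: le_trans W1.
  by move: W1 C40; lra.
move=> n m M L n1 m1 M8 mM LE; set N : R := n%:R in mM LE *.
pose r := Num.min M (6 * L).
have H : regime d N m%:R M r L by split=> //; rewrite ?ler1n// /N ler_nat.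
have [r3 rM rL L1 [L2 mN MN]] := regimeP H.
have N2 : 2 <= N by rewrite /N ler_nat.
have N0 : 0 < N by exact: lt_le_trans N2.
have Ni : 0 < N^-1 by rewrite invr_gt0.
have m1R : 1 <= m%:R :> R by rewrite ler1n.
have r0 : 0 < r by exact: lt_le_trans r3.
have L0 : 0 <= L by rewrite LE sqrtr_ge0.
have M0 : 0 <= M by exact: le_trans M8.
have [a0 da [Z0 [Z1 [hZ Z0le Z1le]]]] := lattice_spacing r0 rM L0.
set a := r / (2 * dR) in a0 da hZ.
pose delta := N ^- resolution_exponent d.
have delta0 : 0 < delta by rewrite invr_gt0 exprn_gt0.
pose k := (Num.truncn (5 * r ^+ 2)).+1.
have [k1 k3] : 5 * r ^+ 2 <= k%:R /\ k%:R <= 6 * r ^+ 2.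
  have h5 : 0 <= 5 * r ^+ 2 by rewrite mulr_ge0 ?sqr_ge0.
  have /andP[u1 /ltW u2] := truncn_itv h5; split=> //.
  have : 3 * 3 <= r ^+ 2 by rewrite expr2; apply: ler_pM.
  by move: u1; rewrite /k -addn1 natrD; lra.
pose w := expR (- (M ^+ 2 / 16)).
have w0 : 0 < w by exact: expR_gt0.
have L20 : 0 <= L ^+ (d + 2) by exact: exprn_ge0.
pose tau := C9 * (N^-1 + L ^+ (d + 2) * w).
have C90 : 0 < C9 by exact: lt_le_trans C91.
have tau0 : 0 < tau by rewrite mulr_gt0// ltr_pwDl// mulr_ge0// ltW.
exists a, r, (6 * L), delta, tau, k, Z0, Z1 => cardC.
have [cCle cNle] := H1 _ _ _ _ _ m Z0 Z1 H erefl Z0le Z1le.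
split=> //.
- by split=> //; rewrite ?(ltW r0)// mulr_ge0.
- have [F1 F2] := H6 _ _ _ _ _ cardC%:R k H (ler0n _ _) cCle k3.
  have G5 := H5 _ _ _ _ _ H.
  set S := N ^- 2 + L ^+ d * w ^+ 2.
  have S0 : N ^- 2 <= S by rewrite /S lerDl mulr_ge0 ?sqr_ge0// exprn_ge0.
  have Nm2 : 0 <= N ^- 2 by rewrite invr_ge0 exprn_ge0// ltW.
  have gw : expR (- (M ^+ 2 / 8)) = w ^+ 2 by rewrite /w -expRM_natl; congr expR; lra.
  rewrite gw -/S in G5; set rho := expR _ in G5.
  have rho0 : 0 <= rho by exact: expR_ge0.
  have Md0 : 0 <= M ^+ d by exact: exprn_ge0.
  have Ld0 : 0 <= L ^+ d by exact: exprn_ge0.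
  have rhoS : rho <= C5 * S.
    by apply: le_trans G5; rewrite ler_peMl// -addrA lerDl addr_ge0.
  have t2 : cardC%:R * (expR (- (r ^+ 2 / 4) + dR * a ^+ 2 / 4) / m%:R) <= C1 * C5 * S.
    have e2 : cardC%:R / m%:R <= C1 * (M ^+ d + L ^+ d).
      by rewrite ler_pdivrMr ?ltr0n// mulrAC.
    rewrite mulrCA mulrC; apply: (@le_trans _ _ (C1 * (M ^+ d + L ^+ d) * rho)).
      by apply: ler_pM; rewrite ?expR_ge0// ?divr_ge0// far_mass_le.
    rewrite -!mulrA ler_wpM2l ?(ltW C10)//; apply: le_trans G5.
    by rewrite ler_wpM2r// -addrA lerDr.
  have t3 : cardC%:R * (delta * (2 ^+ (k * d) * (k ^ d)%:R)) <= C6 * S.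
    by apply: le_trans F2 _; rewrite ler_wpM2l// ltW.
  have t4 : (expR (dR * a ^+ 2 / 2) + 1) * (1 + cardC%:R * delta) *
      (dR * 4 ^- k * expR (16 * dR * a ^+ 2)) <= c4 * S.
    have c0 : 0 <= cardC%:R * delta by rewrite mulr_ge0// ltW.
    have C61 : 0 <= 1 + C6 by rewrite addr_ge0// ltW.
    rewrite mulrAC mulrC.
    apply: (@le_trans _ _ ((1 + C6) * (2 * dR * rho))).
      have e0 : 0 <= dR * 4 ^- k * expR (16 * dR * a ^+ 2).
        by rewrite !mulr_ge0 ?expR_ge0// invr_ge0 exprn_ge0.
      apply: ler_pM; last exact: expansion_mass_le.
      - by rewrite addr_ge0.
      - by rewrite mulr_ge0// addr_ge0// expR_ge0.
      - by rewrite lerD2l.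
    rewrite /c4 -!mulrA ler_wpM2l// ler_wpM2l// ler_wpM2l//.
  apply: (@le_trans _ _ (K * S)).
    rewrite (mulrDr cardC%:R).
    apply: (@balance_mass _ _ (C1 * C5 + C6) c4 K _ _ _ _ _ S _ erefl) => //.
    - by apply: le_trans (outside_mass_le H) _; rewrite ler_wpM2l ?exprn_ge0.
    - by rewrite mulrDl; exact: lerD.
  rewrite /tau exprMn.
  apply: (@le_trans _ _ (C9 * (N^-1 + L ^+ (d + 2) * w) ^+ 2)).
    rewrite /C9 -mulrA ler_wpM2l ?(le_trans _ K1)//.
    exact: square_dominates (ltW w0).
  by rewrite ler_wpM2r ?sqr_ge0// expr2 ler_peMl// ltW.
- have J := H4 _ _ _ _ _ cardC _ k H cCle cNle k3.
  rewrite -/N; move: J.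
  set j := ln _; set U' := m%:R * M ^+ d * L ^+ (d + 2) => J.
  set V := L ^+ (d + 2) * expR _; set U := m%:R / N * M ^+ d * L ^+ (d + 2).
  have V0 : 0 <= V by rewrite mulr_ge0 ?expR_ge0.
  have Md1 : 1 <= M ^+ d by rewrite exprn_ege1// (le_trans _ M8)// ler1n.
  have wV : L ^+ (d + 2) * w <= V.
    by rewrite ler_wpM2l// ler_expR lerN2 ler_wpM2l ?sqr_ge0// lef_pV2 ?posrE// ler_nat.
  have UE : U = N^-1 * U' by rewrite /U /U'; ring.
  have U'0 : 0 <= U' by rewrite !mulr_ge0// (le_trans _ Md1).
  have U0 : N^-1 <= W * U.
    have PL : 1 <= 2 ^+ (d + 2) * L ^+ (d + 2) by rewrite -exprMn exprn_ege1.
    have PW : 2 ^+ (d + 2) <= W by rewrite ler_weXn2l ?ler1n//; clear; lia.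
    have h1 : 1 <= W * L ^+ (d + 2) by apply: le_trans PL _; rewrite ler_wpM2r.
    have h2 : 1 <= m%:R * M ^+ d by rewrite mulr_ege1.
    rewrite UE mulrCA ler_peMr ?(ltW Ni)//.
    have -> : W * U' = (m%:R * M ^+ d) * (W * L ^+ (d + 2)) by rewrite /U'; ring.
    by rewrite mulr_ege1.
  have JU : 2 / N * j <= 2 * C4 * U.
    by rewrite -!mulrA ler_wpM2l// UE mulrCA ler_wpM2l ?(ltW Ni).
  have tU : 2 * tau <= 2 * C9 * (W * U + V).
    by rewrite -mulrA ler_wpM2l// ler_wpM2l ?(ltW C90)// lerD.
  have U00 : 0 <= U by rewrite UE mulr_ge0// ltW.
  rewrite mulrDr mulr1.
  have W0 : 0 <= W by exact: le_trans W1.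
  have s1 : 0 <= 3 * W * V by rewrite !mulr_ge0.
  have s2 : 0 <= C4 * V by rewrite mulr_ge0// ltW.
  have s3 : 0 <= C9 * U by rewrite mulr_ge0// ltW.
  have s4 : 0 <= C9 * (W * V) by apply: mulr_ge0; [exact: ltW|exact: mulr_ge0].
  exact: balance_risk JU tU U0 s1 s2 s3 s4.
Qed.

End parameters.

(** * The risk bound with free radius and moment *)

Section net_risk.
Context {R : realType}.
Variables (d : nat) (d1 : (0 < d)%N).
Local Notation E := 'rV[R]_d.
Local Notation dR := (d%:R : R).

Section trivial_bound.
Context {n : nat} {dO} {Omega : measurableType dO} (P : probability Omega R).
Variables (G : 'I_n -> probability E R) (X : 'I_n -> {RV P >-> E}).
Hypothesis n0 : (0 < n)%N.
Variable fhat : Omega -> E -> R.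
Hypothesis npmle : forall w, is_NPMLE (fun i => X i w) (fhat w).

Lemma risk_le2 :
  ('E_P[fun w => hellinger2 (fhat w) (mixture_density (average_measure G))] <= 2%:E)%E.
Proof.
have [Gp GpE] := average_measure_probability G n0.
rewrite -(eq_mixture_density GpE) unlock.
apply: (@le_trans _ _ (\int[P]_w (cst 2%:E) w)%E).
  apply: ge0_le_integral_sub => w; first by rewrite lee_fin hellinger2_ge0.
  by rewrite lee_fin; have [[H _ <-] _] := npmle w; exact: hellinger2_mixture_le2.
by rewrite integral_cst// [X in (_ * X)%E]probability_setT mule1.
Qed.

End trivial_bound.

(** In the nontrivial regime m and M are at most n, so that all the logarithms in the
tail bound are of the order of ln n. *)
Lemma log_floor_le (n m : nat) (M p : R) : (1 < n)%N -> (0 < m)%N -> 8 <= M -> 0 < p ->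
  m%:R * M ^+ d <= n%:R ->
  ln (m%:R / n%:R ^- 2) + dR * ln 4 + 2 * dR * ln (2 * M) + 2 * dR / p <=
    (3 + 22 * dR) * (ln n%:R + 1 / p) /\
  ln (m%:R / n%:R ^- 2) + dR * ln 4 + 8 * dR <= (3 + 22 * dR) * ln n%:R.
Proof.
move=> n1 m1 M8 p0 mM; set N : R := n%:R in mM *.
have N2 : 2 <= N by rewrite /N ler_nat.
have N0 : 0 < N by exact: lt_le_trans N2.
have l2 := ln_ge_half N2.
have m1R : 1 <= m%:R :> R by rewrite ler1n.
have M1 : 1 <= M by apply: le_trans M8; rewrite ler1n.
have M0 : 0 < M by exact: lt_le_trans M1.
have Md : M <= M ^+ d by rewrite -[leLHS]expr1 ler_weXn2l.
have Md0 : 0 <= M ^+ d by rewrite exprn_ge0// ltW.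
have mN : m%:R <= N.
  apply: le_trans mM; rewrite ler_peMr//; exact: le_trans M1 Md.
have MN : M <= N.
  by apply: le_trans Md _; apply: le_trans mM; rewrite ler_peMl.
have lnm : ln (m%:R / N ^- 2) <= 3 * ln N.
  have -> : 3 * ln N = ln (N ^+ 3) by rewrite lnXn// -(mulr_natl (ln N)).
  rewrite invrK ler_ln ?posrE ?exprn_gt0//; last first.
    by rewrite mulr_gt0 ?exprn_gt0// ltr0n.
  by rewrite (exprS N 2) ler_wpM2r ?sqr_ge0.
have ln4 : ln 4 <= 3 :> R by have := @ln_le_sub1 R 4; lra.
have lnM2 : ln (2 * M) <= 2 * ln N.
  have -> : 2 * ln N = ln (N ^+ 2) by rewrite lnXn// -(mulr_natl (ln N)).
  rewrite ler_ln ?posrE ?exprn_gt0 ?mulr_gt0//.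
  by rewrite expr2; apply: ler_pM => //; exact: ltW.
have dR0 : 0 <= dR by exact: ler0n.
have p1 : 0 < p^-1 by rewrite invr_gt0.
have h1 : dR * ln 4 <= dR * 3 by rewrite ler_wpM2l.
have h2 : dR * ln (2 * M) <= dR * (2 * ln N) by rewrite ler_wpM2l.
have h3 : dR * (1 / 2) <= dR * ln N by rewrite ler_wpM2l.
have h4 : 0 <= dR * p^-1 by rewrite mulr_ge0// ltW.
split; last by move: lnm h1 h3; lra.
by move: lnm h1 h2 h3 h4 p1; lra.
Qed.

(** The bound for a net s of S, with the radius M and the moment p still free. The
three terms are the entropy of the net at radius M, the part of the Gaussian noise
that leaves the balls of radius M, and the part of the mixing measure that does. *)
Theorem risk_le_net : exists C : R, 0 < C /\ forall (n : nat) (dO : measure_display)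
    (Omega : measurableType dO) (P : probability Omega R) (G : 'I_n -> probability E R)
    (X : 'I_n -> {RV P >-> E}) (fhat : Omega -> E -> R)
    (S : set E) (m : nat) (s : 'I_m -> E) (M p L : R),
  (1 < n)%N -> mutually_independent X ->
  (forall i, has_density (X i) (mixture_density (G i))) ->
  (forall w, is_NPMLE (fun i => X i w) (fhat w)) ->
  S !=set0 -> (0 < m)%N -> 8 <= M -> 0 < p ->
  (forall x : E, exists j, forall i, `|x ord0 i - s j ord0 i| <= dist_to S x + 1) ->
  L = Num.sqrt (ln n%:R) ->
  ('E_P[fun w => hellinger2 (fhat w) (mixture_density (average_measure G))] <=
   (C * (m%:R / n%:R * M ^+ d * L ^+ (d + 2) + L ^+ (d + 2) * expR (- (M ^+ 2 / 32))))%:E +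
   (C * (L ^+ 2 + 1 / p) * (3 / M) `^ p)%:E *
     \int[average_measure G]_theta (dist_to S theta `^ p)%:E)%E.
Proof.
have [C1 [C10 H1]] := @discretization_parameters R d d1.
pose C2 : R := 3 + 22 * dR.
have C20 : 0 < C2 by rewrite /C2 ltr_pwDl// mulr_ge0.
pose W : R := 2 ^+ (d + 3).
have W0 : 0 < W by rewrite exprn_gt0.
have q0 : 0 < 12 ^+ d :> R by rewrite exprn_gt0.
have q1 : 1 <= 12 ^+ d :> R by rewrite exprn_ege1// ler1n.
have CW : 0 < C2 * 12 ^+ d by rewrite mulr_gt0.
exists (C1 + W + C2 * 12 ^+ d); split; first by rewrite !addr_gt0.
set C := _ + _ + _ => n dO Omega P G X fhat S m s M p L n1 indX densX npmle S0 m0 M8 p0 net LE.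
have n0 : (0 < n)%N by exact: ltnW.
have CC1 : C1 <= C by rewrite /C -addrA lerDl addr_ge0// ltW.
have CW' : W <= C by rewrite /C addrAC lerDr addr_ge0// ltW.
have CC2 : C2 * 12 ^+ d <= C by rewrite /C lerDr addr_ge0// ltW.
have C0 : 0 < C by exact: lt_le_trans CC1.
have CC2' : C2 <= C by apply: le_trans CC2; rewrite ler_peMr// ltW.
have N2 : 2 <= n%:R :> R by rewrite ler_nat.
have N0 : 0 < n%:R :> R by exact: lt_le_trans N2.
have l2 := ln_ge_half N2.
have L2 : L ^+ 2 = ln n%:R.
  by rewrite LE sqr_sqrtr//; apply: le_trans l2; rewrite divr_ge0.
have L0 : 0 <= L by rewrite LE sqrtr_ge0.
have L1 : 1 <= 2 * L.
  by rewrite -(@ler_pXn2r _ 2)// ?nnegrE ?mulr_ge0// exprMn L2; move: l2; lra.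
have M0 : 0 <= M by exact: le_trans M8.
set U := m%:R / n%:R * M ^+ d * L ^+ (d + 2).
set V := L ^+ (d + 2) * expR (- (M ^+ 2 / 32)).
have U0 : 0 <= U by rewrite /U !mulr_ge0 ?exprn_ge0 ?invr_ge0.
have V0 : 0 <= V by rewrite mulr_ge0 ?expR_ge0 ?exprn_ge0.
have c0 : 0 <= C * (L ^+ 2 + 1 / p) * (3 / M) `^ p.
  by rewrite !mulr_ge0 ?powR_ge0 ?(ltW C0)// addr_ge0 ?sqr_ge0// divr_ge0// ltW.
have I0 : (0 <= \int[average_measure G]_theta (dist_to S theta `^ p)%:E)%E.
  by apply: integral_ge0 => t _; rewrite lee_fin powR_ge0.
have [mM|mM] := lerP (m%:R * M ^+ d) n%:R; last first.
  apply: (le_trans (risk_le2 G n0 npmle)).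
  rewrite -[leLHS]adde0; apply: leeD; last by rewrite mule_ge0// lee_fin.
  rewrite lee_fin; apply: (@le_trans _ _ (W * U)); last first.
    by apply: ler_pM; rewrite ?(ltW W0)// lerDl.
  have h1 : 1 <= m%:R / n%:R * M ^+ d by rewrite mulrAC ler_pdivlMr// mul1r ltW.
  have h2 : 2 <= W * L ^+ (d + 2).
    rewrite /W (addnS d 2) exprS -mulrA -exprMn ler_peMr// exprn_ege1//.
  have -> : W * U = (m%:R / n%:R * M ^+ d) * (W * L ^+ (d + 2)) by rewrite /U; ring.
  by apply: (le_trans h2); rewrite ler_peMl// (le_trans _ h2).
have [a [r [R1 [delta [tau [k [Z0 [Z1 [] ]]]]]]]] := H1 n m M L n1 m0 M8 mM LE.
move=> [tau0 a0 r0 R10 delta0] k0 [hZ0 hZ1] tau_ge main.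
have eps0 : 0 < n%:R ^- 2 :> R by rewrite invr_gt0 exprn_gt0.
have eps1 : n%:R ^- 2 <= 1 :> R.
  by rewrite invf_le1 ?exprn_gt0// exprn_ege1// ler1n.
have e0 : 0 < n%:R^-1 :> R by rewrite invr_gt0.
apply: le_trans (grid_risk_le n0 indX densX npmle s m0 M0 eps0 eps1 e0 tau0 a0 r0 R10
  delta0 k0 hZ0 hZ1 tau_ge) _.
have [Gp GpE] := average_measure_probability G n0.
rewrite -(eq_mixture_density GpE).
have tail := tail_le m0 eps0 eps1 S0 M8 p0 net Gp.
have IE : (\int[Gp]_theta (dist_to S theta `^ p)%:E =
    \int[average_measure G]_theta (dist_to S theta `^ p)%:E)%E.
  by apply: eq_measure_integral => A mA _; exact: GpE.
rewrite {}IE in tail.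
apply: le_trans (leeD (lexx _) tail) _.
have [t1 t2] := log_floor_le n1 m0 M8 p0 mM.
set I := (\int[_]_theta _)%E in I0 *.
rewrite addeCA addeA [leRHS]addeC -!addeA; apply: leeD.
  apply: lee_wpmul2r => //; rewrite lee_fin ler_wpM2r ?powR_ge0//.
  apply: le_trans t1 _; rewrite L2 ler_wpM2r// addr_ge0//.
    by rewrite -L2 sqr_ge0.
  by rewrite divr_ge0// ltW.
rewrite -EFinD lee_fin.
have t3 : (ln (m%:R / n%:R ^- 2) + dR * ln 4 + 8 * dR) * expR (- (M ^+ 2 / 32)) * 6 ^+ d <=
    C2 * 12 ^+ d * V.
  apply: (@le_trans _ _ (C2 * ln n%:R * expR (- (M ^+ 2 / 32)) * 6 ^+ d)).
    by rewrite ler_wpM2r ?exprn_ge0// ler_wpM2r ?expR_ge0.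
  have -> : C2 * 12 ^+ d * V =
      C2 * ln n%:R * expR (- (M ^+ 2 / 32)) * 6 ^+ d * (2 * L) ^+ d.
    rewrite /V -L2 exprD exprMn.
    have -> : (12 : R) = 6 * 2 by rewrite -natrM.
    by rewrite exprMn; ring.
  rewrite ler_peMr ?exprn_ege1// !mulr_ge0 ?exprn_ge0 ?expR_ge0 ?(ltW C20)//.
  by rewrite -L2 sqr_ge0.
have W2 : 0 <= W * (U + V) by rewrite mulr_ge0 ?addr_ge0// ltW.
have U3 : 0 <= C2 * 12 ^+ d * U by rewrite mulr_ge0// ltW.
apply: (le_trans (lerD main t3)).
have -> : C * (U + V) = C1 * (U + V) + C2 * 12 ^+ d * V + (W * (U + V) + C2 * 12 ^+ d * U).
  by rewrite /C; ring.
by rewrite lerDl addr_ge0.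
Qed.

End net_risk.

(** * The three rates *)

Lemma three_terms_le {R : realType} (a b c t1 t2 t3 T : R) : 0 <= c -> 0 <= a * T ->
  t1 <= b * T -> t2 <= c * T -> t3 <= 2 * (c * T) ->
  c * (t1 + t2) + c * t3 <= (a + c * b + 3 * c * c) * T.
Proof.
move=> c0 aT h1 h2 h3; rewrite -mulrDr.
have : c * (t1 + t2 + t3) <= c * (b * T + c * T + 2 * (c * T)).
  by rewrite ler_wpM2l// !lerD.
lra.
Qed.

Section rates.
Context {R : realType}.
Variables (d : nat) (C : R) (n : nat) (mu : probability 'rV[R]_d R) (risk : \bar R).
Local Notation E := 'rV[R]_d.
Local Notation dR := (d%:R : R).
Local Notation N := (n%:R : R).
Local Notation L := (Num.sqrt (ln N)).
Local Notation Vol := (lebesgue_rV d).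
Hypothesis C0 : 0 < C.
Hypothesis n1 : (1 < n)%N.
Hypothesis risk2 : (risk <= 2%:E)%E.
Hypothesis risk_vol : forall (S : set E) (v M p : R),
  S !=set0 -> Vol (enlargement S) = v%:E -> 8 <= M -> 0 < p ->
  1 <= C * v /\
  (risk <= (C * (v / N * M ^+ d * L ^+ (d + 2) + L ^+ (d + 2) * expR (- (M ^+ 2 / 32))))%:E +
   (C * (L ^+ 2 + 1 / p) * (3 / M) `^ p)%:E * \int[mu]_theta (dist_to S theta `^ p)%:E)%E.

Lemma log_size_facts : [/\ 0 < N, 1 / 2 <= ln N, L ^+ 2 = ln N, 0 <= L & 1 <= 2 * L].
Proof.
have N2 : 2 <= N by rewrite ler_nat.
have l2 := ln_ge_half N2.
have L2 : L ^+ 2 = ln N by rewrite sqr_sqrtr//; lra.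
split=> //; first by apply: lt_le_trans N2.
by rewrite -(@ler_pXn2r _ 2)// ?nnegrE ?mulr_ge0// exprMn L2; lra.
Qed.

(** The three bounds are trivial when the enlargement has infinite volume. *)
Lemma volume_cases (S : set E) :
  Vol (enlargement S) = +oo%E \/ exists2 v, Vol (enlargement S) = v%:E & 0 <= v.
Proof.
have : (0 <= Vol (enlargement S))%E by exact: measure_ge0.
by case: (Vol (enlargement S)) => [v v0| _|//]; [right; exists v|left].
Qed.

Lemma integral_dist_eq0 (S : set E) : compact S -> mu S = 1%E ->
  (\int[mu]_theta (dist_to S theta `^ 1)%:E = 0)%E.
Proof.
move=> cS muS.
have mS : measurable S.
  rewrite -(setCK S); apply: measurableC; apply: open_measurable_rV.
  by apply: closed_openC; apply: compact_closed => //; exact: norm_hausdorff.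
have S0 : S !=set0.
  apply/set0P/eqP => S0; move: muS; rewrite S0 measure0 => /eqP.
  by rewrite eq_sym onee_eq0.
have mC : mu (~` S) = 0%E by rewrite probability_setC// muS subee.
rewrite (@ge0_negligible_integral _ _ _ mu setT (~` S))//.
- rewrite setTD setCK; apply: integral0_eq => t St.
  by rewrite dist_to_in// powRr1.
- exact: measurableC.
- apply/measurable_EFinP; under eq_fun do rewrite powRr1 ?dist_to_ge0//.
  exact: measurable_dist_to.
- by move=> t _; rewrite lee_fin powR_ge0.
Qed.

Lemma integral_dist_le (S : set E) (p b : R) : 0 < p -> 0 <= b ->
  (dist_moment p S mu <= b%:E)%E ->
  (\int[mu]_theta (dist_to S theta `^ p)%:E <= (b `^ p)%:E)%E.
Proof.
move=> p0 b0; rewrite /dist_moment; set I := (\int[mu]_theta _)%E => hI.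
have I0 : (0 <= I)%E by apply: integral_ge0 => t _; rewrite lee_fin powR_ge0.
have -> : I = ((I `^ p^-1) `^ p)%E by rewrite -poweRrM mulVf ?gt_eqF// poweRe1.
have := poweR_ge0 I p^-1; case: (I `^ p^-1)%E hI => [r| |]//; rewrite !lee_fin => rb r0.
by apply: ge0_ler_powR; rewrite ?nnegrE// ltW.
Qed.

(** With M = 16 L the Gaussian term is at most 1 / n, and the moment of the distance
vanishes. *)
Lemma rate_compact_support (S : set E) : compact S -> mu S = 1%E ->
  (risk <= (C * 16 ^+ d + C * C * 2 ^+ d)%:E * Vol (enlargement S) * (N^-1)%:E
             * (ln N ^+ d.+1)%:E)%E.
Proof.
move=> cS muS; have [N0 l2 L2 L0 L1] := log_size_facts.
have S0 : S !=set0.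
  apply/set0P/eqP => S0; move: muS; rewrite S0 measure0 => /eqP.
  by rewrite eq_sym onee_eq0.
have c0 : 0 < C * 16 ^+ d + C * C * 2 ^+ d.
  by rewrite addr_gt0// ?mulr_gt0// exprn_gt0.
have Ni : 0 < N^-1 by rewrite invr_gt0.
have lp : 0 < ln N ^+ d.+1 by rewrite exprn_gt0//; lra.
have [->|[v vE v0]] := volume_cases S.
  by rewrite gt0_muley ?lte_fin// !gt0_mulye ?lte_fin// leey.
have M8 : 8 <= 16 * L by lra.
have [Cv] := risk_vol S0 vE M8 (ltr01 : 0 < 1 :> R).
rewrite (integral_dist_eq0 cS muS) mule0 adde0 => /le_trans; apply.
rewrite vE -!EFinM lee_fin.
have e1 : expR (- ((16 * L) ^+ 2 / 32)) <= N^-1.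
  by rewrite -[N in leRHS]lnK ?posrE// -expRN ler_expR exprMn L2; lra.
have -> : (C * 16 ^+ d + C * C * 2 ^+ d) * v / N * ln N ^+ d.+1 =
    C * (v / N * (16 * L) ^+ d * L ^+ (d + 2) +
         L ^+ (d + 2) * (N^-1 * ((C * v) * (2 * L) ^+ d))).
  have -> : ln N ^+ d.+1 = L ^+ d * L ^+ (d + 2).
    by rewrite -[in LHS]L2 -exprM -exprD; congr (_ ^+ _); clear; lia.
  by rewrite !exprMn; ring.
rewrite ler_wpM2l ?(ltW C0)// lerD2l ler_wpM2l ?exprn_ge0//.
apply: (le_trans e1); rewrite ler_peMr ?(ltW Ni)//.
by rewrite mulr_ege1// exprn_ege1.
Qed.

(** With p = ln n and M = 8 e K p^(1 / alpha) the product of (3 / M)^p and the moment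
is at most e^-p = 1 / n. The moment condition is available for p >= 1 only; when ln n < 1 the
sample size is bounded and (e ln n)^(d / alpha) >= 1, which makes the rate itself
bounded below. *)
Lemma rate_weak_moments (S : set E) (alpha K : R) : S !=set0 -> 0 < alpha -> alpha <= 2 ->
  1 <= K ->
  (forall p : R, 1 <= p -> (dist_moment p S mu <= (K * p `^ alpha^-1)%:E)%E) ->
  (risk <= (C * 2 ^+ (d + 5) + C * 32 ^+ d + 3 * C * C)%:E * Vol (enlargement S)
             * ((K * expR alpha^-1) ^+ d)%:E * (N^-1)%:E
             * (L `^ (2 * dR / alpha + dR + 2))%:E)%E.
Proof.
move=> S0 al0 al2 K1 mom; have [N0 l2 L2 L0 L1] := log_size_facts.
set c := C * 2 ^+ (d + 5) + C * 32 ^+ d + 3 * C * C.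
have c1 : 0 < C * 2 ^+ (d + 5) by rewrite mulr_gt0// exprn_gt0.
have c2 : 0 < C * 32 ^+ d by rewrite mulr_gt0// exprn_gt0.
have c3 : 0 < 3 * C * C by rewrite !mulr_gt0.
have c0 : 0 < c by rewrite !addr_gt0.
have Ni : 0 < N^-1 by rewrite invr_gt0.
have Lp : 0 < L by lra.
have Ke : 0 < K * expR alpha^-1 by rewrite mulr_gt0 ?expR_gt0//; lra.
have [->|[v vE v0]] := volume_cases S.
  rewrite gt0_muley ?lte_fin// gt0_mulye ?lte_fin ?exprn_gt0// gt0_mulye ?lte_fin//.
  by rewrite gt0_mulye ?lte_fin ?powR_gt0// leey.
rewrite vE -!EFinM.
set D := expR (dR / alpha).
have KeD : (K * expR alpha^-1) ^+ d = K ^+ d * D by rewrite exprMn -expRM_natl.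
set Y := ln N `^ (dR / alpha).
have lN0 : 0 < ln N by lra.
have da0 : 0 <= dR / alpha by rewrite divr_ge0// ltW.
have LY : L `^ (2 * dR / alpha + dR + 2) = Y * L ^+ (d + 2).
  have nz : (L != 0) by rewrite gt_eqF.
  rewrite -addrA powRD; last by rewrite nz implybT.
  congr (_ * _); last by rewrite -natrD powR_mulrn.
  rewrite -powR12_sqrt ?(ltW lN0)// -powRrM; congr (_ `^ _).
  by field; rewrite gt_eqF.
rewrite KeD LY.
have K0 : 0 <= K by lra.
have Kd : 1 <= K ^+ d by rewrite exprn_ege1.
have D1 : 1 <= D by rewrite -expR0 ler_expR.
have L20 : 0 <= L ^+ (d + 2) by rewrite exprn_ge0.
have [lN|lN] := ltP (ln N) 1.
  apply: le_trans risk2 _; rewrite lee_fin.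
  have DY : 1 <= D * Y.
    rewrite /Y /D /powR gt_eqF// -expRD -[leLHS]expR0 ler_expR -{1}[dR / alpha]mulr1 -mulrDr.
    rewrite mulr_ge0//.
    have := @ln_le_sub1 R (ln N)^-1; rewrite lnV ?posrE// invr_gt0 => /(_ lN0).
    have : (ln N)^-1 <= 2 by rewrite -[leRHS]invrK lef_pV2 ?posrE ?invr_gt0//; lra.
    lra.
  have N4 : N <= 4.
    apply: le_trans (@expR1_le4 R); rewrite -[leLHS]lnK ?posrE// ler_expR.
    exact: ltW.
  have [Cv _] := risk_vol S0 vE (lexx 8) (ltr01 : 0 < 1 :> R).
  have PL : 1 <= 2 ^+ (d + 2) * L ^+ (d + 2) by rewrite -exprMn exprn_ege1.
  have -> : c * v * (K ^+ d * D) / N * (Y * L ^+ (d + 2)) =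
      (c * v * L ^+ (d + 2) / N) * (K ^+ d * (D * Y)) by ring.
  have KDY : 1 <= K ^+ d * (D * Y) by rewrite mulr_ege1.
  have h : 2 <= c * v * L ^+ (d + 2) / N.
    rewrite ler_pdivlMr//.
    have : 8 * ((C * v) * (2 ^+ (d + 2) * L ^+ (d + 2))) <= c * v * L ^+ (d + 2).
      have -> : 8 * ((C * v) * (2 ^+ (d + 2) * L ^+ (d + 2))) =
          C * 2 ^+ (d + 5) * v * L ^+ (d + 2).
        by rewrite -[5%N]/(2 + 3)%N addnA (exprD 2 (d + 2) 3); ring.
      by rewrite ler_wpM2r// ler_wpM2r// /c -addrA lerDl addr_ge0// ltW.
    have : 1 <= (C * v) * (2 ^+ (d + 2) * L ^+ (d + 2)) by rewrite mulr_ege1.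
    by move: N4; lra.
  by apply: (le_trans h); rewrite ler_peMr//; apply: le_trans h.
have L1' : 1 <= L by rewrite -(@ler_pXn2r _ 2)// ?nnegrE// L2 expr1n.
have Y1 : 1 <= Y by rewrite -[leLHS](powRr0 (ln N)) ler_powR.
set Z := ln N `^ alpha^-1.
have LZ : L <= Z.
  rewrite -powR12_sqrt ?(ltW lN0)// ler_powR// lef_pV2 ?posrE//.
have Z0 : 0 < Z by exact: lt_le_trans LZ.
have ZY : Z ^+ d = Y by rewrite /Z -powR_mulrn ?powR_ge0// -powRrM mulrC.
pose e1 : R := expR 1.
have e2 : 2 <= e1 by have := @expR_ge1Dx R 1; rewrite /e1; lra.
have e4 : e1 <= 4 by exact: expR1_le4.
pose M := 8 * e1 * K * Z.
have e10 : 0 < e1 by exact: expR_gt0.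
have KZ : L <= K * Z by apply: (le_trans LZ); rewrite ler_peMl// ltW.
have KZ0 : 0 < K * Z by rewrite mulr_gt0//; lra.
have M8L : 8 * L <= M.
  rewrite /M -!mulrA ler_wpM2l//; apply: (le_trans KZ).
  by rewrite ler_peMl ?(ltW KZ0)//; lra.
have M8 : 8 <= M by apply: le_trans M8L; rewrite ler_peMr.
have M0 : 0 < M by exact: lt_le_trans M8.
have [Cv] := risk_vol S0 vE M8 lN0.
have IK := integral_dist_le lN0 (ltW KZ0) (mom _ lN).
set I := (\int[mu]_theta _)%E in IK *.
move=> /le_trans; apply.
have c30 : 0 <= C * (L ^+ 2 + 1 / ln N) * (3 / M) `^ ln N.
  by rewrite !mulr_ge0 ?powR_ge0 ?(ltW C0)// addr_ge0 ?sqr_ge0// divr_ge0// ltW.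
have {}IK : ((C * (L ^+ 2 + 1 / ln N) * (3 / M) `^ ln N)%:E * I <=
    (C * (L ^+ 2 + 1 / ln N) * (3 / M) `^ ln N * (K * Z) `^ ln N)%:E)%E.
  by rewrite [leRHS]EFinM lee_wpmul2l.
apply: (le_trans (leeD (lexx _) IK)); rewrite -EFinD lee_fin.
have small : (3 / M) `^ ln N * (K * Z) `^ ln N <= N^-1.
  rewrite -powRM ?divr_ge0 ?(ltW M0) ?(ltW KZ0)//.
  have -> : 3 / M * (K * Z) = 3 / 8 * e1^-1.
    by rewrite /M; field; rewrite !gt_eqF//; lra.
  have -> : N^-1 = (e1^-1) `^ ln N.
    rewrite /powR gt_eqF ?invr_gt0// lnV ?posrE// /e1 expRK mulrN1 expRN lnK ?posrE//.
  apply: ge0_ler_powR; rewrite ?nnegrE ?(ltW lN0) ?mulr_ge0 ?invr_ge0 ?(ltW e10)//.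
  by rewrite ler_piMl ?invr_ge0 ?(ltW e10)//; lra.
have gauss : expR (- (M ^+ 2 / 32)) <= N^-1.
  rewrite -[N in leRHS]lnK ?posrE// -expRN ler_expR.
  have : (8 * L) ^+ 2 <= M ^+ 2 by rewrite lerXn2r ?nnegrE ?mulr_ge0// ltW.
  by rewrite exprMn L2; lra.
set T := v / N * (K ^+ d * D) * (Y * L ^+ (d + 2)).
have -> : c * v * (K ^+ d * D) / N * (Y * L ^+ (d + 2)) = c * T by rewrite /T; ring.
have KDY : 1 <= K ^+ d * D * Y by rewrite !mulr_ege1.
have vN0 : 0 <= v / N by rewrite divr_ge0// ltW.
have NT : L ^+ (d + 2) / N <= C * T.
  have -> : C * T = L ^+ (d + 2) / N * ((C * v) * (K ^+ d * D * Y)) by rewrite /T; ring.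
  by rewrite ler_peMr ?divr_ge0 ?(ltW N0)// mulr_ege1.
have T0 : 0 <= T.
  by rewrite /T !mulr_ge0 ?invr_ge0 ?powR_ge0 ?exprn_ge0 ?expR_ge0.
have t1 : v / N * M ^+ d * L ^+ (d + 2) <= 32 ^+ d * T.
  have -> : M ^+ d = (8 * e1) ^+ d * (K ^+ d * Y).
    by rewrite /M -mulrA exprMn (exprMn _ K) ZY.
  have -> : v / N * ((8 * e1) ^+ d * (K ^+ d * Y)) * L ^+ (d + 2) =
     (8 * e1) ^+ d * (v / N * K ^+ d * (Y * L ^+ (d + 2))) by ring.
  apply: ler_pM.
  - by rewrite exprn_ge0// mulr_ge0// ltW.
  - by rewrite !mulr_ge0 ?invr_ge0 ?powR_ge0 ?exprn_ge0.
  - by apply: lerXn2r; rewrite ?nnegrE ?mulr_ge0 ?(ltW e10)//; lra.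
  - apply: ler_wpM2r; first by rewrite mulr_ge0 ?powR_ge0.
    by rewrite ler_wpM2l// ler_peMr// (le_trans _ Kd).
have t2 : L ^+ (d + 2) * expR (- (M ^+ 2 / 32)) <= C * T.
  by apply: le_trans NT; rewrite ler_wpM2l.
have t3 : (L ^+ 2 + 1 / ln N) * ((3 / M) `^ ln N * (K * Z) `^ ln N) <= 2 * (C * T).
  apply: (@le_trans _ _ (2 * L ^+ (d + 2) * N^-1)); last by rewrite -mulrA ler_wpM2l.
  apply: ler_pM => //.
  - by rewrite addr_ge0 ?sqr_ge0// divr_ge0// ltW.
  - by rewrite mulr_ge0 ?powR_ge0.
  - have : L ^+ 2 <= L ^+ (d + 2) by rewrite ler_weXn2l// leq_addl.
    have h1 : 1 / ln N <= 1 by rewrite ler_pdivrMr// mul1r.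
    have h2 : 1 <= L ^+ (d + 2) by rewrite exprn_ege1.
    by move=> h3; rewrite mulr_natl mulr2n lerD// (le_trans h1).
have -> : C * (L ^+ 2 + 1 / ln N) * (3 / M) `^ ln N * (K * Z) `^ ln N =
  C * ((L ^+ 2 + 1 / ln N) * ((3 / M) `^ ln N * (K * Z) `^ ln N)) by ring.
by apply: (three_terms_le _ _ t1 t2 t3); [exact: ltW|rewrite mulr_ge0// ltW].
Qed.

(** The first two summands pay for the cases settled by H^2 <= 2, and the last one for
the three terms of the general bound. *)
Definition moment_rate_constant (mu0 p : R) : R :=
  let k := (Num.truncn (p * (dR + 1))).+1 in
  8 * 8 `^ p + 2 +
  C * (1 + 3 ^+ d * (32 ^+ k * k`!%:R) + (1 + 4 / p) * (3 * mu0) `^ p).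

Lemma moment_rate_constant_gt0 mu0 p : 0 < p -> 0 < moment_rate_constant mu0 p.
Proof.
move=> p0; rewrite /moment_rate_constant; set k := (Num.truncn _).+1.
have h1 : 0 < 8 * 8 `^ p + 2 by rewrite addr_gt0// mulr_gt0// powR_gt0.
apply: (lt_le_trans h1); rewrite lerDl.
rewrite mulr_ge0 ?(ltW C0)// !addr_ge0 ?mulr_ge0 ?exprn_ge0 ?powR_ge0//.
by rewrite addr_ge0// divr_ge0// ltW.
Qed.

(** The radius M is such that the first and third terms are multiples of the rate. If
the rate is less than 1 then L^2 <= M^p, so that the powers of L in the Gaussian
term become powers of M and are absorbed by e^(-M^2 / 32). *)
Lemma rate_one_moment (S : set E) (mu0 p : R) : S !=set0 -> 0 < mu0 -> 0 < p ->
  (dist_moment p S mu <= mu0%:E)%E ->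
  (risk <= (moment_rate_constant mu0 p)%:E
             * (Vol (enlargement S) * (N^-1)%:E) `^ (p / (p + dR))
             * (L `^ ((2 * dR + 2 * p + dR * p) / (p + dR)))%:E)%E.
Proof.
move=> S0 mu00 p0 mom; have [N0 l2 L2 L0 L1] := log_size_facts.
have C30 := moment_rate_constant_gt0 mu0 p0.
set C3 := moment_rate_constant mu0 p in C30 *.
have dR0 : 0 <= dR by exact: ler0n.
have pd : 0 < p + dR by rewrite ltr_pwDl.
have Ni : 0 < N^-1 by rewrite invr_gt0.
have Lp : 0 < L by lra.
have ex0 : 0 < p / (p + dR) by rewrite divr_gt0.
have [->|[v vE v0]] := volume_cases S.
  rewrite gt0_mulye ?lte_fin// poweRyr ?gt_eqF// gt0_muley ?lte_fin//.
  by rewrite gt0_mulye ?lte_fin ?powR_gt0// leey.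
rewrite vE -!EFinM.
have [Cv _] := risk_vol S0 vE (lexx 8) (ltr01 : 0 < 1 :> R).
have vp : 0 < v.
  by rewrite lt_neqAle v0 andbT; apply/eqP => v00; move: Cv; rewrite -v00 mulr0 ler10.
pose x := v / N * L ^+ d.
have x0 : 0 < x by rewrite !mulr_gt0// exprn_gt0.
pose M := x `^ (- (p + dR)^-1).
have M0 : 0 < M by exact: powR_gt0.
(* T is the rate, written with the radius M at which the first and third terms
   of the general bound agree. *)
pose T := L ^+ 2 * M `^ (- p).
have T0 : 0 < T by rewrite mulr_gt0 ?exprn_gt0// powR_gt0.
have pd0 : p + dR != 0 by rewrite gt_eqF.
have -> : C3 * (v / N) `^ (p / (p + dR)) *
    L `^ ((2 * dR + 2 * p + dR * p) / (p + dR)) = C3 * T.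
  have Lnz : (L != 0) by rewrite gt_eqF.
  have vN : 0 <= v / N by rewrite divr_ge0// ltW.
  rewrite /T /M -powRrM.
  have -> : - (p + dR)^-1 * - p = p / (p + dR) by rewrite mulrNN mulrC.
  rewrite /x (powRM _ vN) ?exprn_ge0//.
  have -> : (L ^+ d) `^ (p / (p + dR)) = L `^ (dR * p / (p + dR)).
    by rewrite -powR_mulrn// -powRrM mulrA.
  have -> : L ^+ 2 = L `^ 2 by rewrite powR_mulrn.
  have -> : (2 * dR + 2 * p + dR * p) / (p + dR) = 2 + dR * p / (p + dR).
    by field.
  rewrite powRD ?Lnz ?implybT//; ring.
have Mx : x * M ^+ d = M `^ (- p).
  rewrite -powR_mulrn ?(ltW M0)// /M -!powRrM -{1}[x]powRr1 ?(ltW x0)// -powRD.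
    by congr (_ `^ _); field.
  by rewrite (gt_eqF x0) implybT.
have lC3 : 2 <= C3 /\ 8 * 8 `^ p <= C3.
  have h8 : 0 <= 8 * 8 `^ p by rewrite mulr_ge0 ?powR_ge0.
  have hC : 0 <= C * (1 + 3 ^+ d * (32 ^+ (Num.truncn (p * (dR + 1))).+1 *
     ((Num.truncn (p * (dR + 1))).+1)`!%:R) + (1 + 4 / p) * (3 * mu0) `^ p).
    rewrite mulr_ge0 ?(ltW C0)// !addr_ge0 ?mulr_ge0 ?exprn_ge0 ?powR_ge0//.
    by rewrite addr_ge0// divr_ge0// ltW.
  split; rewrite /C3 /moment_rate_constant.
    by rewrite -addrA addrCA lerDl addr_ge0.
  by rewrite -addrA lerDl addr_ge0.
have L2h : 1 <= 4 * L ^+ 2 by lra.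
have [M8|M8] := ltP M 8.
  apply: le_trans risk2 _; rewrite lee_fin.
  apply: (@le_trans _ _ (8 * 8 `^ p * T)); last by rewrite ler_wpM2r ?(ltW T0)//; case: lC3.
  have h : 8 `^ (- p) <= M `^ (- p).
    rewrite !powRN lef_pV2 ?posrE ?powR_gt0//.
    by apply: ge0_ler_powR; rewrite ?nnegrE ?(ltW p0) ?(ltW M0)// ltW.
  have -> : 8 * 8 `^ p * T = 2 * ((4 * L ^+ 2) * (8 `^ p * M `^ (- p))) by rewrite /T; ring.
  rewrite ler_peMr// mulr_ege1//.
  apply: (@le_trans _ _ (8 `^ p * 8 `^ (- p))); last by rewrite ler_wpM2l ?powR_ge0.
  by rewrite powRN divff// gt_eqF// powR_gt0.
have [T1|T1] := leP 1 T.
  apply: le_trans risk2 _; rewrite lee_fin.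
  apply: (@le_trans _ _ C3); first by case: lC3.
  by rewrite ler_peMr// ltW.
have Mp : 0 < M `^ p by exact: powR_gt0.
have L2M : L ^+ 2 <= M `^ p.
  by move: T1; rewrite /T powRN -ltr_pdivlMr ?invr_gt0// invrK mul1r => /ltW.
have M1 : 1 <= M by apply: le_trans M8; rewrite ler1n.
have Mp1 : 1 <= M `^ p by rewrite -[leLHS](powRr0 M) ler_powR// ltW.
have [_] := risk_vol S0 vE M8 p0 => /le_trans; apply.
have IK := integral_dist_le p0 (ltW mu00) mom.
set I := (\int[mu]_theta _)%E in IK *.
have c30 : 0 <= C * (L ^+ 2 + 1 / p) * (3 / M) `^ p.
  by rewrite !mulr_ge0 ?powR_ge0 ?(ltW C0)// addr_ge0 ?sqr_ge0// divr_ge0// ltW.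
have {}IK : ((C * (L ^+ 2 + 1 / p) * (3 / M) `^ p)%:E * I <=
    (C * (L ^+ 2 + 1 / p) * (3 / M) `^ p * mu0 `^ p)%:E)%E.
  by rewrite [leRHS]EFinM lee_wpmul2l.
apply: (le_trans (leeD (lexx _) IK)); rewrite -EFinD lee_fin.
set k := (Num.truncn (p * (dR + 1))).+1.
have t1 : v / N * M ^+ d * L ^+ (d + 2) = T by rewrite exprD /T -Mx /x; ring.
have t2 : L ^+ (d + 2) * expR (- (M ^+ 2 / 32)) <= 3 ^+ d * (32 ^+ k * k`!%:R) * T.
  have -> : L ^+ (d + 2) * expR (- (M ^+ 2 / 32)) =
      T * (L ^+ d * M `^ p * expR (- (M ^+ 2 / 32))).
    by rewrite /T powRN exprD; field; rewrite gt_eqF.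
  rewrite mulrC ler_wpM2r ?(ltW T0)//.
  have Ld : L ^+ d <= 3 ^+ d * M `^ (p * dR).
    rewrite powRrM powR_mulrn ?powR_ge0// -exprMn.
    apply: lerXn2r; rewrite ?nnegrE ?mulr_ge0 ?powR_ge0//.
    have : 0 <= (L - 1) ^+ 2 by exact: sqr_ge0.
    by move: L2M Mp1; nra.
  have kp : p * (dR + 1) <= k%:R.
    have pd1 : 0 <= p * (dR + 1) by rewrite mulr_ge0 ?addr_ge0// ltW.
    by have /andP[_ /ltW] := truncn_itv pd1.
  have Mk : M `^ (p * dR) * M `^ p <= M ^+ (2 * k).
    rewrite -powRD; last by rewrite (gt_eqF M0) implybT.
    apply: (@le_trans _ _ (M ^+ k)); last by rewrite ler_weXn2l// leq_pmull.
    by rewrite -powR_mulrn ?(ltW M0)// ler_powR//; lra.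
  have x2 : 0 <= M ^+ 2 / 32 by rewrite divr_ge0 ?sqr_ge0.
  have := exprn_le_expR k x2; rewrite expr_div_n ler_pdivrMr ?exprn_gt0// -exprM => hk.
  rewrite expRN ler_pdivrMr ?expR_gt0//.
  apply: (@le_trans _ _ (3 ^+ d * (M `^ (p * dR) * M `^ p))).
    by rewrite mulrA ler_wpM2r// ltW.
  rewrite -(mulrA (3 ^+ d)) ler_wpM2l ?exprn_ge0//; apply: (le_trans Mk); apply: (le_trans hk).
  by rewrite mulrC mulrA.
have t3 : (L ^+ 2 + 1 / p) * ((3 / M) `^ p * mu0 `^ p) <= (1 + 4 / p) * (3 * mu0) `^ p * T.
  have -> : (3 / M) `^ p * mu0 `^ p = (3 * mu0) `^ p * M `^ (- p).
    have <- : M^-1 `^ p = M `^ (- p) 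
      by rewrite -(powR_inv1 (ltW M0)) -powRrM mulN1r.
    have h3 : 0 <= 3 :> R by exact: ler0n.
    have Mi0 : 0 <= M^-1 by rewrite invr_ge0 ltW.
    by rewrite (powRM p h3 Mi0) (powRM p h3 (ltW mu00)) mulrAC.
  have -> : (1 + 4 / p) * (3 * mu0) `^ p * T =
     ((1 + 4 / p) * L ^+ 2) * ((3 * mu0) `^ p * M `^ (- p)) by rewrite /T; ring.
  rewrite ler_wpM2r ?mulr_ge0 ?powR_ge0//.
  have : p^-1 <= p^-1 * (4 * L ^+ 2) by rewrite ler_peMr// invr_ge0 ltW.
  lra.
rewrite t1.
have a2 := ler_wpM2l (ltW C0) t2.
have a3 := ler_wpM2l (ltW C0) t3.
have a0 : 0 <= (8 * 8 `^ p + 2) * T by rewrite mulr_ge0 ?(ltW T0)// addr_ge0// mulr_ge0 ?powR_ge0.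
move: a0 a2 a3; rewrite /C3 /moment_rate_constant -/k.
set u := L ^+ (d + 2) * _; set q1 := 3 ^+ d * _; set q2 := (1 + 4 / p) * _ => a0 a2 a3.
have -> : C * (L ^+ 2 + 1 / p) * (3 / M) `^ p * mu0 `^ p =
  C * ((L ^+ 2 + 1 / p) * ((3 / M) `^ p * mu0 `^ p)) by ring.
have -> : (8 * 8 `^ p + 2 + C * (1 + q1 + q2)) * T =
  (8 * 8 `^ p + 2) * T + (C * T + C * (q1 * T) + C * (q2 * T)) by ring.
rewrite (mulrDr C T u) -[leLHS]add0r lerD// lerD// lerD2l//.
Qed.

End rates.

Section volume_risk.
Context {R : realType}.
Variables (d : nat) (d1 : (0 < d)%N).
Local Notation E := 'rV[R]_d.
Local Notation Vol := (lebesgue_rV d).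

Lemma eq_integral_average (n : nat) (G : 'I_n -> probability E R) (Gp : probability E R)
    (f : E -> \bar R) : (forall A, Gp A = average_measure G A) ->
  (\int[Gp]_theta f theta = \int[average_measure G]_theta f theta)%E.
Proof. by move=> GpE; apply: eq_measure_integral => A mA _; exact: GpE. Qed.

(** The net of the packing lemma turns the number of points into a volume. The lower
bound on C * v allows terms without v to be absorbed. *)
Theorem risk_le_volume : exists C : R, 0 < C /\ forall (n : nat) (dO : measure_display)
    (Omega : measurableType dO) (P : probability Omega R) (G : 'I_n -> probability E R)
    (X : 'I_n -> {RV P >-> E}) (fhat : Omega -> E -> R) (Gp : probability E R),
  (1 < n)%N -> mutually_independent X ->
  (forall i, has_density (X i) (mixture_density (G i))) ->
  (forall w, is_NPMLE (fun i => X i w) (fhat w)) ->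
  (forall A, Gp A = average_measure G A) ->
  forall (S : set E) (v M p : R),
  S !=set0 -> Vol (enlargement S) = v%:E -> 8 <= M -> 0 < p ->
  1 <= C * v /\
  ('E_P[fun w => hellinger2 (fhat w) (mixture_density (average_measure G))] <=
   (C * (v / n%:R * M ^+ d * Num.sqrt (ln n%:R) ^+ (d + 2) +
         Num.sqrt (ln n%:R) ^+ (d + 2) * expR (- (M ^+ 2 / 32))))%:E +
   (C * (Num.sqrt (ln n%:R) ^+ 2 + 1 / p) * (3 / M) `^ p)%:E *
     \int[Gp]_theta (dist_to S theta `^ p)%:E)%E.
Proof.
have [C' [C'0 H]] := @risk_le_net R d d1.
pose q : R := (2 * d%:R) ^+ d.
have q1 : 1 <= q.
  by rewrite exprn_ege1// -natrM ler1n muln_gt0.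
have q0 : 0 < q by exact: lt_le_trans q1.
exists ((C' + 1) * q); split; first by rewrite mulr_gt0// addr_gt0.
set C := (C' + 1) * q.
have C'C : C' <= C.
  by rewrite /C mulrDl mul1r (@le_trans _ _ (C' * q))// ?ler_peMr ?(ltW C'0)// lerDl ltW.
move=> n dO Omega P G X fhat Gp n1 indX densX npmle GpE S v M p S0 vE M8 p0.
have Vfin : (Vol (enlargement S) < +oo)%E by rewrite vE ltry.
have [m [s [m0 mv net]]] := packing d1 S0 Vfin.
have {}mv : m%:R <= q * v.
  by move: mv; rewrite vE lee_fin exprVn -/q ler_pdivrMr// mulrC.
have m1 : 1 <= m%:R :> R by rewrite ler1n.
have v0 : 0 <= v by rewrite -(pmulr_rge0 _ q0); apply: le_trans mv.
split.
  apply: (le_trans m1); apply: (le_trans mv); rewrite ler_wpM2r// /C mulrDl mul1r.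
  by rewrite lerDr mulr_ge0// ltW.
set L := Num.sqrt _.
have L0 : 0 <= L by exact: sqrtr_ge0.
have M0 : 0 <= M by exact: le_trans M8.
apply: le_trans (H n dO Omega P G X fhat S m s M p L n1 indX densX npmle S0 m0 M8 p0 net erefl) _.
rewrite (eq_integral_average _ GpE).
apply: leeD.
  rewrite lee_fin !mulrDr; apply: lerD; last by rewrite ler_wpM2r// mulr_ge0 ?exprn_ge0 ?expR_ge0.
  have A0 : 0 <= M ^+ d * L ^+ (d + 2) by rewrite mulr_ge0 ?exprn_ge0.
  have n0 : 0 <= n%:R^-1 :> R by rewrite invr_ge0.
  have -> : C' * (m%:R / n%:R * M ^+ d * L ^+ (d + 2)) =
    C' * m%:R * (n%:R^-1 * (M ^+ d * L ^+ (d + 2))) by ring.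
  have -> : C * (v / n%:R * M ^+ d * L ^+ (d + 2)) =
    C * v * (n%:R^-1 * (M ^+ d * L ^+ (d + 2))) by ring.
  have B0 : 0 <= n%:R^-1 * (M ^+ d * L ^+ (d + 2)) by rewrite mulr_ge0.
  rewrite ler_wpM2r//.
  have -> : C * v = (C' + 1) * (q * v) by rewrite /C mulrA.
  apply: ler_pM; rewrite ?(ltW C'0)//.
  by rewrite lerDl.
apply: lee_wpmul2r.
  by apply: integral_ge0 => t _; rewrite lee_fin powR_ge0.
rewrite lee_fin; apply: ler_wpM2r; first exact: powR_ge0.
apply: ler_wpM2r => //; rewrite addr_ge0 ?sqr_ge0//.
by rewrite mulr_ge0// invr_ge0 ltW.
Qed.

End volume_risk.

Theorem corollary2p2 (R : realType) (d : nat) (d_ge1 : (1 <= d)%N) :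
  exists (C : R) (C3 : R -> R -> R),
  [/\ 0 < C,
      forall mu p : R, 0 < mu -> 0 < p -> 0 < C3 mu p &
      forall (n : nat) (n_ge2 : (2 <= n)%N)
        (dO : measure_display) (Omega : measurableType dO)
        (P : probability Omega R)
        (G : 'I_n -> probability 'rV[R]_d R)
        (X : 'I_n -> {RV P >-> 'rV[R]_d})
        (fhat : Omega -> 'rV[R]_d -> R),
      mutually_independent X ->
      (forall i, has_density (X i) (mixture_density (G i))) ->
      (forall w, is_NPMLE (fun i => X i w) (fhat w)) ->
      let Gbar : {measure set 'rV[R]_d -> \bar R} := average_measure G in
      let risk : \bar R :=
        ('E_P[fun w => hellinger2 (fhat w) (mixture_density Gbar)])%E in
      let Vol : set 'rV[R]_d -> \bar R := lebesgue_rV d in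
      [/\ forall S : set 'rV[R]_d,
            compact S -> Gbar S = 1%E ->
            (risk <= C%:E * Vol (enlargement S) * (n%:R^-1)%:E
                     * (ln n%:R ^+ d.+1)%:E)%E,
          forall (S : set 'rV[R]_d) (alpha K : R),
            compact S -> S !=set0 -> 0 < alpha -> alpha <= 2 -> 1 <= K ->
            (forall p : R, 1 <= p ->
               (dist_moment p S Gbar <= (K * p `^ alpha^-1)%:E)%E) ->
            (risk <= C%:E * Vol (enlargement S)
                     * ((K * expR alpha^-1) ^+ d)%:E * (n%:R^-1)%:E
                     * (Num.sqrt (ln n%:R)
                          `^ (2 * d%:R / alpha + d%:R + 2))%:E)%E
        & forall (S : set 'rV[R]_d) (mu p : R),
            compact S -> S !=set0 -> 0 < mu -> 0 < p ->
            (dist_moment p S Gbar <= mu%:E)%E ->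
            (risk <= (C3 mu p)%:E
                     * (Vol (enlargement S) * (n%:R^-1)%:E) `^ (p / (p + d%:R))
                     * (Num.sqrt (ln n%:R)
                          `^ ((2 * d%:R + 2 * p + d%:R * p) / (p + d%:R)))%:E)%E]].
Proof.
have [C [C0 H]] := @risk_le_volume R d d_ge1.
pose c1 := C * 16 ^+ d + C * C * 2 ^+ d.
pose c2 := C * 2 ^+ (d + 5) + C * 32 ^+ d + 3 * C * C.
have c10 : 0 < c1 by rewrite addr_gt0// ?mulr_gt0// exprn_gt0.
have c20 : 0 < c2 by rewrite !addr_gt0// ?mulr_gt0// exprn_gt0.
exists (c1 + c2), (moment_rate_constant d C); split.
- exact: addr_gt0.
- by move=> mu p _ p0; exact: moment_rate_constant_gt0.
move=> n n_ge2 dO Omega P G X fhat indX densX npmle Gbar risk Vol.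
have n0 : (0 < n)%N by exact: ltnW.
have [Gp GpE] := average_measure_probability G n0.
have risk2 : (risk <= 2%:E)%E := risk_le2 G n0 npmle.
have Hvol := H n dO Omega P G X fhat Gp n_ge2 indX densX npmle GpE.
have momE p S : dist_moment p S Gbar = dist_moment p S Gp.
  by rewrite /dist_moment (eq_integral_average _ GpE).
have V0 S : (0 <= Vol (enlargement S))%E by exact: measure_ge0.
have ni : 0 <= n%:R^-1 :> R by rewrite invr_ge0.
split.
- move=> S cS GS; rewrite -[Gbar S]GpE in GS.
  apply: le_trans (rate_compact_support C0 n_ge2 Hvol cS GS) _.
  have l0 : 0 <= ln n%:R ^+ d.+1 :> R by rewrite exprn_ge0// ln_ge0// ler1n.
  by rewrite !lee_wpmul2r ?lee_fin// lerDl ltW.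
- move=> S alpha K cS S0 al0 al2 K1 mom.
  have mom' p : 1 <= p -> (dist_moment p S Gp <= (K * p `^ alpha^-1)%:E)%E.
    by move=> p1; rewrite -momE; exact: mom.
  apply: le_trans (rate_weak_moments C0 n_ge2 risk2 Hvol S0 al0 al2 K1 mom') _.
  have k0 : 0 <= (K * expR alpha^-1) ^+ d.
    by rewrite exprn_ge0// mulr_ge0 ?expR_ge0// (le_trans _ K1).
  by rewrite !lee_wpmul2r ?lee_fin ?powR_ge0// lerDr ltW.
- move=> S mu p cS S0 mu0 p0; rewrite momE => mom.
  apply: le_trans (rate_one_moment C0 n_ge2 risk2 Hvol S0 mu0 p0 mom) _.
  exact: lexx.
Qed.
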